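(* For every integer $d\ge 2$, the critical fugacity of the hard sphere model on $\mathbb{R}^d$ satisfies $\lambda_c(d)\ge 2^{1-d}$.
   Context: Fix a dimension $d$ and let $r=r_d>0$ be the radius for which a ball of radius $r$ in $\mathbb{R}^d$ has volume $1$. For a bounded measurable set $\Lambda\subset\mathbb{R}^d$ let $\Lambda_{\mathrm{Int}}=\{x\in\Lambda:\mathrm{dist}(x,\Lambda^c)\ge r\}$. The hard sphere model on $\Lambda$ at fugacity $\lambda\ge 0$ (with free boundary conditions) is the law $\mu_{\Lambda,\lambda}$ of a Poisson point process $\mathbf X$ of intensity $\lambda$ on $\Lambda_{\mathrm{Int}}$ conditioned on the event that all points are at pairwise distance at least $2r$. Equivalently, it is the probability measure on finite point configurations whose $k$-point part has density $\frac{1}{Z_\Lambda(\lambda)}\frac{\lambda^k}{k!}\prod_{1\le i<j\le k}\mathbf 1_{\|x_i-x_j\|\ge 2r}$ on $\Lambda_{\mathrm{Int}}^k$ with respect to Lebesgue measure, where $Z_{\Lambda}(\lambda)=\sum_{k\ge0}\int_{\Lambda_{\mathrm{Int}}^k}\frac{\lambda^k}{k!}\prod_{i<j}\mathbf 1_{\|x_i-x_j\|\ge 2r}\prod_i dx_i$. The critical fugacity $\lambda_c(d)\in[0,\infty]$ is the supremum over $\lambda$ such that the hard sphere model at fugacity $\lambda$ has a unique infinite volume limit in the sense of van Hove, i.e. such that the set of weak limit points of $\{\mu_{\Lambda,\lambda}\}_\Lambda$ as $\Lambda\to\mathbb{R}^d$ is a singleton. Here weak limit points are taken among laws of locally finite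 point configurations on $\mathbb{R}^d$, and $\Lambda\to\mathbb{R}^d$ in the sense of van Hove means along sequences of bounded measurable sets that eventually contain every bounded set and for which, for every $\ell>0$, the volume of the $\ell$-neighbourhood of the boundary of $\Lambda$ is $o(|\Lambda|)$. *)

(* Defs.v *)
From HB Require Import structures.
From mathcomp Require Import all_boot all_order all_algebra.
From mathcomp Require Import all_classical all_reals all_analysis.
From mathcomp Require Import measurable_realfun ring lra.

Set Implicit Arguments.
Unset Strict Implicit.
Unset Printing Implicit Defensive.

Import Order.TTheory GRing.Theory Num.Theory.
Import numFieldNormedType.Exports.

Local Open Scope classical_set_scope.
Local Open Scope ring_scope.

(* An alias of 'rV[R]_d, because the norm the library puts on 'rV[R]_d is the
   sup norm. *)
Definition euclidean (R : realType) (d : nat) : Type := 'rV[R]_d.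

Section euclidean_norm.
Context {R : realType} {d : nat}.
Implicit Types x y : 'rV[R]_d.

Definition euclidean_norm x : R := Num.sqrt (\sum_(i < d) x ord0 i ^+ 2).

Let sqsum_ge0 x : 0 <= \sum_(i < d) x ord0 i ^+ 2.
Proof. by apply: sumr_ge0 => i _; exact: sqr_ge0. Qed.

Let cauchy_schwarz x y :
  \sum_(i < d) x ord0 i * y ord0 i <= euclidean_norm x * euclidean_norm y.
Proof.
set b := \sum_(i < d) _; rewrite /euclidean_norm -sqrtrM//.
set a := \sum_(i < d) _; set c := \sum_(i < d) _.
suff : b ^+ 2 <= a * c.
  move=> bac; apply: (le_trans (ler_norm _)).
  by rewrite -sqrtr_sqr ler_wsqrtr.
have : 0 <= \sum_(i < d) (c * x ord0 i - b * y ord0 i) ^+ 2.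
  by apply: sumr_ge0 => i _; exact: sqr_ge0.
rewrite (eq_bigr (fun i => c ^+ 2 * x ord0 i ^+ 2
    + (- (2 * c * b) * (x ord0 i * y ord0 i) + b ^+ 2 * y ord0 i ^+ 2)));
  last by move=> i _; ring.
rewrite !big_split/= -!mulr_sumr -/a -/b -/c => H.
have := sqsum_ge0 y; rewrite -/c le_eqVlt => /predU1P[c0|c0].
  suff -> : b = 0 by rewrite expr0n/= mulr_ge0 ?sqsum_ge0.
  rewrite /b big1// => i _.
  have /eqP := esym c0; rewrite psumr_eq0; last by move=> *; exact: sqr_ge0.
  move=> /allP/(_ i); rewrite mem_index_enum => /(_ isT)/=.
  by rewrite sqrf_eq0 => /eqP ->; rewrite mulr0.
have : 0 <= c * (a * c - b ^+ 2) by apply: (le_trans H); lra.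
by rewrite pmulr_rge0// subr_ge0.
Qed.

Lemma euclidean_normD x y :
  euclidean_norm (x + y) <= euclidean_norm x + euclidean_norm y.
Proof.
have n0 z : 0 <= euclidean_norm z by exact: sqrtr_ge0.
have sq z : euclidean_norm z ^+ 2 = \sum_(i < d) z ord0 i ^+ 2.
  by rewrite sqr_sqrtr.
rewrite -[leRHS]ger0_norm ?addr_ge0// -sqrtr_sqr ler_wsqrtr//.
rewrite (eq_bigr (fun i => x ord0 i ^+ 2
    + (2 * (x ord0 i * y ord0 i) + y ord0 i ^+ 2))); last first.
  by move=> i _; rewrite mxE; ring.
rewrite !big_split/= -mulr_sumr -!sq.
have := cauchy_schwarz x y; lra.
Qed.

Lemma euclidean_normZ (a : R) x :
  euclidean_norm (a *: x) = `|a| * euclidean_norm x.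
Proof.
rewrite /euclidean_norm -sqrtr_sqr -sqrtrM ?sqr_ge0// mulr_sumr.
by congr Num.sqrt; apply: eq_bigr => i _; rewrite mxE exprMn.
Qed.

Lemma euclidean_norm_eq0 x : euclidean_norm x = 0 -> x = 0.
Proof.
move=> /eqP; rewrite sqrtr_eq0 => x0; apply/rowP => i; rewrite mxE.
have /eqP : \sum_(i < d) x ord0 i ^+ 2 = 0.
  by apply/eqP; rewrite eq_le x0 sqsum_ge0.
rewrite psumr_eq0; last by move=> *; exact: sqr_ge0.
move=> /allP/(_ i); rewrite mem_index_enum => /(_ isT)/=.
by rewrite sqrf_eq0 => /eqP.
Qed.

End euclidean_norm.

HB.instance Definition _ (R : realType) (d : nat) :=
  GRing.Lmodule.copy (euclidean R d) 'rV[R]_d.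
HB.instance Definition _ (R : realType) (d : nat) :=
  @Lmodule_isNormed.Build R (euclidean R d) euclidean_norm
    euclidean_normD euclidean_normZ euclidean_norm_eq0.

Definition euclidean_display : measure_display.
Proof. exact: default_measure_display. Qed.

HB.instance Definition _ (R : realType) (d : nat) :=
  @isMeasurable.Build euclidean_display (euclidean R d)
    <<s @open (euclidean R d) >>
    (@sigma_algebra0 _ _ _) (@sigma_algebraC _ _) (@sigma_algebra_bigcup _ _ _).

Definition pushforward_measure {d d'} {T : measurableType d}
    {T' : measurableType d'} {R : realType} (m : {measure set T -> \bar R})
    (f : T -> T') (mf : measurable_fun setT f) : {measure set T' -> \bar R} :=
  measure_function_pushforward__canonical__measure_function_Measure m mf.

Section measure_power.
Context {d} {T : measurableType d} {R : realType}.

Definition tuple_cons n (p : T * n.-tuple T) : n.+1.-tuple T :=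
  [tuple of p.1 :: p.2].

Let measurable_tuple_cons n : measurable_fun setT (@tuple_cons n).
Proof. by apply: measurable_cons. Qed.

Let measurable_uncons n :
  measurable_fun setT (fun t : n.+1.-tuple T => (thead t, [tuple of behead t])).
Proof.
apply/measurable_fun_pair => /=.
- exact: measurable_tnth.
- exact: measurable_behead.
Qed.

Variable mu : {sigma_finite_measure set T -> \bar R}.

Definition measure_cons n (nu : {sigma_finite_measure set (n.-tuple T) -> \bar R})
    (A : set (n.+1.-tuple T)) : \bar R :=
  (mu \x nu)%E (@tuple_cons n @^-1` A).

Section measure_cons.
Variables (n : nat) (nu : {sigma_finite_measure set (n.-tuple T) -> \bar R}).

Let M : {measure set (n.+1.-tuple T) -> \bar R} :=
  pushforward_measure (mu \x nu)%E (@measurable_tuple_cons n).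

HB.instance Definition _ := isMeasure.Build _ _ _ (measure_cons nu)
  (measure0 M) (measure_ge0 M) (@measure_semi_sigma_additive _ _ _ M).

Let measure_cons_sigma_finite : sigma_finite setT (measure_cons nu).
Proof.
have /sigma_finiteP[F [TF ndF Foo]] := sigma_finiteT mu.
have /sigma_finiteP[G [TG ndG Goo]] := sigma_finiteT nu.
pose uncons (t : n.+1.-tuple T) := (thead t, [tuple of behead t]).
exists (fun k => uncons @^-1` (F k `*` G k)).
  rewrite predeqE => t; split=> // _.
  have [i _ Fi] : (\bigcup_i F i) (thead t) by rewrite -TF.
  have [j _ Gj] : (\bigcup_i G i) [tuple of behead t] by rewrite -TG.
  exists (maxn i j) => //; split => /=.
  - by move: Fi; exact/subsetPset/ndF/leq_maxl.
  - by move: Gj; exact/subsetPset/ndG/leq_maxr.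
move=> k; have [mF Fk] := Foo k; have [mG Gk] := Goo k; split.
  rewrite -[X in measurable X]setTI.
  by apply: measurable_uncons => //; exact: measurableX.
rewrite /measure_cons (_ : _ @^-1` _ = F k `*` G k); last first.
  rewrite -comp_preimage (_ : _ \o _ = id)//.
  by apply/funext => -[x t] /=; congr pair; exact/val_inj.
by rewrite product_measure1E// lte_mul_pinfty// ge0_fin_numE.
Qed.

HB.instance Definition _ :=
  Measure_isSigmaFinite.Build _ _ _ (measure_cons nu) measure_cons_sigma_finite.

End measure_cons.

(* The n-fold product measure of mu. *)
Fixpoint measure_power n : {sigma_finite_measure set (n.-tuple T) -> \bar R} :=
  if n is m.+1 then measure_cons (measure_power m) else \d_([tuple]).

End measure_power.

Section lebesgue_euclidean.
Context {R : realType} {d : nat}.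

Definition point_of_tuple (t : d.-tuple R) : euclidean R d :=
  (\row_(i < d) tnth t i)%R.

Let normE (x : euclidean R d) : `|x| = Num.sqrt (\sum_(i < d) x ord0 i ^+ 2).
Proof. by []. Qed.

Let le_coord_norm (x : euclidean R d) i : `|x ord0 i| <= `|x|.
Proof.
rewrite normE -sqrtr_sqr ler_wsqrtr//.
by rewrite (bigD1 i)//= lerDl; apply: sumr_ge0 => j _; exact: sqr_ge0.
Qed.

Let norm_le_sum_coord (x : euclidean R d) : `|x| <= \sum_(i < d) `|x ord0 i|.
Proof.
have s0 : 0 <= \sum_(i < d) `|x ord0 i| by exact: sumr_ge0.
rewrite normE -[leRHS]ger0_norm// -sqrtr_sqr ler_wsqrtr//.
rewrite expr2 mulr_suml; apply: ler_sum => i _.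
rewrite -real_normK ?num_real// expr2 ler_wpM2l// (bigD1 i)//= lerDl.
exact: sumr_ge0.
Qed.

Lemma continuous_coord (i : 'I_d) : continuous (fun x : euclidean R d => x ord0 i).
Proof.
move=> x; apply/(@cvgrPdist_lt _ R _ (nbhs x) (nbhs_filter x)) => e e0; near=> y.
have -> : x ord0 i - y ord0 i = (x - y : euclidean R d) ord0 i.
  by rewrite !mxE.
apply: (le_lt_trans (le_coord_norm _ _)).
by near: y; apply/nbhs_ballP; exists e => //= z; rewrite -ball_normE.
Unshelve. all: end_near. Qed.

Lemma open_euclidean_measurable (U : set (euclidean R d)) : open U -> measurable U.
Proof. exact: sub_sigma_algebra. Qed.

Lemma closed_euclidean_measurable (U : set (euclidean R d)) : closed U -> measurable U.
Proof.
by move=> /closed_openC/open_euclidean_measurable/measurableC; rewrite setCK.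
Qed.

Lemma measurable_coord (i : 'I_d) :
  measurable_fun setT (fun x : euclidean R d => x ord0 i).
Proof.
apply: (measurability _ (RGenOpens.measurableE R)) => //.
move=> _ [_ [a [b ->] <-]]; rewrite setTI; apply: open_euclidean_measurable.
by apply: open_comp; [move=> ? _; exact: continuous_coord|exact: interval_open].
Qed.

Lemma measurable_point_of_tuple : measurable_fun setT point_of_tuple.
Proof.
apply: (measurability (@open (euclidean R d))) => //.
move=> _ [U oU <-]; rewrite setTI.
pose box (p : d.-tuple rat * nat) : set (d.-tuple R) :=
  [set t | forall i, `|tnth t i - ratr (tnth p.1 i)| < p.2.+1%:R^-1].
have mbox p : measurable (box p).
  rewrite (_ : box p = \bigcap_(i in [set: 'I_d])
      ((fun t : d.-tuple R => tnth t i) @^-1`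
        ball (ratr (tnth p.1 i) : R) p.2.+1%:R^-1)); last first.
    rewrite predeqE => t; split => [bt i _ /=|bt i].
      by rewrite -ball_normE/= distrC; exact: bt.
    by have := bt i Logic.I; rewrite /= -ball_normE/= distrC.
  apply: fin_bigcap_measurable => // i _.
  rewrite -[X in measurable X]setTI.
  by apply: measurable_tnth => //; exact: measurable_ball.
pose F k := if @unpickle (d.-tuple rat * nat)%type k is Some p then
  (if `[< box p `<=` point_of_tuple @^-1` U >] then box p else set0) else set0.
rewrite (_ : _ @^-1` _ = \bigcup_k F k).
  apply: bigcupT_measurable => k; rewrite /F.
  by case: unpickle => // p; case: ifPn.
rewrite predeqE => t; split => [Ut|[k _]]; last first.
  by rewrite /F; case: unpickle => // p; case: asboolP => // bU /bU.
have [e /= e0 eU] : exists2 e : R, 0 < e & ball (point_of_tuple t) e `<=` U.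
  by have /nbhs_ballP := oU _ Ut.
have [n ne] : exists n, d%:R * (2 * n.+1%:R^-1) < e.
  have [n] : exists n, d%:R * 2 / e < n%:R.
    by exists (Num.truncn (d%:R * 2 / e)).+1; exact: truncnS_gt.
  rewrite ltr_pdivrMr// => H; exists n.
  rewrite mulrA ltr_pdivrMr//; apply: (lt_le_trans H).
  by rewrite mulrC ler_wpM2l ?(ltW e0)// ler_nat.
have /choice[q qP] : forall i, exists q : rat,
    `|tnth t i - ratr q| < n.+1%:R^-1.
  move=> i; have : tnth t i - n.+1%:R^-1 < tnth t i + n.+1%:R^-1.
    by rewrite ltrD2l gtrN// invr_gt0.
  move=> /rat_in_itvoo[q]; rewrite in_itv/= => /andP[q1 q2]; exists q.
  move: q1 q2; move: (n.+1%:R^-1 : R) => w q1 q2.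
  by rewrite ltr_norml; apply/andP; split; lra.
pose p : d.-tuple rat * nat := ([tuple q i | i < d], n).
exists (pickle p) => //; rewrite /F pickleK asboolT.
  by move=> i; rewrite tnth_mktuple.
move=> s bs; apply: eU; rewrite -ball_normE/=; apply: le_lt_trans ne.
apply: (le_trans (norm_le_sum_coord _)).
rewrite -[d in leRHS]card_ord -sumr_const mulr_suml; apply: ler_sum => i _.
rewrite mul1r !mxE.
have := bs i; rewrite /= tnth_mktuple => {}bs.
rewrite (_ : _ - _ = (tnth t i - ratr (q i)) - (tnth s i - ratr (q i))); last by ring.
apply: (le_trans (ler_normB _ _)); have := qP i.
by move: bs; move: (n.+1%:R^-1 : R) => w; lra.
Qed.

End lebesgue_euclidean.

Section lebesgue_euclidean_measure.
Context {R : realType} {d : nat}.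

Definition lebesgue_euclidean (A : set (euclidean R d)) : \bar R :=
  measure_power lebesgue_measure d (point_of_tuple @^-1` A).

Let M : {measure set (euclidean R d) -> \bar R} :=
  pushforward_measure (measure_power lebesgue_measure d)
    measurable_point_of_tuple.

HB.instance Definition _ := isMeasure.Build _ _ _ lebesgue_euclidean
  (measure0 M) (measure_ge0 M) (@measure_semi_sigma_additive _ _ _ M).

Let lebesgue_euclidean_sigma_finite : sigma_finite setT lebesgue_euclidean.
Proof.
have [F FT Ffin] := sigma_finiteT (measure_power (@lebesgue_measure R) d).
pose coords (x : euclidean R d) : d.-tuple R := [tuple x ord0 i | i < d].
have pointK : cancel point_of_tuple coords.
  by move=> t; apply: eq_from_tnth => i; rewrite tnth_mktuple mxE.
exists (fun k => coords @^-1` F k); first by rewrite -preimage_bigcup -FT.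
move=> k; split.
  rewrite -[X in measurable X]setTI.
  have mcoords : measurable_fun setT coords.
    apply/measurable_fun_tnthP => i.
    rewrite (_ : _ \o _ = fun x : euclidean R d => x ord0 i).
      exact: measurable_coord.
    by apply/funext => x /=; rewrite tnth_mktuple.
  by apply: mcoords => //; exact: (Ffin k).1.
rewrite /lebesgue_euclidean -comp_preimage (_ : _ \o _ = id).
  exact: (Ffin k).2.
by apply/funext => t /=; rewrite pointK.
Qed.

HB.instance Definition _ := Measure_isSigmaFinite.Build _ _ _
  lebesgue_euclidean lebesgue_euclidean_sigma_finite.

End lebesgue_euclidean_measure.

Arguments lebesgue_euclidean R d : clear implicits.

Section configuration.
Context {R : realType} {d : nat}.

Definition locally_finite (X : set (euclidean R d)) : Prop :=
  forall B, bounded_set B -> finite_set (X `&` B).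

Record configuration : Type := Configuration {
  points :> set (euclidean R d);
  points_locally_finite : locally_finite points }.

HB.instance Definition _ := gen_eqMixin configuration.
HB.instance Definition _ := gen_choiceMixin configuration.

Let locally_finite0 : locally_finite set0.
Proof. by move=> B _; rewrite set0I; exact: finite_set0. Qed.

Definition empty_configuration : configuration := Configuration locally_finite0.

HB.instance Definition _ := isPointed.Build configuration empty_configuration.

Definition test_function : Type :=
  {f : euclidean R d -> R |
    continuous f /\ exists2 K, compact K & forall x, ~ K x -> f x = 0}.

(* The sum is finite: the support of f is bounded and X is locally finite. *)
Definition vague_coordinates (X : configuration) :
    prod_topology (fun _ : test_function => R) :=
  fun f => \sum_(x \in (X : set _)) sval f x.

HB.instance Definition _ :=
  Topological.copy configuration (initial_topology vague_coordinates).

(* The sigma-algebra they generate is the usual one for point processes, and is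
   also the Borel sigma-algebra of the vague topology. *)
Definition counting_events : set (set configuration) :=
  [set A | exists (B : set (euclidean R d)) (n : nat),
    [/\ measurable B, bounded_set B &
    A = [set X : configuration | (X `&` B #= `I_n)%card]]].

Definition configuration_display : measure_display.
Proof. exact: default_measure_display. Qed.

HB.instance Definition _ := @isMeasurable.Build configuration_display
  configuration <<s counting_events >>
  (@sigma_algebra0 _ _ _) (@sigma_algebraC _ _) (@sigma_algebra_bigcup _ _ _).

Let locally_finite_tuple k (x : k.-tuple (euclidean R d)) :
  locally_finite [set` x].
Proof. by move=> B _; apply: finite_setIl; exact: finite_seq. Qed.

Definition configuration_of_tuple k (x : k.-tuple (euclidean R d)) :
  configuration := Configuration (locally_finite_tuple x).

End configuration.

Arguments configuration R d : clear implicits.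

Section measurable_configuration_of_tuple.
Context {R : realType} {d k : nat}.
Local Notation E := (euclidean R d).

Let measurable_coincide (i j : 'I_k) :
  measurable [set x : k.-tuple E | tnth x i = tnth x j].
Proof.
rewrite (_ : [set _ | _] = \bigcap_(l in [set: 'I_d])
    [set x : k.-tuple E | tnth x i ord0 l = tnth x j ord0 l]).
  apply: fin_bigcap_measurable => // l _.
  pose c (i : 'I_k) (x : k.-tuple E) : R := tnth x i ord0 l.
  have mc m : measurable_fun setT (c m).
    apply: (measurableT_comp (measurable_coord l)).
    exact: measurable_tnth.
  have := measurable_fun_eqr (mc i) (mc j).
  move=> /(_ measurableT [set true] Logic.I).
  by rewrite setTI; congr measurable; rewrite predeqE => x; split=> /eqP.
rewrite predeqE => x; split=> [/= ij l _ /=|ij]; first by rewrite ij.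
by apply/rowP => l; exact: (ij l Logic.I).
Qed.

Let first_hits (B : set E) (x : k.-tuple E) : {set 'I_k} :=
  [set i | (tnth x i \in B) &&
    [forall j : 'I_k, (j < i)%N ==> (tnth x j != tnth x i)]].

Let card_first_hits B x :
  ([set` x] `&` B #= `I_#|first_hits B x|)%card.
Proof.
have -> : [set` x] `&` B = tnth x @` [set` first_hits B x].
  rewrite predeqE => y; split=> [[/= yx By]|[i /=]]; last first.
    by rewrite inE => /andP[/set_mem Bi _] <-; split=> //; exact: mem_tnth.
  have : exists i : 'I_k, tnth x i == y.
    by have /tnthP[i ->] := yx; exists i.
  case=> i0 hi0.
  have [i /eqP xi imin] := @arg_minnP _ i0 (fun i => tnth x i == y)
    (fun i : 'I_k => val i) hi0.
  exists i => //=; rewrite inE xi mem_set//=.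
  apply/forallP => j; apply/implyP => ji; apply/negP => xj.
  by have := imin j xj; rewrite leqNgt ji.
apply: (@card_eq_trans _ _ _ _ [set` first_hits B x]).
  apply: inj_card_eq => i j /set_mem + /set_mem.
  rewrite /= !inE => /andP[_ /forallP Hi] /andP[_ /forallP Hj] ij.
  apply/val_inj; case: (ltngtP i j) => // lt_ij.
  - by have := Hj i; rewrite lt_ij ij eqxx.
  - by have := Hi j; rewrite lt_ij ij eqxx.
move: (first_hits B x) => J.
case: (pickP (mem J)) => [i0 _|J0]; last first.
  have -> : [set` J] = set0 by rewrite -subset0 => i /= iJ; have := J0 i; rewrite inE/= iJ.
  by rewrite (eq_card0 J0) II0 card_eq0.
have -> : [set` J] = nth i0 (enum J) @` `I_#|J|.
  rewrite predeqE => i; split=> [/= iJ|[m /= mJ <-]].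
    exists (index i (enum J)); last by rewrite nth_index// mem_enum.
    by rewrite /= cardE index_mem mem_enum.
  by rewrite /= -mem_enum mem_nth// -cardE.
apply: inj_card_eq => m n /set_mem/= mJ /set_mem/= nJ /eqP.
by rewrite nth_uniq ?enum_uniq -?cardE// => /eqP.
Qed.


Lemma measurable_configuration_of_tuple :
  measurable_fun setT (@configuration_of_tuple R d k).
Proof.
apply: (measurability (@counting_events R d)) => //.
move=> _ [_ [B [n [mB _ ->]]] <-]; rewrite setTI.
rewrite (_ : _ @^-1` _ = \bigcup_(J in [set J : {set 'I_k} | #|J| = n])
    \bigcap_(i in [set: 'I_k])
      [set x : k.-tuple E | (i \in first_hits B x) = (i \in J)]).
  apply: fin_bigcup_measurable => // J _.
  apply: fin_bigcap_measurable => // i _.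
  have mhit : measurable [set x : k.-tuple E | i \in first_hits B x].
    rewrite (_ : [set _ | _] = ((fun x => tnth x i) @^-1` B) `&`
      \bigcap_(j in [set j : 'I_k | (j < i)%N])
        ~` [set x : k.-tuple E | tnth x j = tnth x i]).
      apply: measurableI.
        by rewrite -[X in measurable X]setTI; exact: measurable_tnth.
      apply: fin_bigcap_measurable => // j _; exact/measurableC.
    rewrite predeqE => x; split=> /=; rewrite inE.
      move=> /andP[/set_mem Bx /forallP H]; split => // j /= ji /eqP.
      exact/negP/(implyP (H j)).
    move=> [Bx H]; rewrite mem_set//=; apply/forallP => j; apply/implyP => ji.
    by apply/eqP; exact: H.
  case: (i \in J) => //.
  rewrite (_ : [set _ | _] = ~` [set x : k.-tuple E | i \in first_hits B x]).
    exact: measurableC.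
  by rewrite predeqE => x; split=> /= [->|/negP/negbTE].
rewrite predeqE => x; split=> /= [H|[J Jn H]].
  exists (first_hits B x) => //=.
  apply/card_eq_II; apply: card_eq_trans H.
  by rewrite card_eq_sym; exact: card_first_hits.
have HJ : first_hits B x = J by apply/setP => i; exact: (H i Logic.I).
rewrite -Jn -HJ; exact: card_first_hits.
Qed.

End measurable_configuration_of_tuple.

Section hard_spheres.
Context {R : realType} {d : nat}.
Local Notation E := (euclidean R d).

(* For 0 < d there is exactly one such r, so the default value 1 is not used. *)
Definition unit_volume_radius : {posnum R} :=
  xget 1%:pos
    [set r : {posnum R} | lebesgue_euclidean R d (ball 0 r%:num) = 1%E].

Local Notation r := (unit_volume_radius%:num : R).

Definition inner_region (L : set E) : set E :=
  [set x | L x /\ (r%:E <= edist_inf (~` L) x)%E].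

Definition hard_sphere_tuples (L : set E) (k : nat) : set (k.-tuple E) :=
  [set x | (forall i, inner_region L (tnth x i)) /\
    forall i j : 'I_k, (i < j)%N -> 2 * r <= `|tnth x i - tnth x j|].
Arguments hard_sphere_tuples L k _ : clear implicits.

(* The product of the indicators of |x_i - x_j| >= 2r on the k-th power of the
   inner region is the indicator of hard_sphere_tuples L k, so the density is
   written as a restriction to this set. The total mass is the partition
   function Z. *)
Definition hard_sphere_weight (lambda : {nonneg R}) (L : set E)
    (A : set (configuration R d)) : \bar R :=
  (\sum_(k <oo) (lambda%:num ^+ k / k`!%:R)%:E *
    measure_power (lebesgue_euclidean R d) k
      (hard_sphere_tuples L k `&` @configuration_of_tuple R d k @^-1` A))%E.

Lemma inner_region_measurable L : measurable (inner_region L).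
Proof.
apply: closed_euclidean_measurable.
rewrite (_ : inner_region L = edist_inf (~` L) @^-1` [set y | (r%:E <= y)%E]).
  apply: closed_comp => [x _|]; first exact: edist_inf_continuous.
  exact: closed_ereal_le_ereal.
rewrite predeqE => x; split=> [[]//|/= rx]; split => //.
apply: contrapT => Lx; move: rx; rewrite edist_inf0//.
by rewrite lee_fin leNgt => /negP; exact.
Qed.

Let measurable_distance k (i j : 'I_k) :
  measurable_fun setT (fun x : k.-tuple E => `|tnth x i - tnth x j| : R).
Proof.
rewrite (_ : (fun _ => _) = fun x : k.-tuple E => Num.sqrt
    (\sum_(l < d) (tnth x i ord0 l - tnth x j ord0 l) ^+ 2)); last first.
  apply/funext => x; rewrite [LHS]/(Num.sqrt _); congr Num.sqrt.
  by apply: eq_bigr => l _; rewrite !mxE.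
apply: measurableT_comp.
  by apply: continuous_measurable_fun; exact: sqrt_continuous.
apply: measurable_sum => l; apply: measurable_funX; apply: measurable_funB;
  by apply: (measurableT_comp (measurable_coord l)); exact: measurable_tnth.
Qed.

Lemma hard_sphere_tuples_measurable L k : measurable (hard_sphere_tuples L k).
Proof.
rewrite (_ : hard_sphere_tuples L k =
  (\bigcap_(i in [set: 'I_k]) ((fun x => tnth x i) @^-1` inner_region L)) `&`
  (\bigcap_(i in [set: 'I_k]) \bigcap_(j in [set j : 'I_k | (i < j)%N])
    (fun x : k.-tuple E => `|tnth x i - tnth x j|) @^-1` `[2 * r, +oo[)).
  apply: measurableI.
    apply: fin_bigcap_measurable => // i _.
    rewrite -[X in measurable X]setTI; apply: measurable_tnth => //.
    exact: inner_region_measurable.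
  apply: fin_bigcap_measurable => // i _.
  apply: fin_bigcap_measurable => // j _.
  by rewrite -[X in measurable X]setTI; exact: measurable_distance.
rewrite predeqE => x; split=> -[H1 H2]; split.
- by move=> i _; exact: H1.
- by move=> i _ j /= ij; rewrite in_itv/= andbT; exact: H2.
- by move=> i; exact: H1.
- by move=> i j ij; have := H2 i Logic.I j ij; rewrite /= in_itv/= andbT.
Qed.

Section hard_sphere_measure.
Variables (lambda : {nonneg R}) (L : set E).

Let coef_ge0 k : 0 <= lambda%:num ^+ k / k`!%:R.
Proof. by rewrite divr_ge0// exprn_ge0. Qed.

Let M : {measure set (configuration R d) -> \bar R} :=
  mseries (fun k => mscale (NngNum (coef_ge0 k))
    (pushforward_measure
      (mrestr (measure_power (lebesgue_euclidean R d) k)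
        (@hard_sphere_tuples_measurable L k))
      measurable_configuration_of_tuple)) 0.

Let weightE : hard_sphere_weight lambda L = M.
Proof.
apply/funext => A; apply: eq_eseriesr => k _.
by rewrite setIC.
Qed.

Let weight0 : hard_sphere_weight lambda L set0 = 0%E.
Proof. by rewrite weightE measure0. Qed.

Let weight_ge0 A : (0 <= hard_sphere_weight lambda L A)%E.
Proof. by rewrite weightE. Qed.

Let weight_sigma_additive : semi_sigma_additive (hard_sphere_weight lambda L).
Proof. by rewrite weightE; exact: measure_semi_sigma_additive. Qed.

HB.instance Definition _ := isMeasure.Build _ _ _
  (hard_sphere_weight lambda L) weight0 weight_ge0 weight_sigma_additive.

(* For bounded L we have 1 <= Z < +oo (the term k = 0 is 1), so the second
   argument of mnormalize, a fallback for Z = 0 and Z = +oo, is not used. *)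
Definition hard_sphere : probability (configuration R d) R :=
  mnormalize (hard_sphere_weight lambda L) \d_(empty_configuration).

End hard_sphere_measure.

Definition boundary (L : set E) : set E := closure L `\` interior L.

Definition van_hove (L : nat -> set E) : Prop :=
  [/\ forall n, bounded_set (L n) /\ measurable (L n),
      forall B, bounded_set B -> \forall n \near \oo, B `<=` L n &
      forall l : R, 0 < l ->
        (fun n => fine (lebesgue_euclidean R d
          [set x | (edist_inf (boundary (L n)) x <= l%:E)%E]) : R^o) =o_\oo
        (fun n => fine (lebesgue_euclidean R d (L n)) : R^o)].

Definition weak_limit (P : nat -> probability (configuration R d) R)
    (Q : probability (configuration R d) R) : Prop :=
  forall F : configuration R d -> R, continuous F ->
    (exists M : R, forall X, `|F X| <= M) ->
    (\int[P n]_X (F X)%:E)%E @[n --> \oo] --> (\int[Q]_X (F X)%:E)%E.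

Definition infinite_volume_limit (lambda : {nonneg R})
    (Q : probability (configuration R d) R) : Prop :=
  exists2 L : nat -> set E,
    van_hove L & weak_limit (fun n => hard_sphere lambda (L n)) Q.

(* Laws are compared on events only, because the library's probabilities are
   functions defined on all sets. *)
Definition unique_infinite_volume_limit (lambda : {nonneg R}) : Prop :=
  exists2 Q, infinite_volume_limit lambda Q &
    forall Q', infinite_volume_limit lambda Q' ->
      forall A, measurable A -> Q' A = Q A.

End hard_spheres.

Definition critical_fugacity (R : realType) (d : nat) : \bar R :=
  ereal_sup [set lambda%:num%:E | lambda in
    [set lambda : {nonneg R} | @unique_infinite_volume_limit R d lambda]].

(* Main.v *)
(* For a region [W], let Z(W) be the partition function of the hard-core gas on W
   and let V(W, B) = Z(W \ B) / Z(W) be the probability that B is empty. A set A of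
   diameter less than 2r contains at most one particle, so
     Z(W) / Z(W \ A) = 1 + lambda * int_(A & W) V(W \ A, B(w, 2r)) dw.
   This writes - ln V(W, B) in terms of the numbers V(W', B(w, 2r)) for smaller
   regions W' and w in B. If two regions agree on a large ball around v, an additive
   error c on these numbers becomes an error lambda * 2^d * c on - ln V, hence a
   multiplicative error exp(lambda * 2^d * c) on the numbers V themselves; applied
   once more, the identity multiplies - ln V by at most exp(lambda * 2^d * c), and
   since the derivative of t |-> exp(- exp t) is at most 1/2 in absolute value, the
   numbers V(W, B(v, 2r)) change by at most (lambda * 2^d / 2) * c. For
   lambda < 2^(1-d) this is a contraction, so void probabilities converge along
   every van Hove sequence to a limit that does not depend on the sequence.
   Void probabilities of bounded open sets determine a law, and by inner
   approximation of open sets by compact ones every weak limit has the limiting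
   void probabilities: this is uniqueness. For existence, an ultrafilter limit of
   the finite-volume laws is a finitely additive law on the algebra generated by the
   void events; compactness of the hard-core configurations makes it extend to a
   probability, and finite unions of void-and-hit events approximate vaguely open
   sets from inside, which turns convergence of the void probabilities into weak
   convergence. *)
From HB Require Import structures.
Require Import Defs.
From mathcomp Require Import all_boot all_order all_algebra finmap.
From mathcomp Require Import all_classical all_reals all_analysis.
From mathcomp Require Import measurable_realfun ring lra zify.

Set Implicit Arguments.
Unset Strict Implicit.
Unset Printing Implicit Defensive.

Import Order.TTheory GRing.Theory Num.Theory.
Import numFieldNormedType.Exports.

Local Open Scope classical_set_scope.
Local Open Scope ring_scope.

(** * The cluster identity for hard-core partition functions *)

(** The factor [2 ^ d] is the volume of a ball of radius [2r], because a ball of radius [r] has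
    volume 1. A direct Lipschitz estimate of the void probabilities would contract only for
    fugacities below [2^(-d)]; measuring the error on [ln (- ln V)] gains the remaining factor 2.
    The cluster identity cuts away cliques one after the other, so it leads to regions with
    irregular measurable pieces removed. The estimates therefore range over all measurable regions
    of finite volume, not only over balls. In the vague topology, avoiding an open set and hitting a
    compact set are closed conditions, but an open set and a compact set inside it differ. This gap
    is controlled everywhere by one bound, [V(W, B) >= 1 - lambda |B|], which is uniform in [W] and
    serves both existence and uniqueness. *)

Section hard_core_volume.
Context {d} {T : measurableType d} {R : realType}.
Variable mu : {sigma_finite_measure set T -> \bar R}.
Variable excl : set (T * T).
Hypothesis mexcl : measurable excl.
Hypothesis exclC : forall x y, excl (x, y) -> excl (y, x).
Local Open Scope ereal_scope.

Local Notation N := (xsection excl).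

(** The measure of the ordered [k]-tuples in [W] no two of which exclude each other, computed by
    placing one particle and deleting its neighbourhood. The recursion lets an induction on [k]
    range over all regions. *)
Fixpoint hcvol k (W : set T) : \bar R :=
  if k is k'.+1 then \int[mu]_(w in W) hcvol k' (W `\` N w) else 1.

Lemma hcvol_ge0 k W : 0 <= hcvol k W.
Proof. by elim: k W => [|k IH] W //=; apply: integral_ge0. Qed.
Hint Resolve hcvol_ge0 : core.

Lemma measurable_excl w : measurable (N w).
Proof. exact: measurable_xsection. Qed.
Hint Resolve measurable_excl : core.

(** The induction step absorbs the position of the placed particle into the parameter, so all
    parameter spaces [S] have to be treated at once. *)
Lemma measurable_hcvol_xsection k d' (S : measurableType d') (A : set (S * T)) :
  measurable A -> measurable_fun setT (fun s => hcvol k (xsection A s)).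
Proof.
elim: k d' S A => [|k IH] d' S A mA /=; first exact: measurable_cst.
pose A' : set ((S * T) * T) :=
  [set p | A (p.1.1, p.2)] `\` [set p | excl (p.1.2, p.2)].
have mA' : measurable A'.
  apply: measurableD.
    rewrite -[X in measurable X]setTI.
    have mf : measurable_fun setT (fun p : (S * T) * T => (p.1.1, p.2)).
      exact: (measurable_fun_pair (measurableT_comp measurable_fst measurable_fst) measurable_snd).
    by exact: mf.
  rewrite -[X in measurable X]setTI.
  have mf : measurable_fun setT (fun p : (S * T) * T => (p.1.2, p.2)).
    exact: (measurable_fun_pair (measurableT_comp measurable_snd measurable_fst) measurable_snd).
  by exact: mf.
have A'E p : xsection A' p = xsection A p.1 `\` N p.2.
  rewrite predeqE => x; split.
    by move=> /xsectionP [/= ? ?]; split; [apply/xsectionP|move=> /xsectionP].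
  by move=> [/xsectionP ? n]; apply/xsectionP; split => //= ?; apply/n/xsectionP.
have mg := IH _ _ A' mA'.
pose g := (fun p : S * T => hcvol k (xsection A' p)).
have mgA : measurable_fun setT (g \_ A) by apply/(measurable_restrictT _ _).1 => //; exact: measurable_funTS.
have := @measurable_fun_fubini_tonelli_F _ _ S T R mu (g \_ A) mgA.
move=> H; apply: (eq_measurable_fun (fubini_F mu (g \_ A))).
  move=> s _; rewrite /fubini_F [RHS]integral_mkcond; apply: eq_integral => w _.
  rewrite !patchE mem_xsection; case: ifPn => // _.
  by rewrite /g A'E.
apply: H => x; rewrite patchE; case: ifPn => // _; exact: hcvol_ge0.
Qed.

Lemma measurable_hcvolD k W : measurable W ->
  measurable_fun setT (fun w => hcvol k (W `\` N w)).
Proof.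
move=> mW; apply: (eq_measurable_fun
    (fun w => hcvol k (xsection ((setT `*` W) `\` excl) w))).
  by move=> w _; rewrite xsectionD in_xsectionX ?inE.
by apply: measurable_hcvol_xsection; apply: measurableD => //; exact: measurableX.
Qed.

Lemma le_hcvol k W W' : measurable W -> measurable W' -> W `<=` W' ->
  hcvol k W <= hcvol k W'.
Proof.
elim: k W W' => //= k IH W W' mW mW' WW'.
apply: (@le_trans _ _ (\int[mu]_(w in W) hcvol k (W' `\` N w))).
  apply: ge0_le_integral => //.
  - exact/measurable_funTS/measurable_hcvolD.
  - exact/measurable_funTS/measurable_hcvolD.
  - move=> w Ww; apply: IH; [exact: measurableD|exact: measurableD|].
    exact: setSD.
by apply: ge0_subset_integral => //; exact/measurable_funTS/measurable_hcvolD.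
Qed.

Lemma hcvol_le_expe k W : measurable W -> hcvol k W <= mu W ^+ k.
Proof.
elim: k W => [|k IH] W mW; first by rewrite expe0.
rewrite expeS/=.
apply: (@le_trans _ _ (\int[mu]_(w in W) (cst (mu W ^+ k) w))).
  apply: ge0_le_integral => //.
  - exact/measurable_funTS/measurable_hcvolD.
  - move=> w Ww; apply: (le_trans _ (IH W mW)); apply: le_hcvol => //.
    exact: measurableD.
by rewrite integral_cst// muleC.
Qed.

(** At most one particle lies in the clique [A], and by symmetry it can be any of the [k.+1].
    Symmetry is obtained by induction: when the first particle [w] is outside [A], the induction
    hypothesis for [A] minus its neighbourhood extracts the particle in [A], and Tonelli puts that
    one first. *)
Lemma hcvol_cluster k A W : measurable A -> measurable W -> A `<=` W ->
  A `*` A `<=` excl ->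
  hcvol k.+1 W = hcvol k.+1 (W `\` A) +
    k.+1%:R%:E * \int[mu]_(w in A) hcvol k ((W `\` A) `\` N w).
Proof.
elim: k A W => [|k IH] A W mA mW AW AA.
  rewrite -[W in LHS](setDKU AW) /= ge0_integral_setU//.
  - by rewrite mul1e addeC.
  - exact: measurableD.
  - by apply/disj_setPS => x [[]].
have mWA : measurable (W `\` A) by exact: measurableD.
rewrite [LHS]/= -[W in X in integral _ X _](setDKU AW) setUC ge0_integral_setU//; last 3 first.
- exact/measurable_funTS/(@measurable_hcvolD k.+1).
- by move=> x _; exact: (@hcvol_ge0 k.+1).
- by apply/disj_setPS => x [? []].
(* For [x] in the clique [A], all of [A] lies in [N x], so deleting [A] as well changes nothing. *)
have -> : \int[mu]_(x in A) hcvol k.+1 (W `\` N x) =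
    \int[mu]_(x in A) hcvol k.+1 (W `\` A `\` N x).
  apply: eq_integral => w /set_mem Aw; congr hcvol.
  rewrite predeqE => x; split; last by move=> [[]].
  move=> [Wx Nx]; split=> //; split=> // Ax; apply: Nx; apply/xsectionP.
  exact: AA.
have sq w : (W `\` A) w ->
    hcvol k.+1 (W `\` N w) = hcvol k.+1 ((W `\` A) `\` N w) +
      k.+1%:R%:E * \int[mu]_(u in A `\` N w) hcvol k (((W `\` A) `\` N u) `\` N w).
  move=> WAw; rewrite (IH (A `\` N w)).
  - have -> : W `\` N w `\` (A `\` N w) = W `\` A `\` N w.
      rewrite predeqE => x; split.
        by move=> [[Wx Nx] h]; split=> //; split=> // Ax; apply: h.
      by move=> [[Wx Ax] Nx]; split=> // -[].
    by congr (_ + _ * _); apply: eq_integral => u _; rewrite !(setDE _ (N _)) setIAC.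
  - exact: measurableD.
  - exact: measurableD.
  - exact: setSD.
  - by move=> [x y] [[/= Ax _] [Ay _]]; apply: AA.
rewrite (eq_integral (fun w => hcvol k.+1 ((W `\` A) `\` N w) +
      k.+1%:R%:E * \int[mu]_(u in A `\` N w) hcvol k (((W `\` A) `\` N u) `\` N w))); last first.
  by move=> w /set_mem; exact: sq.
(* The integrand in both positions, [p.1] outside [A] and [p.2] inside, extended by zero so that
   Tonelli applies on the whole product. *)
pose h := (fun p : T * T => hcvol k (((W `\` A) `\` N p.2) `\` N p.1)) \_
  (((W `\` A) `*` A) `\` excl).
have h0 p : 0 <= h p by rewrite /h patchE; case: ifPn.
have mh : measurable_fun setT h.
  apply/(measurable_restrictT _ _).1.
    by apply: measurableD => //; exact: measurableX.
  apply: measurable_funTS.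
  pose B : set ((T * T) * T) :=
    ([set p | (W `\` A) p.2] `\` [set p | excl (p.1.2, p.2)]) `\`
       [set p | excl (p.1.1, p.2)].
  have mB : measurable B.
    apply: measurableD; first apply: measurableD.
    - rewrite -[X in measurable X]setTI.
      by apply: (@measurable_snd _ _ (T * T)%type T).
    - rewrite -[X in measurable X]setTI.
      have mf : measurable_fun setT (fun p : (T * T) * T => (p.1.2, p.2)).
        exact: (measurable_fun_pair (measurableT_comp measurable_snd measurable_fst) measurable_snd).
      by exact: mf.
    - rewrite -[X in measurable X]setTI.
      have mf : measurable_fun setT (fun p : (T * T) * T => (p.1.1, p.2)).
        exact: (measurable_fun_pair (measurableT_comp measurable_fst measurable_fst) measurable_snd).
      by exact: mf.
  apply: (eq_measurable_fun (fun p => hcvol k (xsection B p))).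
    move=> p _; congr hcvol; rewrite predeqE => x; split.
      move=> /xsectionP[[/= ? ?] ?]; split; [split => //|].
      - by move=> /xsectionP.
      - by move=> /xsectionP.
    move=> [[? h1] h2]; apply/xsectionP; split; [split => //=|].
    - by move=> ?; apply/h1/xsectionP.
    - by move=> ?; apply/h2/xsectionP.
  exact: measurable_hcvol_xsection.
have hF w : (W `\` A) w -> \int[mu]_(u in A `\` N w)
    hcvol k (((W `\` A) `\` N u) `\` N w) = fubini_F mu h w.
  move=> WAw; rewrite integral_mkcond; apply: eq_integral => u _.
  rewrite !patchE; congr (if _ then _ else _); apply/idP/idP => /set_mem H;
    apply/mem_set; case: H.
    by move=> Au Nu; split => //= e; apply: Nu; apply/xsectionP.
  by move=> [_ Au] e; split=> // /xsectionP.
rewrite ge0_integralD//; first last.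
- apply: (eq_measurable_fun (fun w => k.+1%:R%:E * fubini_F mu h w)).
    by move=> w /set_mem /hF ->.
  apply: measurable_funeM; apply: measurable_funTS.
  exact: measurable_fun_fubini_tonelli_F.
- by move=> w _; apply: mule_ge0 => //; apply: integral_ge0.
- exact/measurable_funTS/measurable_hcvolD.
rewrite -[X in _ + (X + _)]/(hcvol k.+2 (W `\` A)) addeCA; congr (_ + _).
(* The summand 1 stands for the first particle being in [A], [k.+1] for one of the others. *)
rewrite [in RHS](_ : k.+2%:R = 1 + k.+1%:R)%R; last by rewrite -natr1 addrC.
rewrite EFinD ge0_muleDl//.
rewrite mul1e; congr (_ + _).
rewrite (eq_integral (fun w => k.+1%:R%:E * fubini_F mu h w)); last first.
  by move=> w /set_mem /hF ->.
rewrite ge0_integralZl//; first last.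
- by move=> w _; apply: integral_ge0.
- exact/measurable_funTS/measurable_fun_fubini_tonelli_F.
congr (_ * _).
have -> : \int[mu]_(w in W `\` A) fubini_F mu h w = \int[mu]_w fubini_F mu h w.
  rewrite integral_mkcond; apply: eq_integral => w _.
  rewrite patchE; case: ifPn => // /negP wWA; rewrite /fubini_F.
  rewrite integral0_eq// => u _; rewrite /h patchE ifF//.
  apply/negP => /set_mem[[/= H _] _]; apply: wWA; exact: mem_set.
have -> : \int[mu]_(x in A) \int[mu]_(w in W `\` A `\` N x)
     hcvol k (W `\` A `\` N x `\` N w) = \int[mu]_u fubini_G mu h u.
  rewrite [LHS]integral_mkcond; apply: eq_integral => u _.
  rewrite patchE; case: ifPn => [/set_mem Au|/negP uA]; last first.
    rewrite /fubini_G integral0_eq// => w _; rewrite /h patchE ifF//.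
    apply/negP => /set_mem[[/= _ H] _]; apply: uA; exact: mem_set.
  rewrite integral_mkcond; apply: eq_integral => w _.
  rewrite !patchE; congr (if _ then _ else _); apply/idP/idP => /set_mem H;
    apply/mem_set; case: H.
    move=> WAw Nu; split => //= e; apply: Nu; apply/xsectionP; exact: exclC.
  by move=> [WAw _] e; split => // /xsectionP /exclC.
by rewrite fubini_tonelli.
Qed.

End hard_core_volume.

(** * Inequalities for the logarithm and the exponential *)

Section real_inequalities.
Context {R : realType}.
Implicit Types x y k u : R.

Lemma ln_lipschitz_ge1 x y : 1 <= x -> 1 <= y -> `|ln x - ln y| <= `|x - y|.
Proof.
wlog xy : x y / y <= x.
  move=> H x1 y1; have [yx|/ltW xy] := leP y x; first exact: H.
  by rewrite distrC [leRHS]distrC; exact: H.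
move=> x1 y1; have x0 : 0 < x by lra.
have y0 : 0 < y by lra.
rewrite !ger0_norm ?subr_ge0// ?ler_ln ?posrE// -ln_div ?posrE//.
rewrite (_ : x / y = 1 + (x / y - 1)); last by lra.
apply: (le_trans (le_ln1Dx _)).
  by have := divr_gt0 x0 y0; lra.
have -> : x / y - 1 = (x - y) / y by field; rewrite gt_eqF.
by rewrite ler_pdivrMr// ler_peMr// subr_ge0.
Qed.

(* Concavity of the logarithm, through its tangent line at [1 + x]. *)
Lemma ln_bernoulli k x : 1 <= k -> 0 <= x -> ln (1 + k * x) <= k * ln (1 + x).
Proof.
move=> k1 x0.
have k0 : 0 <= k by lra.
have kx0 : 0 <= k * x by rewrite mulr_ge0.
have a0 : 0 < 1 + x by lra.
have tangent y : 0 < y -> ln y <= ln (1 + x) + (y - (1 + x)) / (1 + x).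
  move=> y0; rewrite -[in leLHS](divfK (lt0r_neq0 a0) y) lnM ?posrE ?divr_gt0//.
  rewrite addrC lerD2l mulrBl divff ?gt_eqF//.
  rewrite (_ : y / (1 + x) = 1 + (y / (1 + x) - 1)); last by lra.
  apply: (le_trans (le_ln1Dx _)); last by lra.
  by have := divr_gt0 y0 a0; lra.
have t1 := tangent (1 + k * x); have t2 := tangent 1.
have {}t1 : ln (1 + k * x) <= ln (1 + x) + (1 + k * x - (1 + x)) / (1 + x).
  by apply: t1; lra.
have {}t2 : ln 1 <= ln (1 + x) + (1 - (1 + x)) / (1 + x) by apply: t2; lra.
rewrite ln1 in t2.
have {}t2 := ler_wpM2l (_ : 0 <= k - 1) t2; have {t2} t2 : 0 <= (k - 1) * (ln (1 + x) + (1 - (1 + x)) / (1 + x)).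
  by have := t2 ltac:(lra); rewrite mulr0.
have : (1 + k * x - (1 + x)) / (1 + x) + (k - 1) * ((1 - (1 + x)) / (1 + x)) = 0.
  by field; rewrite gt_eqF.
move: t1 t2; move: ((1 + k * x - (1 + x)) / (1 + x)) ((1 - (1 + x)) / (1 + x)).
move: (ln (1 + k * x)) (ln (1 + x)) => a b c e; nra.
Qed.

(** The square of [1 + u / 2] equals [2 * u] plus the square of [1 - u / 2]. Equivalently
    [u * expR (- u) <= 1 / 2], the source of the factor 1/2 in the contraction. *)
Lemma double_le_expR u : 0 <= u -> 2 * u <= expR u.
Proof.
move=> u0; have := expR_ge1Dx (u / 2) => h.
rewrite [in leRHS](_ : u = u / 2 + u / 2); last by lra.
rewrite expRD.
have h2 : (1 + u / 2) * (1 + u / 2) <= expR (u / 2) * expR (u / 2).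
  by apply: ler_pM => //; lra.
apply: le_trans h2; have := sqr_ge0 (1 - u / 2); rewrite expr2; lra.
Qed.

(* The derivative of [t |-> exp (- exp t)] is at most 1/e <= 1/2 in absolute value. *)
Lemma expRN_log_lipschitz (s t c : R) : 0 <= s -> 0 <= c -> t <= expR c * s ->
  expR (- s) - expR (- t) <= c / 2.
Proof.
move=> s0 c0 tcs.
have [ts|st] := leP t s.
  have : expR (- s) <= expR (- t) by rewrite ler_expR lerN2.
  by lra.
have spos : 0 < s.
  rewrite lt_neqAle s0 andbT; apply/eqP => s00; move: tcs; rewrite -s00 mulr0 => h.
  by move: st; rewrite -s00 ltNge h.
(* [g] is nondecreasing between [s] and [t] by [double_le_expR], so [expR (- s) - expR (- t)] is at
   most half of [ln t - ln s], and [ln t - ln s <= c]. *)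
pose g u : R := expR (- u) + 2^-1 * ln u.
pose g' u : R := - expR (- u) + 2^-1 * u^-1.
have dg u : 0 < u -> is_derive u 1 g (g' u).
  move=> u0; have lnu := is_derive1_ln u0.
  have h1 : is_derive u 1 (expR \o -%R) (- expR (- u)).
    by apply: is_derive_eq; rewrite mulrN1.
  exact: (is_deriveD h1 (is_deriveZ 2^-1 lnu)).
have [||e] := @MVT_segment R g g' s t (ltW st).
- by move=> u; rewrite in_itv/= => /andP[h _]; apply: dg; lra.
- apply: derivable_within_continuous => u; rewrite in_itv/= => /andP[h _].
  have u0 : 0 < u by lra.
  by have [] := dg u u0.
rewrite in_itv/= => /andP[se et] ge.
have e0 : 0 < e by lra.
have ge0 : 0 <= g' e.
  rewrite /g' expRN addrC subr_ge0 -invfM lef_pV2 ?posrE ?expR_gt0//.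
    exact/double_le_expR/ltW.
  by rewrite mulr_gt0.
have : 0 <= g t - g s by rewrite ge mulr_ge0// subr_ge0 ltW.
have t0 : 0 < t by lra.
have lnt : ln t <= c + ln s.
  rewrite -[c]expRK -lnM ?posrE ?expR_gt0// ler_ln ?posrE ?mulr_gt0 ?expR_gt0//.
rewrite /g; lra.
Qed.

End real_inequalities.

(** * Partition functions and void probabilities of an abstract hard-core gas *)

Section partition_function.
Context {d} {T : measurableType d} {R : realType}.
Variable mu : {sigma_finite_measure set T -> \bar R}.
Variable excl : set (T * T).
Hypothesis mexcl : measurable excl.
Hypothesis exclC : forall x y, excl (x, y) -> excl (y, x).
Variable lam : R.
Hypothesis lam0 : 0 <= lam.
Local Open Scope ereal_scope.

Local Notation N := (xsection excl).
Local Notation hcvol := (hcvol mu excl).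

Definition hcZ (W : set T) : \bar R :=
  \sum_(k <oo) (lam ^+ k / k`!%:R)%:E * hcvol k W.

Let coef_ge0 k : (0 <= lam ^+ k / k`!%:R)%R.
Proof. by rewrite divr_ge0// exprn_ge0. Qed.

Let term_ge0 k W : 0 <= (lam ^+ k / k`!%:R)%:E * hcvol k W.
Proof. by rewrite mule_ge0// ?lee_fin//; exact: hcvol_ge0. Qed.

Lemma hcZ_ge1 W : 1 <= hcZ W.
Proof.
have := @nneseries_lim_ge R (fun k => (lam ^+ k / k`!%:R)%:E * hcvol k W) predT 0 1
  (fun n _ _ => term_ge0 n W).
by rewrite big_nat1/= expr0 fact0 divr1 mul1e; exact.
Qed.

Lemma le_hcZ W W' : measurable W -> measurable W' -> W `<=` W' ->
  hcZ W <= hcZ W'.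
Proof.
move=> mW mW' WW'; apply: lee_nneseries => k _; first by move=> _; exact: term_ge0.
by apply: lee_wpmul2l; [rewrite lee_fin|exact: le_hcvol].
Qed.

(** Forgetting the exclusion bounds the series by that of [expR (lam * mu W)]. *)
Lemma hcZ_lty W : measurable W -> mu W < +oo -> hcZ W < +oo.
Proof.
move=> mW Woo.
have Wfin : mu W \is a fin_num by rewrite ge0_fin_numE.
set m := fine (mu W).
have m0 : (0 <= m)%R by exact: fine_ge0.
apply: (@le_lt_trans _ _ (expR (lam * m))%:E); last exact: ltry.
apply: lime_le; first by apply: is_cvg_nneseries => n _ _; exact: term_ge0.
apply: nearW => n.
apply: (@le_trans _ _ (\sum_(0 <= k < n) (exp_coeff (lam * m) k)%:E)).
  apply: lee_sum => k _; rewrite /exp_coeff/= exprMn.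
  rewrite mulrAC [X in _ <= X]EFinM; apply: lee_wpmul2l; first by rewrite lee_fin.
  by rewrite EFin_expe /m fineK//; exact: hcvol_le_expe.
rewrite sumEFin lee_fin; apply: nondecreasing_cvgn_le.
  move=> a b ab; rewrite /series/= (big_cat_nat (leq0n a) ab)//= lerDl.
  by apply: sumr_ge0 => i _; rewrite /exp_coeff/= divr_ge0// exprn_ge0// mulr_ge0.
exact: is_cvg_series_exp_coeff.
Qed.

Lemma hcZ_fin_num W : measurable W -> mu W < +oo -> hcZ W \is a fin_num.
Proof.
move=> mW Woo; rewrite ge0_fin_numE; first exact: hcZ_lty.
by rewrite (le_trans _ (hcZ_ge1 _)).
Qed.

Lemma measurable_hcZD W : measurable W ->
  measurable_fun setT (fun w => hcZ (W `\` N w)).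
Proof.
move=> mW; apply: (eq_measurable_fun (fun x => \sum_(k <oo | k \in predT)
    (lam ^+ k / k`!%:R)%:E * hcvol k (W `\` N x))).
  by move=> x _; apply: eq_eseriesl.
apply: ge0_emeasurable_sum => [k x _ _|k _]; first exact: term_ge0.
by apply: measurable_funeM; exact: measurable_hcvolD.
Qed.

(** Termwise this is [hcvol_cluster]: its factor [k.+1] turns [lam^(k+1) / (k+1)!] into [lam] times
    [lam^k / k!]. *)
Lemma hcZ_cluster A W : measurable A -> measurable W -> A `<=` W ->
  A `*` A `<=` excl ->
  hcZ W = hcZ (W `\` A) + lam%:E * \int[mu]_(w in A) hcZ ((W `\` A) `\` N w).
Proof.
move=> mA mW AW AA.
have mWA : measurable (W `\` A) by exact: measurableD.
rewrite /hcZ integral_nneseries//; last first.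
  move=> k; apply: measurable_funeM; apply: measurable_funTS.
  exact: measurable_hcvolD.
rewrite -nneseriesZl; last first.
  by move=> k _; apply: integral_ge0 => x _; exact: term_ge0.
have i0 k : 0 <= \int[mu]_(x in A) hcvol k (W `\` A `\` N x).
  by apply: integral_ge0 => x _; exact: hcvol_ge0.
rewrite nneseries_recl// [in RHS]nneseries_recl//= -addeA; congr (_ + _).
rewrite -!(@nneseries_addn _ _ 1)//.
rewrite [X in _ = _ + X](_ : _ = \sum_(k <oo)
   (lam ^+ k.+1 / k.+1`!%:R)%:E * (k.+1%:R%:E *
     \int[mu]_(x in A) hcvol k (W `\` A `\` N x))); last first.
  apply: eq_eseriesr => k _.
  rewrite ge0_integralZl//; first last.
  - by rewrite lee_fin.
  - by move=> x _; exact: hcvol_ge0.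
  - by apply: measurable_funTS; exact: measurable_hcvolD.
  rewrite !muleA -!EFinM; congr (_%:E * _).
  rewrite factS natrM exprS.
  have : (k.+1%:R != 0 :> R)%R by rewrite pnatr_eq0.
  have : (k`!%:R != 0 :> R)%R by rewrite pnatr_eq0 -lt0n fact_gt0.
  by move: (k.+1%:R : R)%R (k`!%:R : R)%R (lam ^+ k)%R => a b c a0 b0; field; rewrite a0 b0.
rewrite -nneseriesD; last 2 first.
- by move=> k _ _; rewrite addn1; exact: term_ge0.
- by move=> k _ _; rewrite mule_ge0 ?lee_fin// mule_ge0.
apply: eq_eseriesr => k _.
rewrite !addn1 -ge0_muleDr//; last 2 first.
- exact: hcvol_ge0.
- by rewrite mule_ge0.
by rewrite (hcvol_cluster _ mexcl exclC _ mA mW AW AA).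
Qed.

Local Close Scope ereal_scope.

Definition finite_region (W : set T) := measurable W /\ (mu W < +oo)%E.

Definition clique (A : set T) := measurable A /\ A `*` A `<=` excl.

Lemma finite_regionD W A : finite_region W -> measurable A ->
  finite_region (W `\` A).
Proof.
move=> [mW Woo] mA; split; first exact: measurableD.
by apply: le_lt_trans Woo; apply: le_measure; rewrite ?inE//; exact: measurableD.
Qed.

Lemma finite_regionS W A : finite_region W -> measurable A -> A `<=` W ->
  finite_region A.
Proof.
move=> [mW Woo] mA AW; split => //.
by apply: le_lt_trans Woo; apply: le_measure; rewrite ?inE.
Qed.

Definition Zr W : R := fine (hcZ W).

(* The probability that the hard-core gas in [W] has no point in [B]. *)
Definition avoid W B : R := Zr (W `\` B) / Zr W.

(** Minus the logarithm of [avoid] on finite regions ([avoidE]); it adds up when sets are removed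
    one after the other ([nlavU]). *)
Definition nlav W B : R := ln (Zr W / Zr (W `\` B)).

Lemma Zr_ge1 W : finite_region W -> 1 <= Zr W.
Proof.
move=> [mW Woo]; rewrite -lee_fin /Zr fineK; first exact: hcZ_ge1.
exact: hcZ_fin_num.
Qed.

Lemma Zr_gt0 W : finite_region W -> 0 < Zr W.
Proof. by move=> /Zr_ge1; apply: lt_le_trans. Qed.

Lemma le_Zr W W' : measurable W -> finite_region W' -> W `<=` W' -> Zr W <= Zr W'.
Proof.
move=> mW fW' WW'; have [_ Woo] := finite_regionS fW' mW WW'.
case: (fW') => mW' W'oo.
by apply: fine_le; rewrite ?hcZ_fin_num//; exact: le_hcZ.
Qed.

Lemma avoid_gt0 W B : finite_region W -> measurable B -> 0 < avoid W B.
Proof.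
by move=> fW mB; rewrite divr_gt0// Zr_gt0//; exact: finite_regionD.
Qed.

Lemma avoid_le1 W B : finite_region W -> measurable B -> avoid W B <= 1.
Proof.
move=> fW mB; rewrite ler_pdivrMr ?Zr_gt0// mul1r; apply: le_Zr => //.
by case: (finite_regionD fW mB).
Qed.

Lemma avoidE W B : finite_region W -> measurable B -> avoid W B = expR (- nlav W B).
Proof.
move=> fW mB; have ? := Zr_gt0 fW; have ? := Zr_gt0 (finite_regionD fW mB).
by rewrite /nlav -lnV ?posrE ?divr_gt0// invf_div lnK// posrE divr_gt0.
Qed.

Lemma nlav_ge0 W B : finite_region W -> measurable B -> 0 <= nlav W B.
Proof.
move=> fW mB; apply: ln_ge0; have fWB := finite_regionD fW mB.
by rewrite ler_pdivlMr ?Zr_gt0// mul1r; apply: le_Zr => //; case: fWB.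
Qed.

Lemma nlavU W A B : finite_region W -> measurable A -> measurable B ->
  nlav W (A `|` B) = nlav W A + nlav (W `\` A) B.
Proof.
move=> fW mA mB; have fA := finite_regionD fW mA; have fB := finite_regionD fA mB.
rewrite /nlav -setDDl -lnM ?posrE ?divr_gt0 ?Zr_gt0//.
have := Zr_gt0 fA; have := Zr_gt0 fB.
move: (Zr W) (Zr _) (Zr _) => a b c b0 c0.
by congr ln; field; rewrite !gt_eqF.
Qed.

Lemma measurable_avoid W D : finite_region W ->
  measurable_fun D (fun w => avoid W (N w)).
Proof.
move=> [mW Woo]; apply: measurable_funTS; apply: measurable_funM => //.
by apply: (measurableT_comp (fine_measurable _)) => //; exact: measurable_hcZD.
Qed.

Lemma integrable_avoid W D : finite_region W -> finite_region D ->
  mu.-integrable D (EFin \o (fun w => avoid W (N w))).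
Proof.
move=> fW [mD Doo]; apply: measurable_bounded_integrable => //.
  exact: measurable_avoid.
exists 1; split => // M M1 w _ /=; apply: le_trans (ltW M1).
have mN := measurable_excl mexcl w.
by rewrite ger0_norm ?avoid_le1// ltW// avoid_gt0.
Qed.

(* At most one particle lies in the clique [A]; the integral is over its position. *)
Lemma Zr_cluster A W : clique A -> finite_region W ->
  Zr W / Zr (W `\` A) =
  1 + lam * \int[mu]_(w in A `&` W) avoid (W `\` A) (N w).
Proof.
move=> [mA AA] fW; have fWA := finite_regionD fW mA.
have [mW Woo] := fW.
have mAW : measurable (A `&` W) by exact: measurableI.
have WAE : W `\` (A `&` W) = W `\` A by rewrite setDIr setDv setU0.
have := hcZ_cluster mAW mW (@subIsetr _ _ _) _.
rewrite WAE => /(_ ltac:(by move=> [x y] [[/= ? _] [? _]]; apply: AA)) E.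
have Z0 := Zr_gt0 fWA.
have fD w : finite_region (W `\` A `\` N w).
  by apply: finite_regionD => //; exact: measurable_excl.
have E2 : (\int[mu]_(w in A `&` W) hcZ (W `\` A `\` N w) =
  (Zr (W `\` A) * \int[mu]_(w in A `&` W) avoid (W `\` A) (N w))%:E)%E.
  have fAW : finite_region (A `&` W) by apply: finite_regionS fW _ _.
  have intav := integrable_avoid fWA fAW.
  rewrite EFinM /Rintegral [X in (_ * X)%E]fineK; last exact: integrable_fin_num.
  rewrite -ge0_integralZl_EFin//; first last.
  - exact: ltW.
  - exact/measurable_EFinP/measurable_avoid.
  - move=> x _; rewrite lee_fin; apply/ltW/avoid_gt0 => //; exact: measurable_excl.
  apply: eq_integral => w _; have [mDw Dwoo] := fD w.
  by rewrite -EFinM /avoid mulrC divfK ?gt_eqF// fineK// hcZ_fin_num.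
have -> : Zr W = Zr (W `\` A) + lam * (Zr (W `\` A) *
    \int[mu]_(w in A `&` W) avoid (W `\` A) (N w)).
  have [mWA WAoo] := fWA.
  rewrite {1}/Zr E E2 fineD ?hcZ_fin_num//.
by rewrite mulrDl divff ?gt_eqF// mulrCA mulrAC divff ?gt_eqF// mul1r.
Qed.

Let cinteg W A := \int[mu]_(w in A `&` W) avoid (W `\` A) (N w).

Let cinteg_ge0 W A : finite_region W -> measurable A -> 0 <= cinteg W A.
Proof.
move=> fW mA; apply: Rintegral_ge0 => w _; apply/ltW/avoid_gt0.
  exact: finite_regionD.
exact: measurable_excl.
Qed.

Lemma nlav_clique A W : clique A -> finite_region W ->
  nlav W A = ln (1 + lam * \int[mu]_(w in A `&` W) avoid (W `\` A) (N w)).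
Proof. by move=> cA fW; rewrite /nlav Zr_cluster. Qed.

(** * Void probabilities of a finite union of cliques *)

Section clique_cover.
Variable A : nat -> set T.
Hypothesis cA : forall i, clique (A i).
Let cov n := \big[setU/set0]_(i < n) A i.

Let mcov n : measurable (cov n).
Proof. by apply: bigsetU_measurable => i _; case: (cA i). Qed.

Let covS n : cov n.+1 = cov n `|` A n.
Proof. by rewrite /cov big_ord_recr. Qed.

Let sub_cov n : cov n `<=` cov n.+1.
Proof. by rewrite covS; exact: subsetUl. Qed.

Let nlav_cov0 W : finite_region W -> nlav W (cov 0) = 0.
Proof.
by move=> fW; rewrite /cov big_ord0 /nlav setD0 divff ?ln1// gt_eqF// Zr_gt0.
Qed.

(** One more clique costs one term of the cluster identity, taken in the region already freed of
    [cov n]; overlaps between cliques are thus harmless. *)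
Let nlav_covS W n : finite_region W ->
  nlav W (cov n.+1) = nlav W (cov n) + ln (1 + lam * cinteg (W `\` cov n) (A n)).
Proof.
move=> fW; case: (cA n) => mAn _.
rewrite covS nlavU// (nlav_clique (cA n))//; exact: finite_regionD.
Qed.

Let mu_covS W n : finite_region W ->
  fine (mu (cov n.+1 `&` W)) =
  fine (mu (cov n `&` W)) + fine (mu (A n `&` (W `\` cov n))).
Proof.
move=> fW; case: (cA n) => mAn _; case: (fW) => mW Woo.
have mD := measurableD mW (mcov n).
have fin X : measurable X -> mu (X `&` W) \is a fin_num.
  move=> mX; rewrite ge0_fin_numE//.
  by have [] := finite_regionS fW (measurableI _ _ mX mW) (@subIsetr _ _ _).
have m1 : measurable (cov n `&` W) by exact: measurableI.
have m2 : measurable (A n `&` (W `\` cov n)) by exact: measurableI.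
rewrite -fineD//; last 2 first.
- exact: fin.
- have -> : A n `&` (W `\` cov n) = (A n `\` cov n) `&` W.
    by rewrite !setDE setICA setIC -setIA setICA setIA; congr (_ `&` _); rewrite setIC.
  by apply: fin; exact: measurableD.
rewrite -measureU//; first congr (fine (mu _)); last first.
  by rewrite predeqE => x; split => // -[[? _] [_ [_ ?]]].
rewrite covS predeqE => x; split; last first.
  by move=> [[? ?]|[? [? ?]]]; split => //; [left|right].
have [cx|cx] := pselect (cov n x); first by move=> [_ ?]; left.
by move=> [[//|?] ?]; right.
Qed.

(** Each term [ln (1 + lam * I)] is at most [lam * I], and [I] is at most the volume newly removed
    because [avoid] is at most 1. *)
Lemma nlav_le n W : finite_region W -> nlav W (cov n) <= lam * fine (mu (cov n `&` W)).
Proof.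
move=> fW; elim: n => [|n IH].
  by rewrite nlav_cov0// /cov big_ord0 set0I measure0 mulr0.
rewrite nlav_covS// mu_covS// mulrDr; apply: lerD => //.
have fD := finite_regionD fW (mcov n); case: (cA n) => mAn _.
have i0 := cinteg_ge0 fD mAn.
apply: (le_trans (le_ln1Dx _)); first by rewrite (lt_le_trans (_ : _ < 0))// mulr_ge0.
apply: ler_wpM2l => //.
have fAD : finite_region (A n `&` (W `\` cov n)).
  by case: (fD) => mD _; apply: finite_regionS fD _ _ => //; exact: measurableI.
rewrite -[leRHS]mul1r -Rintegral_cst//; last by case: fAD.
apply: le_Rintegral; [by case: fAD| |  |].
- by apply: integrable_avoid => //; exact: finite_regionD.
- apply: measurable_bounded_integrable => //; try by case: fAD.
  by exists 1; split => // M M1 w _ /=; rewrite normr1 ltW.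
- move=> w _; apply: avoid_le1; first exact: finite_regionD.
  exact: measurable_excl.
Qed.

(** Both regions meet the cover in the same set, so the integrals compared have the same domain, and
    [ln] is 1-Lipschitz above 1. The hypothesis ranges over [D] because the integrands live in
    regions freed of earlier cliques. *)
Lemma nlav_dist n W W' (c : R) : finite_region W -> finite_region W' ->
  cov n `&` W = cov n `&` W' ->
  (forall D w, measurable D -> cov n w ->
    `|avoid (W `\` D) (N w) - avoid (W' `\` D) (N w)| <= c) ->
  `|nlav W (cov n) - nlav W' (cov n)| <= lam * c * fine (mu (cov n `&` W)).
Proof.
move=> fW fW'; elim: n => [|n IH] WW' h.
  by rewrite !nlav_cov0// /cov big_ord0 set0I measure0 mulr0 subrr normr0.
rewrite !nlav_covS// mu_covS// mulrDr.
rewrite opprD addrACA; apply: (le_trans (ler_normD _ _)); apply: lerD.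
  apply: IH => [|D w mD /sub_cov]; last exact: h.
  by rewrite -(setIidl (@sub_cov n)) -!setIA WW'.
have fD := finite_regionD fW (mcov n); case: (cA n) => mAn _.
have fD' := finite_regionD fW' (mcov n).
have i0 := cinteg_ge0 fD mAn; have i0' := cinteg_ge0 fD' mAn.
apply: (le_trans (ln_lipschitz_ge1 _ _)); try by rewrite lerDl mulr_ge0.
rewrite opprD addrACA subrr add0r -mulrBr normrM ger0_norm// -mulrA.
apply: ler_wpM2l => //; rewrite /cinteg.
have AE : A n `&` (W' `\` cov n) = A n `&` (W `\` cov n).
  have sA : A n `<=` cov n.+1 by rewrite covS; exact: subsetUr.
  by rewrite !setDE !setIA -(setIidl sA) -!setIA !(setIA (cov n.+1)) WW'.
rewrite AE.
have fAD : finite_region (A n `&` (W `\` cov n)).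
  by case: (fD) => mD _; apply: finite_regionS fD _ _ => //; exact: measurableI.
have [mAD ADoo] := fAD.
have in1 : mu.-integrable (A n `&` (W `\` cov n))
    (EFin \o (fun w => avoid (W `\` cov n `\` A n) (N w))).
  by apply: integrable_avoid => //; exact: finite_regionD.
have in2 : mu.-integrable (A n `&` (W `\` cov n))
    (EFin \o (fun w => avoid (W' `\` cov n `\` A n) (N w))).
  by apply: integrable_avoid => //; exact: finite_regionD.
rewrite -RintegralB//.
have in12 := integrableB mAD in1 in2.
apply: (le_trans (le_normr_Rintegral _ _)) => //.
rewrite -Rintegral_cst//; apply: le_Rintegral => //.
- exact: (integrable_norm in12).
- apply: measurable_bounded_integrable => //.
  by exists `|c|; split => // M M1 w _ /=; rewrite ltW.
- move=> w [Anw _] /=; rewrite !setDDl -covS; apply: h => //.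
  by rewrite covS; right.
Qed.

(** By [ln_bernoulli], a factor [k >= 1] on the integrals becomes at most a factor [k] on each
    [ln (1 + lam * I)]. *)
Lemma nlav_ratio n W W' (k : R) : 1 <= k -> finite_region W -> finite_region W' ->
  cov n `&` W = cov n `&` W' ->
  (forall D w, measurable D -> cov n w ->
    avoid (W' `\` D) (N w) <= k * avoid (W `\` D) (N w)) ->
  nlav W' (cov n) <= k * nlav W (cov n).
Proof.
move=> k1 fW fW'; have k0 : 0 <= k by lra.
elim: n => [|n IH] WW' h.
  by rewrite !nlav_cov0// mulr0.
rewrite !nlav_covS// mulrDr; apply: lerD.
  apply: IH => [|D w mD /sub_cov]; last exact: h.
  by rewrite -(setIidl (@sub_cov n)) -!setIA WW'.
have fD := finite_regionD fW (mcov n); case: (cA n) => mAn _.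
have fD' := finite_regionD fW' (mcov n).
have i0 := cinteg_ge0 fD mAn; have i0' := cinteg_ge0 fD' mAn.
apply: le_trans (ln_bernoulli k1 (mulr_ge0 lam0 i0)).
rewrite ler_ln ?posrE; last 2 first.
- by rewrite ltr_pwDl// mulr_ge0.
- by rewrite ltr_pwDl// mulr_ge0// mulr_ge0.
rewrite lerD2l mulrCA; apply: ler_wpM2l => //; rewrite /cinteg.
have AE : A n `&` (W' `\` cov n) = A n `&` (W `\` cov n).
  have sA : A n `<=` cov n.+1 by rewrite covS; exact: subsetUr.
  by rewrite !setDE !setIA -(setIidl sA) -!setIA !(setIA (cov n.+1)) WW'.
rewrite AE.
have fAD : finite_region (A n `&` (W `\` cov n)).
  by case: (fD) => mD _; apply: finite_regionS fD _ _ => //; exact: measurableI.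
have [mAD ADoo] := fAD.
have in1 : mu.-integrable (A n `&` (W `\` cov n))
    (EFin \o (fun w => avoid (W `\` cov n `\` A n) (N w))).
  by apply: integrable_avoid => //; exact: finite_regionD.
rewrite -RintegralZl//; apply: le_Rintegral => //.
- by apply: integrable_avoid => //; exact: finite_regionD.
- exact: (integrableZl mAD k in1).
- move=> w [Anw _] /=; rewrite !setDDl -covS; apply: h => //.
  by rewrite covS; right.
Qed.

End clique_cover.

End partition_function.

(** * Lebesgue measure and topology of Euclidean space *)

Section affine_change_of_variables.
Context {d} {T : measurableType d} {R : realType}.
Variable mu : {sigma_finite_measure set T -> \bar R}.
Local Open Scope ereal_scope.

(** The maps vary with the coordinate to allow for translations, and are indexed by [nat] so that
    the tail of a tuple uses the shifted family. *)
Definition tuple_coordmap n (f : nat -> T -> T) (t : n.-tuple T) : n.-tuple T :=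
  [tuple f i (tnth t i) | i < n].

Lemma tuple_coordmap_cons n (f : nat -> T -> T) x (t : n.-tuple T) :
  tuple_coordmap f (tuple_cons (x, t)) =
  tuple_cons (f 0%N x, tuple_coordmap (fun i => f i.+1) t).
Proof.
apply: eq_from_tnth => i; rewrite tnth_mktuple.
case: (unliftP ord0 i) => [j|] ->; last by rewrite !(tnth_nth x)/=.
rewrite /tuple_cons !(tnth_nth x) /= (nth_map j) ?size_enum_ord//.
  by rewrite nth_ord_enum (tnth_nth x).
exact: (ltn_ord j).
Qed.

Lemma measurable_tuple_cons n : measurable_fun setT (@tuple_cons _ T n).
Proof. exact: measurable_cons. Qed.

Lemma measure_powerS n (A : set (n.+1.-tuple T)) :
  measure_power mu n.+1 A =
  \int[mu]_x measure_power mu n ((fun t => tuple_cons (x, t)) @^-1` A).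
Proof. by apply: eq_integral => x _; rewrite /= xsectionE. Qed.

Lemma measure_power_coordmap (c : {nonneg R}) (n : nat) (f : nat -> T -> T) :
  (forall i, measurable_fun setT (f i)) ->
  (forall i A, measurable A -> mu (f i @^-1` A) = c%:num%:E * mu A) ->
  forall A, measurable A ->
  measure_power mu n (tuple_coordmap f @^-1` A) =
    (c%:num ^+ n)%:E * measure_power mu n A.
Proof.
elim: n f => [|n IH] f mf fE A mA.
  rewrite expr0 mul1e; congr (_ _); rewrite predeqE => t /=.
  by rewrite [tuple_coordmap f t]tuple0 [t]tuple0.
rewrite !measure_powerS.
pose g x := measure_power mu n ((fun t => tuple_cons (x, t)) @^-1` A).
have mB : measurable (@tuple_cons _ T n @^-1` A).
  by rewrite -[X in measurable X]setTI; exact: measurable_tuple_cons.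
have mg : measurable_fun setT g.
  have := measurable_fun_xsection (measure_power mu n) mB.
  by apply: eq_measurable_fun => x _; rewrite /= xsectionE.
have g0 x : 0 <= g x by [].
transitivity (\int[mu]_x ((c%:num ^+ n)%:E * g (f 0%N x))).
  apply: eq_integral => x _; rewrite -(IH (fun i => f i.+1)).
  - by congr (_ _); rewrite predeqE => t /=; rewrite tuple_coordmap_cons.
  - by move=> i; exact: mf.
  - by move=> i; exact: fE.
  - by have := measurable_xsection (f 0%N x) mB; rewrite xsectionE.
rewrite ge0_integralZl//; last exact: measurableT_comp.
rewrite exprSr EFinM -muleA; congr (_ * _).
have := @ge0_integral_pushforward _ _ T T R (f 0%N) (mf 0%N) mu setT g measurableT mg.
rewrite preimage_setT => /(_ (fun _ _ => g0 _)) <-.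
rewrite -ge0_integral_mscale//.
by apply: eq_measure_integral => X mX _; exact: fE.
Qed.

End affine_change_of_variables.

Section lebesgue_affine.
Context {R : realType}.
Local Open Scope ereal_scope.

Lemma measurable_affine (a b : R) :
  measurable_fun setT (fun x : R => a * x + b)%R.
Proof. by apply: measurable_funD => //; exact: measurable_funM. Qed.

(** The rescaled image measure agrees with Lebesgue measure on half-open intervals, which determine
    it. *)
Lemma lebesgue_measure_affine (s v : R) (A : set R) : (0 < s)%R -> measurable A ->
  lebesgue_measure ((fun x : R => s^-1 * x + v)%R @^-1` A) =
    s%:E * lebesgue_measure A.
Proof.
move=> s0 mA.
have sV0 : (0 <= s^-1)%R by rewrite invr_ge0 ltW.
pose f := (fun x : R => s^-1 * x + v)%R.
pose M : {measure set (measurableTypeR R) -> \bar R} :=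
  mscale (NngNum sV0) (@pushforward_measure _ _ (measurableTypeR R)
    (measurableTypeR R) R lebesgue_measure _ (@measurable_affine s^-1 v)).
have E : lebesgue_measure A = M A.
  apply: lebesgue_measure_unique => // _ [[a b] _ <-].
  rewrite /M/= /mscale/= /pushforward/=.
  have -> : (fun x : R => s^-1 * x + v)%R @^-1` `]a, b]%classic =
      `](s * (a - v))%R, (s * (b - v))%R]%classic.
    rewrite predeqE => x /=; rewrite !in_itv/=.
    rewrite -ltrBlDr -lerBrDr -(ltr_pM2l s0) -(ler_pM2l s0).
    by rewrite mulVKf// gt_eqF.
  rewrite !lebesgue_measure_itv/= !lte_fin ltr_pM2l// ltrD2r.
  case: ifPn => _; last by rewrite mule0.
  by rewrite -!EFinB -EFinM; congr _%:E; field; rewrite gt_eqF.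
rewrite E /M/= /mscale/= muleA -EFinM divff ?mul1e// gt_eqF//.
Qed.

Lemma measure_power_box (n : nat) (A : set R) : measurable A ->
  measure_power lebesgue_measure n [set t : n.-tuple R | forall i, A (tnth t i)]
  = lebesgue_measure A ^+ n.
Proof.
move=> mA; elim: n => [|n IH].
  by rewrite expe0 /= diracE mem_set//= => i; exfalso; move: (ltn_ord i); rewrite ltn0.
rewrite measure_powerS expeS -IH.
transitivity (\int[lebesgue_measure]_x
  ((cst (measure_power lebesgue_measure n [set t | forall i, A (tnth t i)])) \_ A) x).
  apply: eq_integral => x _; rewrite patchE; case: ifPn => [/set_mem Ax|/negP nA].
    congr (_ _); rewrite predeqE => t; split => /= [h i|h i].
      have := h (lift ord0 i); rewrite !(tnth_nth x)/=; exact.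
    case: (unliftP ord0 i) => [j|] ->; rewrite (tnth_nth x)//=.
    by rewrite -tnth_nth.
  rewrite (_ : _ @^-1` _ = set0) ?measure0//.
  rewrite -subset0 => t /= /(_ ord0); rewrite (tnth_nth x)/= => Ax.
  by apply: nA; exact: mem_set.
by rewrite -integral_mkcond integral_cst// muleC.
Qed.

End lebesgue_affine.

Section euclidean_geometry.
Context {R : realType} {d : nat}.
Local Notation E := (euclidean R d).

Lemma euclidean_normE (x : E) : `|x| = Num.sqrt (\sum_(i < d) x ord0 i ^+ 2).
Proof. by []. Qed.

Lemma le_coord_norm (x : E) i : `|x ord0 i| <= `|x|.
Proof.
rewrite euclidean_normE -sqrtr_sqr ler_wsqrtr//.
by rewrite (bigD1 i)//= lerDl; apply: sumr_ge0 => j _; exact: sqr_ge0.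
Qed.

Lemma norm_le_sum_coord (x : E) : `|x| <= \sum_(i < d) `|x ord0 i|.
Proof.
have s0 : 0 <= \sum_(i < d) `|x ord0 i| by exact: sumr_ge0.
rewrite euclidean_normE -[leRHS]ger0_norm// -sqrtr_sqr ler_wsqrtr//.
rewrite expr2 mulr_suml; apply: ler_sum => i _.
rewrite -real_normK ?num_real// expr2 ler_wpM2l// (bigD1 i)//= lerDl.
exact: sumr_ge0.
Qed.

Lemma eball_measurable (v : E) (s : R) : measurable (ball v s : set E).
Proof. by apply: open_euclidean_measurable; exact: ball_open. Qed.

Lemma eballE (v : E) (s : R) : ball v s = [set y : E | `|v - y| < s].
Proof. by rewrite -ball_normE. Qed.

Lemma bounded_sub_ball (B : set E) : bounded_set B ->
  exists2 M : R, 0 < M & B `<=` ball (0 : E) M.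
Proof.
move=> [M [Mr hM]]; exists (`|M| + 2); first by rewrite ltr_wpDl.
move=> x Bx; rewrite eballE/= sub0r normrN.
apply: (@le_lt_trans _ _ (`|M| + 1)); last by rewrite ltrD2l ltr1n.
by apply: hM Bx; rewrite (le_lt_trans (ler_norm _))// ltrDl.
Qed.

Lemma bounded_ball (v : E) (s : R) : bounded_set (ball v s : set E).
Proof.
exists (`|v| + s); split; first exact: num_real.
move=> M vM y; rewrite eballE/= => vy; apply: le_trans (ltW vM).
rewrite -[y](subKr v) opprB addrC (le_trans (ler_normD _ _))//.
by rewrite addrC lerD2l distrC ltW// distrC.
Qed.

Lemma bounded_setS (A B : set E) : A `<=` B -> bounded_set B -> bounded_set A.
Proof. by move=> AB [M [Mr hM]]; exists M; split => // M' /hM h x /AB /h. Qed.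

Lemma bounded_setU (A B : set E) : bounded_set A -> bounded_set B ->
  bounded_set (A `|` B).
Proof.
move=> /bounded_sub_ball[M M0 AM] /bounded_sub_ball[N N0 BN].
apply: (@bounded_setS _ (ball (0 : E) (Num.max M N))); last exact: bounded_ball.
move=> x [/AM|/BN]; rewrite !eballE/= => h; apply: (lt_le_trans h).
- by rewrite le_max lexx.
- by rewrite le_max lexx orbT.
Qed.

Lemma lebesgue_euclidean_dilation (s : R) (v : E) (A : set E) : 0 < s ->
  measurable A ->
  lebesgue_euclidean R d ((fun x : E => s^-1 *: (x - v)) @^-1` A) =
  ((s ^+ d)%:E * lebesgue_euclidean R d A)%E.
Proof.
move=> s0 mA; rewrite /lebesgue_euclidean.
(* The translation of coordinate [i]; the value is 0 at indices not below [d], as [tuple_coordmap]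
   takes a family on [nat]. *)
pose b i := oapp (fun j : 'I_d => - s^-1 * v ord0 j) 0 (insub i).
pose f (i : nat) (x : R) := s^-1 * x + b i.
have mA' : measurable (@point_of_tuple R d @^-1` A).
  by rewrite -[X in measurable X]setTI; exact: measurable_point_of_tuple.
have := @measure_power_coordmap _ (measurableTypeR R) R lebesgue_measure
  (NngNum (ltW s0)) d f _ _ _ mA'.
move=> <-.
- congr (_ _); rewrite predeqE => t /=.
  suff -> : point_of_tuple (tuple_coordmap f t) = s^-1 *: (point_of_tuple t - v) by [].
  apply/rowP => i; rewrite !mxE tnth_mktuple /f /b.
  by rewrite valK/= mulrBr mulNr.
- by move=> i; exact: measurable_affine.
- by move=> i B mB; exact: lebesgue_measure_affine.
Qed.

Lemma lebesgue_euclidean_ball (v : E) (s : R) : 0 < s ->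
  lebesgue_euclidean R d (ball v s) =
  ((s ^+ d)%:E * lebesgue_euclidean R d (ball (0%R : E) 1%R))%E.
Proof.
move=> s0; rewrite -(lebesgue_euclidean_dilation v) //; last exact: eball_measurable.
congr (_ _); rewrite predeqE => x; rewrite !eballE/= sub0r normrN normrZ.
rewrite gtr0_norm ?invr_gt0// distrC.
by rewrite mulrC ltr_pdivrMr// mul1r.
Qed.

Let box (A : set R) : set E := [set x | forall i, A (x ord0 i)].

Let measurable_box A : measurable A -> measurable (box A).
Proof.
move=> mA; rewrite (_ : box A = \bigcap_(i in [set: 'I_d])
    ((fun x : E => x ord0 i) @^-1` A)).
  apply: fin_bigcap_measurable => // i _.
  by rewrite -[X in measurable X]setTI; exact: measurable_coord.
by rewrite predeqE => x; split=> [h i _|h i]; [exact: h|exact: (h i Logic.I)].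
Qed.

Let lebesgue_box A : measurable A ->
  lebesgue_euclidean R d (box A) = (lebesgue_measure A ^+ d)%E.
Proof.
move=> mA; rewrite -(measure_power_box d mA) /lebesgue_euclidean; congr (_ _).
by rewrite predeqE => t; split=> /= h i; have := h i; rewrite mxE.
Qed.

Lemma lebesgue_ball_lty (v : E) (s : R) :
  (lebesgue_euclidean R d (ball v s) < +oo)%E.
Proof.
have [s0|s0] := ltP 0 s; last first.
  rewrite (_ : ball v s = set0) ?measure0// -subset0 => x; rewrite eballE/=.
  by move=> /lt_le_trans/(_ s0); rewrite ltNge normr_ge0.
rewrite lebesgue_euclidean_ball//; apply: lte_mul_pinfty; rewrite ?lee_fin ?exprn_ge0 ?ltW//.
apply: (@le_lt_trans _ _ (lebesgue_euclidean R d (box `[-1, 1]%classic))).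
  apply: le_measure; rewrite ?inE.
  - exact: eball_measurable.
  - exact: measurable_box.
  - move=> x; rewrite eballE/= sub0r normrN => /ltW x1 i.
    by rewrite /= in_itv/= -ler_norml (le_trans (le_coord_norm x i)).
rewrite lebesgue_box// lebesgue_measure_itv/=; case: ifPn => _.
  by rewrite -EFinB -EFin_expe ltry.
by case: (d) => [|n]; rewrite ?expe0 ?ltry// expeS mul0e ltry.
Qed.

Lemma lebesgue_ball_gt0 (v : E) (s : R) : 0 < s ->
  (0 < lebesgue_euclidean R d (ball v s))%E.
Proof.
move=> s0; rewrite lebesgue_euclidean_ball// mule_gt0// ?lte_fin ?exprn_gt0//.
(* The cube of half-side [1 / (d + 1)] lies in the open unit ball: the absolute values of the
   coordinates sum to at most [d / (d + 1)]. *)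
pose a : R := d.+1%:R^-1.
have a0 : 0 < a by rewrite invr_gt0.
apply: (@lt_le_trans _ _ (lebesgue_euclidean R d (box `[-a, a]%classic))).
  rewrite lebesgue_box// lebesgue_measure_itv/= lte_fin gtrN//.
  by rewrite -EFinB -EFin_expe lte_fin exprn_gt0// opprK addr_gt0.
apply: le_measure; rewrite ?inE.
- exact: measurable_box.
- exact: eball_measurable.
- move=> x xa; rewrite eballE/= sub0r normrN.
  apply: (le_lt_trans (norm_le_sum_coord x)).
  apply: (@le_lt_trans _ _ (\sum_(i < d) a)).
    by apply: ler_sum => i _; have := xa i; rewrite /= in_itv/= -ler_norml.
  rewrite sumr_const card_ord -mulr_natl /a ltr_pdivrMr// mul1r ltr_nat//.
Qed.

Lemma bounded_lebesgue_lty (B : set E) : bounded_set B -> measurable B ->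
  (lebesgue_euclidean R d B < +oo)%E.
Proof.
move=> /bounded_sub_ball[M M0 BM] mB.
apply: (@le_lt_trans _ _ (lebesgue_euclidean R d (ball (0 : E) M))).
  by apply: le_measure; rewrite ?inE//; exact: eball_measurable.
exact: lebesgue_ball_lty.
Qed.

Local Notation r := ((@unit_volume_radius R d)%:num : R).

Lemma unit_volume_radiusP : (0 < d)%N ->
  lebesgue_euclidean R d (ball (0 : E) r) = 1%E.
Proof.
move=> d0; rewrite /unit_volume_radius; case: xgetP => [x _ //|].
set V := lebesgue_euclidean R d (ball (0 : E) 1).
have Voo : (V < +oo)%E by exact: lebesgue_ball_lty.
have Vgt0 : (0 < V)%E by exact: lebesgue_ball_gt0.
have Vfin : V \is a fin_num by rewrite ge0_fin_numE // ltW.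
have V0 : 0 < fine V by apply: fine_gt0; rewrite Vgt0.
(* By scaling, the radius [V^(-1/d)] gives volume 1, which rules out the default value of [xget]. *)
have s0 : 0 < (fine V)^-1 `^ d%:R^-1 by rewrite powR_gt0// invr_gt0.
move=> /(_ (PosNum s0)) h; exfalso; apply: h => /=.
rewrite lebesgue_euclidean_ball// -/V -powR_mulrn ?ltW// -powRrM mulVf; last first.
  by rewrite pnatr_eq0 -lt0n.
by rewrite powRr1 ?ltW ?invr_gt0// -[V in LHS]fineK// -EFinM mulVf// gt_eqF.
Qed.

Lemma lebesgue_exclusion_ball (v : E) : (0 < d)%N ->
  lebesgue_euclidean R d (ball v (2 * r)) = (2 ^+ d)%:E.
Proof.
move=> d0; rewrite lebesgue_euclidean_ball ?mulr_gt0// exprMn.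
have := unit_volume_radiusP d0; rewrite lebesgue_euclidean_ball// EFinM -muleA => ->.
by rewrite mule1.
Qed.

End euclidean_geometry.

(** * Compactness and separability of Euclidean space *)

Section euclidean_topology.
Context {R : realType} {d : nat}.
Local Notation E := (euclidean R d).

Lemma sum_fraction_lt (e : R) : 0 < e -> \sum_(i < d) e / d.+1%:R < e.
Proof.
move=> e0; rewrite sumr_const card_ord -[X in X < _]mulr_natl mulrCA.
by rewrite gtr_pMr// ltr_pdivrMr// mul1r ltr_nat.
Qed.

(** Heine-Borel is transported from the sup norm on row vectors: the identity map is continuous
    since the Euclidean norm is at most the sum of the absolute values of the coordinates. *)
Lemma euclidean_bounded_closed_compact (A : set E) :
  bounded_set A -> closed A -> compact A.
Proof.
move=> bA cA.
pose toE (x : 'rV[R]_d) : E := x.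
have toE_cont : continuous toE.
  move=> x; apply/(@cvgrPdist_lt _ E _ (nbhs x) (nbhs_filter x)) => e e0.
  have e'0 : 0 < e / d.+1%:R by rewrite divr_gt0.
  near=> y.
  apply: (le_lt_trans (norm_le_sum_coord _)).
  apply: (@le_lt_trans _ _ (\sum_(i < d) e / d.+1%:R)).
    apply: ler_sum => i _; apply/ltW.
    have : `|x - y| < e / d.+1%:R.
      by near: y; apply/nbhs_ballP; exists (e / d.+1%:R) => //= z; rewrite -ball_normE.
    apply: le_lt_trans; rewrite [leRHS]/Num.norm/= mx_normrE.
    by apply/bigmax_geP; right => /=; exists (ord0, i) => //=; rewrite !mxE.
  exact: sum_fraction_lt.
have cA' : closed (toE @^-1` A) by apply: preimage_closed => // x _; exact: toE_cont.
have bA' : bounded_set (toE @^-1` A).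
  have [M M0 AM] := bounded_sub_ball bA.
  exists M; split; first exact: num_real.
  move=> N MN x /AM; rewrite eballE/= sub0r normrN => xM.
  rewrite [leLHS]/Num.norm/= mx_normrE; apply/bigmax_leP; split => /=.
    by rewrite ltW// (lt_trans M0).
  move=> [i j] _ /=; rewrite (ord1 i).
  by rewrite (le_trans (le_coord_norm (toE x) j))// ltW// (lt_trans xM).
have -> : A = toE @` (toE @^-1` A).
  by rewrite predeqE => x; split=> [Ax|[y Ay <-//]]; exists x.
apply: continuous_compact; last exact: bounded_closed_compact.
by apply: continuous_subspaceT => x; exact: toE_cont.
Unshelve. all: end_near. Qed.

Lemma bounded_finite_cover (B : set E) (s : R) : bounded_set B -> 0 < s ->
  exists c : seq E, B `<=` \bigcup_(i in `I_(size c)) ball (nth 0 c i) s.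
Proof.
move=> /bounded_sub_ball[M M0 BM] s0.
have cK : compact (closure (ball (0 : E) M)).
  apply: euclidean_bounded_closed_compact; last exact: closed_closure.
  apply: (@bounded_setS _ _ _ (ball (0 : E) (M + 1))); last exact: bounded_ball.
  move=> x /(_ (ball x 1) (nbhsx_ballx _ _ ltr01))[y []].
  rewrite !eballE/= !sub0r !normrN => yM xy.
  rewrite -(subrK y x) (le_lt_trans (ler_normD _ _))// addrC.
  by rewrite ltrD.
move: cK; rewrite compact_cover => /(_ E setT (fun c => ball c s)) [].
- by move=> c _; exact: ball_open.
- by move=> x _; exists x => //; exact: ballxx.
move=> D _ cov; exists (finmap.enum_fset D) => x /BM /subset_closure /cov[c /= cD xc].
exists (index c (finmap.enum_fset D)); first by rewrite /= index_mem.
by rewrite nth_index.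
Qed.

Definition rational_point (q : d.-tuple rat) : E := \row_i ratr (tnth q i).

Lemma rational_point_dense (x : E) (e : R) : 0 < e ->
  exists q, `|x - rational_point q| < e.
Proof.
move=> e0; have e'0 : 0 < e / d.+1%:R by rewrite divr_gt0.
have /choice[q qP] : forall i, exists q : rat,
    `|x ord0 i - ratr q| < e / d.+1%:R.
  move=> i; have : x ord0 i - e / d.+1%:R < x ord0 i + e / d.+1%:R.
    by rewrite ltrD2l gtrN.
  move=> /rat_in_itvoo[q]; rewrite in_itv/= => /andP[q1 q2]; exists q.
  move: q1 q2; move: (e / d.+1%:R) => w q1 q2.
  by rewrite ltr_norml; apply/andP; split; lra.
exists [tuple q i | i < d].
apply: (le_lt_trans (norm_le_sum_coord _)).
apply: (@le_lt_trans _ _ (\sum_(i < d) e / d.+1%:R)).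
  by apply: ler_sum => i _; rewrite !mxE tnth_mktuple ltW.
exact: sum_fraction_lt.
Qed.

End euclidean_topology.

(** * Void probabilities of the hard sphere model *)

Section hard_core_tuples.
Context {d} {T : measurableType d} {R : realType}.
Variable mu : {sigma_finite_measure set T -> \bar R}.
Variable excl : set (T * T).

Definition hard_core_tuples (W : set T) k : set (k.-tuple T) :=
  [set x | (forall i, W (tnth x i)) /\
     forall i j : 'I_k, (i < j)%N -> ~ excl (tnth x i, tnth x j)].

Lemma hard_core_tuplesS W k w (t : k.-tuple T) :
  hard_core_tuples W (tuple_cons (w, t)) <->
  W w /\ hard_core_tuples (W `\` xsection excl w) t.
Proof.
have tS (i : 'I_k) : tnth (tuple_cons (w, t)) (lift ord0 i) = tnth t i.
  by rewrite !(tnth_nth w).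
have t0 : tnth (tuple_cons (w, t)) ord0 = w by rewrite (tnth_nth w).
split=> [[h1 h2]|[Ww [h1 h2]]].
- split; first by rewrite -t0; exact: h1.
  split=> [i|i j ij].
    split; first by rewrite -tS; exact: h1.
    by move=> /xsectionP; rewrite -{1}t0 -tS; exact: h2.
  by rewrite -!tS; apply: h2; rewrite !lift0 ltnS.
- split=> [i|i j].
    by case: (unliftP ord0 i) => [i'|] ->; rewrite ?tS ?t0//; case: (h1 i').
  case: (unliftP ord0 j) => [j'|] ->; last by rewrite ltn0.
  case: (unliftP ord0 i) => [i'|] ->; rewrite ?tS ?t0.
    by rewrite !lift0 ltnS; exact: h2.
  by move=> _ e; have [_] := h1 j'; apply; apply/xsectionP.
Qed.

Lemma measure_hard_core_tuples W k :
  measure_power mu k (@hard_core_tuples W k) = hcvol mu excl k W.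
Proof.
elim: k W => [|k IH] W.
  rewrite /= diracE mem_set//; split => [i|i j]; first by move: (ltn_ord i); rewrite ltn0.
  by move: (ltn_ord i); rewrite ltn0.
rewrite measure_powerS/= [RHS]integral_mkcond; apply: eq_integral => w _.
rewrite patchE; case: ifPn => [/set_mem Ww|/negP nW].
  rewrite -IH; congr (_ _); rewrite predeqE => t.
  by split=> [/hard_core_tuplesS[]//|h]; apply/hard_core_tuplesS.
rewrite (_ : _ @^-1` _ = set0) ?measure0// -subset0 => t /hard_core_tuplesS[Ww _].
by apply: nW; exact: mem_set.
Qed.

End hard_core_tuples.

Section hard_sphere_void.
Context {R : realType} {d : nat}.
Local Notation E := (euclidean R d).
Local Notation r := ((@unit_volume_radius R d)%:num : R).
Local Notation leb := (lebesgue_euclidean R d).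

Definition overlap : set (E * E) := [set p | `|p.1 - p.2| < 2 * r].

Lemma overlap_measurable : measurable overlap.
Proof.
have m : measurable_fun setT (fun p : E * E => `|p.1 - p.2| : R).
  rewrite (_ : (fun _ => _) = fun p : E * E => Num.sqrt
      (\sum_(l < d) (p.1 ord0 l - p.2 ord0 l) ^+ 2)); last first.
    apply/funext => p; rewrite euclidean_normE; congr Num.sqrt.
    by apply: eq_bigr => l _; rewrite !mxE.
  apply: measurableT_comp.
    by apply: continuous_measurable_fun; exact: sqrt_continuous.
  apply: measurable_sum => l; apply: measurable_funX; apply: measurable_funB.
    exact: (measurableT_comp (measurable_coord l) measurable_fst).
  exact: (measurableT_comp (measurable_coord l) measurable_snd).
rewrite (_ : overlap = (fun p : E * E => `|p.1 - p.2| : R) @^-1` `]-oo, 2 * r[).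
  by rewrite -[X in measurable X]setTI; exact: m.
by rewrite predeqE => p; rewrite /overlap/= in_itv.
Qed.

Lemma overlapC (x y : E) : overlap (x, y) -> overlap (y, x).
Proof. by rewrite /overlap/= distrC. Qed.

Lemma xsection_overlap (w : E) : xsection overlap w = ball w (2 * r).
Proof. by rewrite predeqE => x; rewrite eballE; exact: xsectionP. Qed.

Definition void (B : set E) : set (configuration R d) :=
  [set X | (X : set E) `&` B = set0].

Variables (lam : {nonneg R}).

(** Avoiding [B] restricts every coordinate of a tuple to the inner region outside [B], so the
    weight of a void event is again a partition function. *)
Lemma hard_sphere_weight_void (L B : set E) :
  hard_sphere_weight lam L (void B) = hcZ leb overlap lam%:num (inner_region L `\` B).
Proof.
apply: eq_eseriesr => k _; congr (_ * _)%E.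
rewrite -measure_hard_core_tuples; congr (_ _); rewrite predeqE => x; split.
  move=> [[h1 h2] h3]; split=> [i|i j ij].
    split; first exact: h1.
    move=> Bi; have : ([set` x] `&` B) (tnth x i) by split => //; exact: mem_tnth.
    by have -> : [set` x] `&` B = set0 := h3.
  by rewrite /overlap/=; apply/negP; rewrite -leNgt; exact: h2.
move=> [h1 h2]; split; first split.
- by move=> i; case: (h1 i).
- by move=> i j ij; rewrite leNgt; apply/negP; exact: h2.
- rewrite /void/= -subset0 => y [/= /tnthP[i ->]].
  by case: (h1 i).
Qed.

Lemma hard_sphere_weightT (L : set E) :
  hard_sphere_weight lam L setT = hcZ leb overlap lam%:num (inner_region L).
Proof.
rewrite -[in RHS](setD0 (inner_region L)) -hard_sphere_weight_void; congr (_ _).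
by rewrite predeqE => X; split => // _; rewrite /void/= setI0.
Qed.

Lemma finite_region_bounded (W : set E) : bounded_set W -> measurable W ->
  finite_region leb W.
Proof. by move=> bW mW; split => //; exact: bounded_lebesgue_lty. Qed.

Lemma finite_region_inner (L : set E) : bounded_set L ->
  finite_region leb (inner_region L).
Proof.
move=> bL; apply: finite_region_bounded; last exact: inner_region_measurable.
by apply: bounded_setS bL => x [].
Qed.

Lemma hard_sphereE (L : set E) (A : set (configuration R d)) : bounded_set L ->
  hard_sphere lam L A = (hard_sphere_weight lam L A *
    (Zr leb overlap lam%:num (inner_region L))^-1%:E)%E.
Proof.
move=> bL.
transitivity (mnormalize (hard_sphere_weight lam L) \d_(empty_configuration) A) => //.
rewrite /mnormalize/= hard_sphere_weightT.
have [mW Woo] := finite_region_inner bL.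
have lam0 : 0 <= lam%:num by [].
have Z1 := hcZ_ge1 leb overlap lam0 (inner_region L).
have Zoo := hcZ_lty overlap_measurable lam0 mW Woo.
by rewrite gt_eqF ?(lt_le_trans _ Z1)// lt_eqF.
Qed.

Lemma hard_sphere_void (L B : set E) : bounded_set L -> measurable B ->
  hard_sphere lam L (void B) = (avoid leb overlap lam%:num (inner_region L) B)%:E.
Proof.
move=> bL mB; rewrite hard_sphereE// hard_sphere_weight_void /avoid EFinM.
have fL := finite_region_inner bL; have [mD Doo] := finite_regionD fL mB.
by rewrite {2}/Zr fineK// hcZ_fin_num//; exact: overlap_measurable.
Qed.

End hard_sphere_void.

(** * Contraction of the void probabilities *)

Section decay.
Context {R : realType} {d : nat}.
Hypothesis d0 : (0 < d)%N.
Local Notation E := (euclidean R d).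
Local Notation r := ((@unit_volume_radius R d)%:num : R).
Local Notation leb := (lebesgue_euclidean R d).
Local Notation N := (xsection (@overlap R d)).
Variable lam : R.
Hypothesis lam0 : 0 <= lam.
Local Notation avoid := (avoid leb overlap lam).
Local Notation nlav := (nlav leb overlap lam).
Local Notation region := (finite_region leb).

Let mov : measurable (@overlap R d).
Proof. exact: overlap_measurable. Qed.
Let ovC : forall x y : E, overlap (x, y) -> overlap (y, x).
Proof. exact: overlapC. Qed.
Let mN (w : E) : measurable (N w). Proof. exact: measurable_excl. Qed.

(** Two points of an open ball of radius [r] are closer than [2r], and finitely many such balls
    cover a bounded set. *)
Lemma clique_decomposition (B : set E) : bounded_set B -> measurable B ->
  exists (A : nat -> set E) n, (forall i, clique overlap (A i)) /\
    \big[setU/set0]_(i < n) A i = B.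
Proof.
move=> bB mB; have r0 : 0 < r by [].
have [c cov] := bounded_finite_cover bB r0.
exists (fun i => B `&` ball (nth 0 c i) r), (size c); split.
  move=> i; split; first by apply: measurableI => //; exact: eball_measurable.
  move=> [x y] [[/= _ +] [/= _]]; rewrite eballE/= /overlap/= => xc yc.
  rewrite -(subrK (nth 0 c i) x) -addrA (le_lt_trans (ler_normD _ _))//.
  by rewrite mulrDl mul1r ltrD// distrC.
rewrite -(bigcup_mkord _ (fun i => B `&` ball (nth 0 c i) r)) -setI_bigcupr.
exact: setIidl.
Qed.

Lemma nlav_close (B W W' : set E) (c : R) : bounded_set B -> measurable B ->
  region W -> region W' -> B `&` W = B `&` W' ->
  (forall D w, measurable D -> B w ->
    `|avoid (W `\` D) (N w) - avoid (W' `\` D) (N w)| <= c) ->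
  `|nlav W B - nlav W' B| <= lam * c * fine (leb (B `&` W)).
Proof.
move=> bB mB fW fW'; have [A [n [cA <-]]] := clique_decomposition bB mB.
exact: nlav_dist.
Qed.

Lemma nlav_le_volume (B W : set E) : bounded_set B -> measurable B ->
  region W -> nlav W B <= lam * fine (leb (B `&` W)).
Proof.
move=> bB mB fW; have [A [n [cA <-]]] := clique_decomposition bB mB.
exact: nlav_le.
Qed.

(** Through [1 - x <= expR (- x)], [nlav_le_volume] bounds the probability of hitting [B] uniformly
    in the region; the later approximations of open sets by compact ones rest on it. *)
Lemma avoid_ge_volume (B W : set E) : bounded_set B -> measurable B ->
  region W -> 1 - lam * fine (leb B) <= avoid W B.
Proof.
move=> bB mB fW; rewrite avoidE//.
apply: le_trans (expR_ge1Dx _); rewrite lerD2l lerN2.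
apply: (le_trans (nlav_le_volume bB mB fW)); apply: ler_wpM2l => //.
have fB := finite_region_bounded bB mB; case: (fB) => _ Boo; case: (fW) => mW _.
have mBW := measurableI _ _ mB mW.
have [_ BWoo] := finite_regionS fB mBW (@subIsetl _ _ _).
apply: fine_le; rewrite ?ge0_fin_numE//.
by apply: le_measure; rewrite ?inE.
Qed.

Lemma nlav_scale (B W W' : set E) (k : R) : 1 <= k ->
  bounded_set B -> measurable B ->
  region W -> region W' -> B `&` W = B `&` W' ->
  (forall D w, measurable D -> B w ->
    avoid (W' `\` D) (N w) <= k * avoid (W `\` D) (N w)) ->
  nlav W' B <= k * nlav W B.
Proof.
move=> k1 bB mB fW fW'; have [A [n [cA <-]]] := clique_decomposition bB mB.
exact: nlav_ratio.
Qed.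

(** The unit of length is [2r] because each use of the cluster identity moves the centre by less
    than [2r]. *)
Let agree (v : E) n (W W' : set E) :=
  ball v (2 * r * n%:R) `&` W = ball v (2 * r * n%:R) `&` W'.

Let agreeS v n W W' D w : agree v n.+1 W W' -> N v w ->
  agree w n (W `\` D) (W' `\` D).
Proof.
move=> WW' vw; rewrite /agree !setDE !setIA; congr (_ `&` _).
have sb : ball w (2 * r * n%:R) `<=` ball v (2 * r * n.+1%:R).
  move: vw; rewrite xsection_overlap !eballE/= => vw x /= wx.
  rewrite -(subrK w v) -addrA (le_lt_trans (ler_normD _ _))//.
  by rewrite -[n.+1%:R]natr1 [ltRHS]mulrDr mulr1 [ltRHS]addrC ltrD.
by rewrite -(setIidl sb) -!setIA WW'.
Qed.

Let agree_ball v n W W' : agree v n.+1 W W' -> N v `&` W = N v `&` W'.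
Proof.
move=> WW'; have sb : N v `<=` ball v (2 * r * n.+1%:R).
  rewrite xsection_overlap !eballE => x /= h; apply: (lt_le_trans h).
  by rewrite ler_peMr// ler1n.
by rewrite -(setIidl sb) -!setIA WW'.
Qed.

Let vol : R := 2 ^+ d.

Let volN (v : E) W : region W -> fine (leb (N v `&` W)) <= vol.
Proof.
move=> [mW _]; rewrite -lee_fin.
have := lebesgue_exclusion_ball v d0; rewrite -xsection_overlap => <-.
rewrite fineK ?ge0_fin_numE//; last first.
  apply: (@le_lt_trans _ _ (leb (N v))).
    by apply: le_measure; rewrite ?inE//; exact: measurableI.
  by rewrite xsection_overlap; exact: lebesgue_ball_lty.
by apply: le_measure; rewrite ?inE//; exact: measurableI.
Qed.

Let bN (v : E) : bounded_set (N v).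
Proof. by rewrite xsection_overlap; exact: bounded_ball. Qed.

Definition avoid_decay n (c : R) := forall v W W', region W -> region W' ->
  agree v n W W' -> `|avoid W (N v) - avoid W' (N v)| <= c.

(** One use of the identity gives an additive error [k] on [nlav] ([G]), hence a factor [expR k] on
    [avoid] ([G']); a second use puts this factor on [nlav] ([S]), and [expRN_log_lipschitz] returns
    the additive error [k / 2]. Two uses cost two units of agreement. *)
Lemma avoid_decayS n (c : R) : 0 <= c -> avoid_decay n c ->
  avoid_decay n.+2 (lam * vol / 2 * c).
Proof.
move=> c0 H.
have G v W W' : region W -> region W' -> agree v n.+1 W W' ->
    `|nlav W (N v) - nlav W' (N v)| <= lam * vol * c.
  move=> fW fW' WW'; apply: (le_trans (@nlav_close _ _ _ c _ _ _ _ _ _)) => //.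
  - exact: agree_ball WW'.
  - by move=> D w mD vw; apply: H; [exact: finite_regionD|exact: finite_regionD|exact: agreeS WW' vw].
  - by rewrite mulrAC ler_wpM2r// ler_wpM2l// volN.
set k := lam * vol * c in G *.
have k0 : 0 <= k by rewrite !mulr_ge0// exprn_ge0.
have G' v W W' : region W -> region W' -> agree v n.+1 W W' ->
    avoid W' (N v) <= expR k * avoid W (N v).
  move=> fW fW' WW'; rewrite !avoidE// -expRD ler_expR.
  have := G v W W' fW fW' WW'; rewrite ler_norml => /andP[_]; lra.
have S v W W' : region W -> region W' -> agree v n.+2 W W' ->
    nlav W' (N v) <= expR k * nlav W (N v).
  move=> fW fW' WW'; apply: nlav_scale => //.
  - by rewrite -[1]expR0 ler_expR.
  - exact: agree_ball WW'.
  - by move=> D w mD vw; apply: G'; [exact: finite_regionD|exact: finite_regionD|exact: agreeS WW' vw].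
have K v W W' : region W -> region W' -> agree v n.+2 W W' ->
    avoid W (N v) - avoid W' (N v) <= k / 2.
  move=> fW fW' WW'; rewrite !avoidE//; apply: expRN_log_lipschitz => //.
  - exact: nlav_ge0.
  - exact: S.
move=> v W W' fW fW' WW'.
rewrite (_ : lam * vol / 2 * c = k / 2); last by rewrite /k mulrAC.
rewrite ler_norml; apply/andP; split; last exact: K.
by rewrite lerNl opprB; apply: K.
Qed.

Lemma avoid_decay_exp n : avoid_decay (2 * n) ((lam * vol / 2) ^+ n).
Proof.
have k0 : 0 <= lam * vol / 2 by rewrite divr_ge0// mulr_ge0// exprn_ge0.
elim: n => [|n IH].
  (* At exponent 0 the bound is 1, and both probabilities lie between 0 and 1. *)
  move=> v W W' fW fW' _; rewrite expr0 ler_norml.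
  have := avoid_gt0 mov lam0 fW (mN v); have := avoid_gt0 mov lam0 fW' (mN v).
  have := avoid_le1 mov lam0 fW (mN v); have := avoid_le1 mov lam0 fW' (mN v).
  by move=> *; apply/andP; split; lra.
rewrite mulnS exprS; apply: avoid_decayS => //; exact: exprn_ge0.
Qed.

(** Both regions contain the ball of radius [2r * 2n] around every point of [B], so they agree
    there, and still do after a common set [D] is removed. *)
Lemma nlav_local n (M : R) (B W W' : set E) : measurable B -> B `<=` ball (0 : E) M ->
  region W -> region W' ->
  ball (0 : E) (M + 2 * r * (2 * n)%:R) `<=` W ->
  ball (0 : E) (M + 2 * r * (2 * n)%:R) `<=` W' ->
  `|nlav W B - nlav W' B| <= lam * (lam * vol / 2) ^+ n * fine (leb B).
Proof.
move=> mB BM fW fW' sW sW'.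
have bB : bounded_set B by apply: bounded_setS BM _; exact: bounded_ball.
have sub x w : B w -> ball w (2 * r * (2 * n)%:R) x ->
    ball (0 : E) (M + 2 * r * (2 * n)%:R) x.
  move=> /BM; rewrite !eballE/= !sub0r !normrN => wM wx.
  by rewrite -(subrK w x) (le_lt_trans (ler_normD _ _))// addrC ltrD// distrC.
have BW V : ball (0 : E) (M + 2 * r * (2 * n)%:R) `<=` V -> B `&` V = B.
  move=> sV; apply: setIidl => x /BM; rewrite eballE/= => xM; apply: sV.
  by rewrite eballE/= (lt_le_trans xM)// lerDl mulr_ge0.
apply: (le_trans (@nlav_close _ _ _ ((lam * vol / 2) ^+ n) _ _ _ _ _ _)) => //.
- by rewrite !BW.
- move=> D w mD Bw; apply: avoid_decay_exp; [exact: finite_regionD|exact: finite_regionD|].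
  rewrite /agree !setDE !setIA; congr (_ `&` _).
  by rewrite !setIidl// => x /(sub _ _ Bw); [exact: sW'|exact: sW].
- by rewrite BW.
Qed.

Hypothesis lam_small : lam * vol / 2 < 1.

Let exhausts (W : nat -> set E) := forall M : R, \forall n \near \oo,
  ball (0 : E) M `<=` W n.

(** A joint Cauchy condition: with [W] and [W'] both the balls it gives existence of the limit, with
    [W] arbitrary its independence of the sequence. *)
Lemma nlav_two_sequences (W W' : nat -> set E) (B : set E) :
  bounded_set B -> measurable B ->
  (forall n, region (W n)) -> (forall n, region (W' n)) ->
  exhausts W -> exhausts W' ->
  forall e : R, 0 < e -> \forall n \near \oo, \forall m \near \oo,
    `|nlav (W n) B - nlav (W' m) B| < e.
Proof.
move=> bB mB fW fW' xW xW' e e0.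
have [M M0 BM] := bounded_sub_ball bB.
have k0 : 0 <= lam * vol / 2 by rewrite divr_ge0// mulr_ge0// exprn_ge0.
have : lam * (lam * vol / 2) ^+ n * fine (leb B) @[n --> \oo] --> lam * 0 * fine (leb B).
  apply: cvgM; last exact: cvg_cst.
  apply: cvgM; first exact: cvg_cst.
  by apply: cvg_expr; rewrite ger0_norm.
rewrite mulr0 mul0r => /cvgrPdist_lt/(_ _ e0)[n _ /(_ n (leqnn n))/=].
rewrite sub0r normrN ger0_norm; last by rewrite !mulr_ge0// ?exprn_ge0// fine_ge0.
move=> small; near=> p; near=> q.
apply: le_lt_trans small; apply: (@nlav_local n M) => //.
- by near: p; exact: xW.
- by near: q; exact: xW'.
Unshelve. all: end_near. Qed.

Definition void_limit (B : set E) : R :=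
  lim (avoid (ball (0 : E) n%:R) B @[n --> \oo]).

Let ball_exhausts : exhausts (fun n => ball (0 : E) n%:R).
Proof.
move=> M; exists (Num.truncn M).+1 => // n /= Mn x; rewrite !eballE/=.
move=> /lt_le_trans; apply; apply/ltW/(lt_le_trans (truncnS_gt M)).
by rewrite ler_nat.
Qed.

Let ball_region n : region (ball (0 : E) n%:R).
Proof.
by apply: finite_region_bounded; [exact: bounded_ball|exact: eball_measurable].
Qed.

Lemma avoid_cvg (W : nat -> set E) (B : set E) : bounded_set B -> measurable B ->
  (forall n, region (W n)) ->
  (forall M : R, \forall n \near \oo, ball (0 : E) M `<=` W n) ->
  avoid (W n) B @[n --> \oo] --> void_limit B.
Proof.
move=> bB mB fW xW.
pose b n := nlav (ball (0 : E) n%:R) B.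
have cb : cvg (b n @[n --> \oo]).
  apply: cauchy_cvg; apply/cauchy_exP => e e0.
  have := nlav_two_sequences bB mB ball_region ball_region ball_exhausts ball_exhausts e0.
  move=> [n _ /(_ n (leqnn n))] h; exists (b n).
  by apply: filterS h => m; rewrite -ball_normE.
have cvgW (V : nat -> set E) : (forall n, region (V n)) -> exhausts V ->
    nlav (V n) B @[n --> \oo] --> lim (b n @[n --> \oo]).
  move=> fV xV; apply/cvgrPdist_lt => e e0.
  have e20 : 0 < e / 2 by rewrite divr_gt0.
  have h1 := nlav_two_sequences bB mB fV ball_region xV ball_exhausts e20.
  have /cvgrPdist_lt/(_ _ e20) h2 : b n @[n --> \oo] --> lim (b n @[n --> \oo]) by exact: cb.
  near=> n.
  have : \forall m \near \oo, `|nlav (V n) B - b m| < e / 2 by near: n.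
  move=> h1n; have [m [/= h1m h2m]] := filter_ex (filterI h1n h2).
  rewrite -(subrK (b m) (lim _)) -addrA (le_lt_trans (ler_normD _ _))//.
  by rewrite [ltRHS]splitr ltrD// distrC.
have cvgA (V : nat -> set E) : (forall n, region (V n)) -> exhausts V ->
    avoid (V n) B @[n --> \oo] --> expR (- lim (b n @[n --> \oo])).
  move=> fV xV; rewrite (_ : (fun n => _) = fun n => expR (- nlav (V n) B)); last first.
    by apply/funext => n; rewrite avoidE.
  apply: continuous_cvg; first exact: continuous_expR.
  by apply: cvgN; exact: cvgW.
rewrite /void_limit (cvg_lim _ (cvgA _ ball_region ball_exhausts))//.
exact: cvgA.
Unshelve. all: end_near. Qed.

End decay.

(** * The sigma-algebra generated by the void events *)

Section void_events.
Context {R : realType} {d : nat}.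
Local Notation E := (euclidean R d).
Local Notation conf := (configuration R d).

(** A countable base of open balls with rational centres. The closed version [crball] is what gets
    removed from an open set, so that the rest stays open. *)
Definition rball (p : d.-tuple rat * nat) : set E :=
  ball (rational_point p.1) p.2.+1%:R^-1.

Definition crball (p : d.-tuple rat * nat) : set E :=
  [set y | `|rational_point p.1 - y| <= p.2.+1%:R^-1].

Lemma rball_sub_crball p : rball p `<=` crball p.
Proof. by move=> x; rewrite /rball eballE/= /crball/= => /ltW. Qed.

Lemma rball_open p : open (rball p).
Proof. exact: ball_open. Qed.

Lemma crball_closed p : closed (crball p).
Proof.
have e0 : (0 : R) < p.2.+1%:R^-1 by rewrite invr_gt0.
rewrite (_ : crball p = closed_ball (rational_point p.1 : E) p.2.+1%:R^-1).
  exact: closed_ball_closed.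
by rewrite closed_ballE.
Qed.

Lemma crball_nbhs (x : E) (e : R) : 0 < e ->
  exists p, rball p x /\ crball p `<=` ball x e.
Proof.
move=> e0.
(* A rational centre within [1 / (m + 1)] of [x] leaves room in [ball x e] for the closed ball of
   that radius. *)
have [m me] : exists m, 2 * m.+1%:R^-1 < e.
  exists (Num.truncn (2 / e)); rewrite ltr_pdivrMr// (mulrC e) -ltr_pdivrMr//.
  exact: truncnS_gt.
have m0 : (0 : R) < m.+1%:R^-1 by rewrite invr_gt0.
have [q qx] := rational_point_dense x m0.
exists (q, m); split; first by rewrite /rball eballE/= distrC.
move=> y; rewrite /crball/= eballE/= => qy.
rewrite -(subrK (rational_point q) x) -addrA (le_lt_trans (ler_normD _ _))//.
by apply: lt_trans me; rewrite mulrDl mul1r ltr_leD.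
Qed.

Lemma finite_isolated (F : set E) (x : E) : finite_set F ->
  exists2 e : R, 0 < e & forall y, F y -> ball x e y -> y = x.
Proof.
move=> finF.
have cF : closed (F `\ x).
  have /accessible_finite_set_closed := hausdorff_accessible (@norm_hausdorff R E).
  by apply; exact: finite_setD.
have : nbhs x (~` (F `\ x)) by apply: open_nbhs_nbhs; split; [exact: closed_openC|by move=> [_]; apply].
move=> /nbhs_ballP[e /= e0 h]; exists e => // y Fy /h; apply: contra_notP => yx.
by split.
Qed.

Lemma points_finite (X : conf) (B : set E) : bounded_set B ->
  finite_set ((X : set E) `&` B).
Proof. by move=> bB; exact: points_locally_finite. Qed.

Definition count (X : conf) (B : set E) : nat := #|` fset_set ((X : set E) `&` B)|.

Lemma le_count X (B B' : set E) : bounded_set B' -> B `<=` B' ->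
  (count X B <= count X B')%N.
Proof.
move=> bB' BB'; apply: fsubset_leq_card; rewrite -fset_set_sub; last 2 first.
- by apply: points_finite; exact: bounded_setS bB'.
- exact: points_finite.
exact: setIS.
Qed.

Lemma count_setD X (B B' : set E) : bounded_set B' -> B `<=` B' ->
  count X (B' `\` B) = (count X B' - count X B)%N.
Proof.
move=> bB' BB'; have bB := bounded_setS BB' bB'.
have fB := points_finite X bB; have fB' := points_finite X bB'.
rewrite /count (_ : _ `&` _ = ((X : set E) `&` B') `\` ((X : set E) `&` B)); last first.
  rewrite predeqE => x; split=> [[Xx [B'x Bx]]|[[Xx B'x] h]].
    by split=> // -[].
  by split=> //; split=> // Bx; apply: h.
rewrite fset_setD// cardfsD (fsetIidPr _)//.
by rewrite -fset_set_sub//; exact: setIS.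
Qed.

Lemma count_gt0 X (B : set E) : bounded_set B -> (0 < count X B)%N <-> ~ void B X.
Proof.
move=> bB; have fin := points_finite X bB.
rewrite /void/= /count cardfs_gt0; split.
  by move=> /fset0Pn[x]; rewrite in_fset_set// inE => xXB h; move: xXB; rewrite h.
move=> /eqP/set0P[x xXB]; apply/fset0Pn; exists x.
by rewrite in_fset_set// inE.
Qed.

End void_events.

Section void_events_generate.
Context {R : realType} {d : nat}.
Local Notation E := (euclidean R d).
Local Notation conf := (configuration R d).

Definition bounded_open (U : set E) := bounded_set U /\ open U.

Definition void_opens : set (set conf) :=
  [set A | exists2 U, bounded_open U & A = void U].

Local Notation Tg := (g_sigma_algebraType void_opens).

Let sigma_void_open U : bounded_open U -> measurable (void U : set Tg).
Proof. by move=> bU; apply: sub_sigma_algebra; exists U. Qed.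

Lemma rball_index_countable : countable [set: d.-tuple rat * nat].
Proof. exact: countableP. Qed.

Let count_splitE (X : conf) U p : bounded_set U -> (count X U =
  count X (U `\` crball p) + count X (U `&` crball p))%N.
Proof.
move=> bU; have -> : U `\` crball p = U `\` (U `&` crball p).
  by rewrite setDIr setDv set0U.
have sU : U `&` crball p `<=` U by exact: subIsetl.
by rewrite count_setD// subnK// le_count.
Qed.

(** Counting reduces to hitting: [n.+1] points lie in [U] as soon as a rational ball is hit inside
    [U] and [n] points remain after its closed version is removed. Conversely, local finiteness
    provides a ball isolating one point. *)
Let measurable_count_open n U : bounded_open U ->
  measurable ([set X | (n <= count X U)%N] : set Tg).
Proof.
elim: n U => [|n IH] U [bU oU].
  by rewrite (_ : [set _ | _] = setT)// predeqE.
rewrite (_ : [set _ | _] = \bigcup_p (~` void (rball p `&` U) `&`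
    [set X | (n <= count X (U `\` crball p))%N])).
  apply: countable_bigcupT_measurable; first exact: rball_index_countable.
  move=> p; apply: measurableI.
    apply: measurableC; apply: sigma_void_open; split.
      by apply: bounded_setS bU; exact: subIsetr.
    by apply: openI => //; exact: rball_open.
  apply: IH; split; first by apply: bounded_setS bU; exact: subDsetl.
  by rewrite setDE; apply: openI => //; apply: closed_openC; exact: crball_closed.
rewrite predeqE => X; split=> [/= nX|[p _ [/= hit nX]]].
  have /count_gt0 : (0 < count X U)%N by exact: leq_trans nX.
  move=> /(_ bU)/eqP/set0P[x [Xx Ux]].
  have [e e0 iso] := finite_isolated x (points_finite X bU).
  have [p [px pe]] := crball_nbhs x e0.
  exists p => //; split => /=.
    move=> h; have : ((X : set E) `&` (rball p `&` U)) x by [].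
    by rewrite h.
  have c1 : (count X (U `&` crball p) <= 1)%N.
    rewrite /count (_ : _ `&` _ = [set x]) ?fset_set1 ?cardfs1//.
    rewrite predeqE => y; split=> [[Xy [Uy /pe xy]]|->]; first exact: (iso y).
    by split => //; split => //; exact: rball_sub_crball.
  move: nX; rewrite (count_splitE X p bU).
  by move: c1; move: (count X (U `&` _)) (count X (U `\` _)) => a b; lia.
have : (0 < count X (U `&` crball p))%N.
  apply/count_gt0; first by apply: bounded_setS bU; exact: subIsetl.
  move=> h; apply: hit; rewrite /void/= -subset0 => x [Xx [px Ux]].
  have : ((X : set E) `&` (U `&` crball p)) x.
    by split => //; split => //; exact: rball_sub_crball.
  by rewrite h.
rewrite (count_splitE X p bU); move: nX.
by move: (count X (U `&` _)) (count X (U `\` _)) => a b; lia.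
Qed.

Let finite_sub_ndseq (A : set E) (F : (set E)^nat) : finite_set A ->
  nondecreasing_seq F -> A `<=` \bigcup_i F i -> exists i, A `<=` F i.
Proof.
move=> finA ndF AF.
have /choice[f fP] : forall x, exists i, A x -> F i x.
  move=> x; have [Ax|nA] := pselect (A x); last by exists 0%N.
  by have [i _ Fi] := AF _ Ax; exists i.
exists (\max_(x <- fset_set A) f x)%N => x Ax.
have := fP x Ax; apply/subsetPset/ndF.
by apply: leq_bigmax_seq => //; rewrite in_fset_set// inE.
Qed.

(** The sets with measurable counts form a lambda-system containing the open sets. Intersecting with
    a fixed ball keeps the point sets finite, so that counts can be subtracted. *)
Let measurable_count (M : R) n (B : set E) : measurable B ->
  measurable ([set X | (n <= count X (B `&` ball (0%R : E) M))%N] : set Tg).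
Proof.
have bD (A : set E) : bounded_set (A `&` ball (0%R : E) M).
  by apply: bounded_setS (@bounded_ball _ _ (0%R : E) M); exact: subIsetr.
pose H : set (set E) := [set B | forall n,
  measurable ([set X | (n <= count X (B `&` ball (0%R : E) M))%N] : set Tg)].
suff : <<s @open E >> `<=` H by move=> /[apply]; apply.
apply: lambda_system_subset => //.
- by move=> A B' oA oB; exact: openI.
- split => //.
  + move=> m; rewrite setTI; apply: measurable_count_open; split.
      exact: bounded_ball.
    exact: ball_open.
  + move=> A A' A'A HA HA' m /=.
    have AE : (A `\` A') `&` ball (0%R : E) M =
        (A `&` ball (0%R : E) M) `\` (A' `&` ball (0%R : E) M).
      by apply/seteqP; split=> x;
        [move=> [[? ?] ?]; split => // -[]|move=> [[? ?] h]; split => //; split => // ?; apply: h].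
    have sub : A' `&` ball (0%R : E) M `<=` A `&` ball (0%R : E) M by exact: setSI.
    (* The witness [k] is the number of points in [A']; the difference has at least [m] points when
       [A] has at least [m + k] and [A'] at most [k]. *)
    rewrite (_ : [set _ | _] = \bigcup_k
      ([set X | (m + k <= count X (A `&` ball (0%R : E) M))%N] `&`
       ~` [set X | (k.+1 <= count X (A' `&` ball (0%R : E) M))%N])).
      apply: bigcupT_measurable => k; apply: measurableI; first exact: HA.
      by apply: measurableC; exact: HA'.
    rewrite predeqE => X; rewrite /= AE count_setD//.
    have := le_count X (bD A) sub => le.
    split => [h|[k _ [/= h1 /negP]]].
      exists (count X (A' `&` ball (0%R : E) M)) => //=; split; last by rewrite ltnn.
      move: le h; move: (count X (A `&` _)) (count X (A' `&` _)) => a b; lia.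
    move: le h1; move: (count X (A `&` _)) (count X (A' `&` _)) => a b; lia.
  + move=> F ndF HF m /=.
    rewrite (_ : [set _ | _] = \bigcup_k
        [set X | (m <= count X (F k `&` ball (0%R : E) M))%N]).
      by apply: bigcupT_measurable => k; exact: HF.
    rewrite predeqE => X; split => /= [h|[k _ /= h]].
      have [|||i sF] := @finite_sub_ndseq
          ((X : set E) `&` ((\bigcup_i F i) `&` ball (0%R : E) M)) F.
      * exact: points_finite.
      * exact: ndF.
      * by move=> x [_ []].
      exists i => //=; apply: (leq_trans h).
      rewrite /count (_ : _ `&` _ = (X : set E) `&` (F i `&` ball (0%R : E) M))//.
      rewrite predeqE => x; split=> [[Xx [FX Bx]]|[Xx [Fx Bx]]].
        by split=> //; split => //; apply: sF.
      by split=> //; split => //; exists i.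
    by apply: (leq_trans h); apply: le_count => //; apply: setSI; exact: bigcup_sup.
- move=> U oU m /=; apply: measurable_count_open; split => //.
  by apply: openI => //; exact: ball_open.
Qed.

Lemma counting_events_sub_void : counting_events `<=` <<s void_opens >>.
Proof.
move=> _ [B [n [mB bB ->]]].
have [M M0 BM] := bounded_sub_ball bB.
have BE : B `&` ball (0%R : E) M = B by exact: setIidl.
have -> : [set X : conf | (X `&` B #= `I_n)%card] =
    [set X | (n <= count X (B `&` ball (0%R : E) M))%N] `\`
    [set X | (n.+1 <= count X (B `&` ball (0%R : E) M))%N].
  rewrite predeqE => X /=; rewrite BE; have fin := points_finite X bB.
  split=> [/card_fset_set h|[h1 /negP h2]]; first by rewrite /count h leqnn ltnn.
  have /finite_setP[m Xm] := fin.
  move: h1 h2; rewrite /count (card_fset_set Xm) -leqNgt => h1 h2.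
  by rewrite (_ : n = m)//; apply/eqP; rewrite eqn_leq h1.
by apply: (@measurableD _ Tg); exact: measurable_count.
Qed.

Lemma measurable_void (B : set E) : bounded_set B -> measurable B ->
  measurable (void B).
Proof.
move=> bB mB; apply: sub_sigma_algebra; exists B, 0%N; split => //.
rewrite predeqE => X; rewrite /void/= II0; split=> [->|]; first exact: card_eq00.
by rewrite card_eq0 => /eqP.
Qed.

Lemma measurable_void_open (U : set E) : bounded_open U -> measurable (void U).
Proof.
by move=> [bU oU]; apply: measurable_void => //; exact: open_euclidean_measurable.
Qed.

(** With [void_opens_setI_closed], this makes the void events a generating pi-system, so that they
    determine a law. *)
Lemma measurable_configuration_void :
  @measurable _ conf = <<s void_opens >>.
Proof.
rewrite eqEsubset; split.
  apply: smallest_sub; last exact: counting_events_sub_void.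
  exact: smallest_sigma_algebra.
apply: smallest_sub; first exact: sigma_algebra_measurable.
by move=> _ [U bU ->]; exact: measurable_void_open.
Qed.

Lemma voidU (A B : set E) : void A `&` void B = void (A `|` B).
Proof.
rewrite predeqE => X; rewrite /void/= setIUr; split=> [[-> ->]|]; first by rewrite setU0.
by rewrite setU_eq0.
Qed.

Lemma bounded_openU (A B : set E) : bounded_open A -> bounded_open B ->
  bounded_open (A `|` B).
Proof. by move=> [? ?] [? ?]; split; [exact: bounded_setU|exact: openU]. Qed.

Lemma void_opens_setI_closed : setI_closed void_opens.
Proof.
move=> _ _ [U bU ->] [V bV ->]; exists (U `|` V); first exact: bounded_openU.
exact: voidU.
Qed.

End void_events_generate.

(** * Existence of a limit law *)

Section algebra_extension.
Context {T : pointedType} {R : realType}.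
Variables (alg : set (set T)) (m : set T -> R).
Hypotheses (alg0 : alg set0) (algU : setU_closed alg) (algC : setC_closed alg).
Hypothesis m_ge0 : forall A, alg A -> 0 <= m A.
Hypothesis mU : forall A B, alg A -> alg B -> A `&` B = set0 ->
  m (A `|` B) = m A + m B.
Hypothesis m_continuous : forall D : (set T)^nat, (forall n, alg (D n)) ->
  (forall n, D n.+1 `<=` D n) -> \bigcap_n D n = set0 ->
  forall e : R, 0 < e -> exists n, m (D n) < e.

(** An alias, so that the algebra [alg] can be attached to a type that may already carry a
    sigma-algebra. *)
Definition algebra_type : Type := T.
HB.instance Definition _ := Pointed.on algebra_type.
Definition algebra_display : measure_display.
Proof. exact: default_measure_display. Qed.
HB.instance Definition _ :=
  @isAlgebraOfSets.Build algebra_display algebra_type alg alg0 algU algC.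

Definition algebra_content (A : set algebra_type) : \bar R :=
  if `[< alg A >] then (m A)%:E else 0%E.

Let contentE A : alg A -> algebra_content A = (m A)%:E.
Proof. by move=> aA; rewrite /algebra_content asboolT. Qed.

Let m0 : m set0 = 0.
Proof.
have := mU alg0 alg0 (setI0 _); rewrite setU0 => /eqP.
by rewrite -subr_eq0 opprD addNKr oppr_eq0 => /eqP.
Qed.

Let content_ge0 A : (0 <= algebra_content A)%E.
Proof. by rewrite /algebra_content; case: asboolP => // /m_ge0; rewrite lee_fin. Qed.

Let content_additive : measure_function.semi_additive algebra_content.
Proof.
apply/additive2P; first by rewrite contentE// m0.
move=> A B mA mB AB; rewrite !contentE//; last exact: algU.
by rewrite mU.
Qed.

HB.instance Definition _ := isContent.Build _ _ _ algebra_content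
  content_ge0 content_additive.

Let le_m A B : alg A -> alg B -> A `<=` B -> m A <= m B.
Proof.
move=> aA aB AB; have aBA : alg (B `\` A).
  by rewrite -[B `\` A]setCK setCD; apply: algC; apply: algU => //; exact: algC.
by rewrite -(setDUK AB) mU ?lerDl ?m_ge0// setDIK.
Qed.

(** Finitely many [A i] cover [B] up to the rest outside [S n], which decreases to the empty set and
    so has small content. *)
Let content_subadditive : measurable_subset_sigma_subadditive algebra_content.
Proof.
move=> B A mA mB BA; rewrite contentE//.
have aA n : alg (A n) by exact: mA.
pose S n := \big[setU/set0]_(i < n) A i.
have aS n : alg (S n).
  by apply: (big_ind (fun X => alg X)) => // i _; exact: mA.
have algD X Y : alg X -> alg Y -> alg (X `\` Y).
  by move=> aX aY; rewrite -[X `\` Y]setCK setCD; apply: algC; apply: algU => //; exact: algC.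
have mS n : m (S n) <= \sum_(i < n) m (A i).
  elim: n => [|n IH]; first by rewrite /S !big_ord0 m0.
  rewrite /S !big_ord_recr/= -/(S n) -(setDUK (@subsetUl _ (S n) (A n))).
  rewrite mU//; last by rewrite setDIK.
    by apply: lerD => //; apply: le_m => //; [apply: algD => //; exact: algU|by move=> x [[h /(_ h)|]]].
  by apply: algD => //; exact: algU.
apply/lee_addgt0Pr => e e0.
have [|||n] := @m_continuous (fun n => B `\` S n) _ _ _ e e0.
- by move=> n; exact: algD.
- by move=> n x [Bx Sx]; split => // Snx; apply: Sx; rewrite /S big_ord_recr; left.
- rewrite -subset0 => x /= h.
  have [Bx _] := h 0%N Logic.I.
  have [i _ Aix] := BA _ Bx; have [_] := h i.+1 Logic.I.
  by apply; rewrite /S big_ord_recr; right.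
move=> small.
apply: (@le_trans _ _ ((\sum_(i < n) m (A i))%:E + e%:E)%E).
  rewrite -EFinD lee_fin.
  have : m B <= m (S n) + m (B `\` S n).
    rewrite -mU//; last by rewrite setDIK.
      by apply: le_m => //; [apply: algU => //; exact: algD|move=> x Bx; have [|] := pselect (S n x); [left|right]].
    exact: algD.
  by have := mS n; lra.
apply: leeD2r; rewrite -sumEFin.
rewrite (eq_bigr (fun i : 'I_n => algebra_content (A i))); last by move=> i _; rewrite contentE.
by rewrite -(big_mkord predT (fun i => algebra_content (A i))); apply: nneseries_lim_ge.
Qed.

HB.instance Definition _ := Content_SigmaSubAdditive_isMeasure.Build _ _ _
  algebra_content content_subadditive.

(** Caratheodory extension, delivered as a bare set function so that it can be repackaged as a
    measure on the sigma-algebra that configurations carry. *)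
Lemma algebra_extension : exists Q : set T -> \bar R,
  [/\ Q set0 = 0%E, forall A, (0 <= Q A)%E,
      forall F : (set T)^nat, (forall n, <<s alg >> (F n)) -> trivIset setT F ->
        (\sum_(0 <= i < n) Q (F i))%E @[n --> \oo] --> Q (\bigcup_n F n) &
      forall A, alg A -> Q A = (m A)%:E].
Proof.
pose I := g_sigma_algebraType (@measurable _ algebra_type).
pose Q : {measure set I -> \bar R} := measure_extension algebra_content.
exists Q; split.
- exact: (measure0 Q).
- by move=> A; exact: (measure_ge0 Q).
- move=> F mF tF; have mUF : measurable (\bigcup_n F n : set I).
    by apply: (@bigcupT_measurable _ I) => n; exact: mF.
  exact: (@measure_semi_sigma_additive _ I _ Q F mF tF mUF).
- by move=> A aA; rewrite -contentE//; exact: measurable_mu_extE.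
Qed.

End algebra_extension.

(** * Hard-core configurations and compact approximation of open sets *)

Section hard_core_configurations.
Context {R : realType} {d : nat}.
Local Notation E := (euclidean R d).
Local Notation conf := (configuration R d).
Local Notation r := ((@unit_volume_radius R d)%:num : R).
Local Notation leb := (lebesgue_euclidean R d).

Definition separated (S : set E) :=
  forall x y, S x -> S y -> x <> y -> 2 * r <= `|x - y|.

Definition hard_core : set conf := [set X | separated X].

(** A ball of radius [r] contains at most one point of [S], and finitely many such balls cover
    [B]. *)
Lemma separated_locally_finite (S : set E) : separated S -> locally_finite S.
Proof.
move=> sS B bB; have r0 : 0 < r by [].
have [c cov] := bounded_finite_cover bB r0.
apply: (@sub_finite_set _ _ (\bigcup_(i in `I_(size c)) (S `&` ball (nth 0 c i) r))).
  by move=> x [Sx /cov[i ic xi]]; exists i.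
apply: bigcup_finite => // i _.
have [->|/set0P[x [Sx xi]]] := eqVneq (S `&` ball (nth 0 c i) r) set0.
  exact: finite_set0.
apply: (@sub_finite_set _ _ [set x]); last exact: finite_set1.
move=> y [Sy yi]; apply: contrapT => /(sS _ _ Sy Sx); apply/negP; rewrite -ltNge.
move: xi yi; rewrite !eballE/= => xi yi.
rewrite -(subrK (nth 0 c i) y) -addrA (le_lt_trans (ler_normD _ _))//.
by rewrite mulrDl mul1r ltrD// distrC.
Qed.

(** Pairs of rational balls that no hard-core configuration can both hit. They turn the failure of
    the hard core into a countable union of events expressed by void events, which is measurable and
    stays null in the limit. *)
Definition overlapping_pairs :
    set ((d.-tuple rat * nat) * (d.-tuple rat * nat)) :=
  [set p | forall x y, rball p.1 x -> rball p.2 y -> x <> y /\ `|x - y| < 2 * r].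

Lemma hard_coreC : ~` hard_core = \bigcup_(p in overlapping_pairs)
  (~` void (rball p.1) `&` ~` void (rball p.2)).
Proof.
rewrite predeqE => X; split=> [|[p hp [/eqP/set0P[x [Xx px]] /eqP/set0P[y [Xy py]]]] sX].
  move=> h; apply: contrapT => h2; apply: h => x y Xx Xy xy.
  rewrite leNgt; apply/negP => lt; apply: h2.
  have xy0 : 0 < `|x - y| by rewrite normr_gt0 subr_eq0; exact/eqP.
  have e10 : 0 < `|x - y| / 2 by rewrite divr_gt0.
  have e20 : 0 < (2 * r - `|x - y|) / 2 by rewrite divr_gt0// subr_gt0.
  (* Displacements below [e] keep the two points distinct (first bound) and closer than [2r] (second
     bound). *)
  pose e := Num.min (`|x - y| / 2) ((2 * r - `|x - y|) / 2).
  have e0 : 0 < e by rewrite lt_min e10.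
  have [p [px pe]] := crball_nbhs x e0; have [q [qy qe]] := crball_nbhs y e0.
  exists (p, q) => /=.
    move=> x' y' /rball_sub_crball/pe + /rball_sub_crball/qe.
    rewrite !eballE/= => h1 h2.
    have {}h1 : `|x - x'| < `|x - y| / 2 /\ `|x - x'| < (2 * r - `|x - y|) / 2.
      by apply/andP; rewrite -lt_min.
    have {}h2 : `|y - y'| < `|x - y| / 2 /\ `|y - y'| < (2 * r - `|x - y|) / 2.
      by apply/andP; rewrite -lt_min.
    split.
      move=> x'y'; have := ler_distD x' x y; rewrite [X in _ <= _ + X]distrC.
      by rewrite x'y' in h1 *; move: h1 h2 => [h1 _] [h2 _]; lra.
    have := ler_distD x x' y'; rewrite (distrC x' x).
    have := ler_distD y x y'.
    by move: h1 h2 => [_ h1] [_ h2]; lra.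
  split; apply/eqP/set0P; [by exists x|by exists y].
have [xy lt] := hp _ _ px py.
by move: lt; rewrite ltNge => /negP; apply; exact: sX.
Qed.

Lemma rball_bounded_open p : bounded_open (@rball R d p).
Proof. by split; [exact: bounded_ball|exact: rball_open]. Qed.

Lemma measurable_hard_coreC : measurable (~` hard_core).
Proof.
rewrite hard_coreC bigcup_mkcond; apply: countable_bigcupT_measurable.
  exact: countableP.
move=> p; case: ifPn => // _; apply: measurableI; apply: measurableC;
  by apply: measurable_void_open; exact: rball_bounded_open.
Qed.

Lemma measurable_hard_core : measurable hard_core.
Proof. by rewrite -[hard_core]setCK; apply: measurableC; exact: measurable_hard_coreC. Qed.

Lemma hard_sphere_hard_core (lam : {nonneg R}) (L : set E) : bounded_set L ->
  hard_sphere lam L (~` hard_core) = 0%E.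
Proof.
move=> bL; rewrite hard_sphereE// (_ : hard_sphere_weight _ _ _ = 0%E) ?mul0e//.
apply: eseries0 => k _ _.
rewrite (_ : _ `&` _ = set0) ?measure0 ?mule0// -subset0 => x [[_ sep]] /= h.
apply: h => _ _ /= /tnthP[i ->] /tnthP[j ->] ij.
case: (ltngtP i j) => [lt|lt|/val_inj e].
- exact: sep.
- by rewrite distrC; exact: sep.
- by move: ij; rewrite e.
Qed.

(** [K m] consists of the points at distance at least [1 / (m + 1)] from the complement of [U]; the
    volumes converge by continuity from above. *)
Lemma compact_exhaustion (U : set E) : bounded_open U ->
  exists K : nat -> set E, [/\ forall m, compact (K m), forall m, K m `<=` U,
    forall m n, (m <= n)%N -> K m `<=` K n, U `<=` \bigcup_m K m &
    fine (leb (U `\` K m)) @[m --> \oo] --> 0].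
Proof.
move=> [bU oU].
pose K m : set E := \bigcap_(y in ~` U) [set x | m.+1%:R^-1 <= `|x - y|].
have cK m : closed (K m).
  apply: closed_bigI => y _.
  rewrite (_ : [set x : E | _] = ~` (ball y m.+1%:R^-1)).
    by apply: open_closedC; exact: ball_open.
  rewrite predeqE => x; rewrite eballE/= distrC leNgt.
  by split=> /negP.
have KU m : K m `<=` U.
  move=> x Kx; apply: contrapT => nU; have := Kx _ nU.
  by rewrite /= subrr normr0 leNgt invr_gt0 ltr0n.
have KK m n : (m <= n)%N -> K m `<=` K n.
  move=> mn x Kx y yU; apply: le_trans (Kx y yU).
  by rewrite lef_pV2 ?posrE// ler_nat.
have UK : U `<=` \bigcup_m K m.
  move=> x Ux; have /nbhs_ballP[s /= s0 sU] : nbhs x U by exact: open_nbhs_nbhs.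
  exists (Num.truncn s^-1) => // y yU /=; rewrite leNgt; apply/negP => xy.
  apply: yU; apply: sU; rewrite eballE/=; apply: lt_trans xy _.
  by rewrite invf_plt ?posrE//; exact: truncnS_gt.
have mU := open_euclidean_measurable oU.
have mK m : measurable (K m) by apply: closed_euclidean_measurable.
have Uoo := bounded_lebesgue_lty bU mU.
exists K; split => //.
  move=> m; apply: euclidean_bounded_closed_compact; last exact: cK.
  exact: bounded_setS (KU m) bU.
have : leb (U `\` K m) @[m --> \oo] --> leb (\bigcap_m (U `\` K m)).
  apply: nonincreasing_cvg_mu.
  - apply: le_lt_trans Uoo; apply: le_measure; rewrite ?inE//.
    exact: measurableD.
  - by move=> m; exact: measurableD.
  - by apply: bigcapT_measurable => m; exact: measurableD.
  - by move=> m n mn; apply/subsetPset => x [Ux nK]; split => // /(KK m n mn).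
rewrite (_ : \bigcap_m _ = set0); last first.
  rewrite -subset0 => x h; have [/UK[m _ Kx] _] := h 0%N Logic.I.
  by have [_] := h m Logic.I; apply.
by rewrite measure0 => /fine_cvgP[].
Qed.

Lemma compact_inner_approx (U : set E) (e : R) : bounded_open U -> 0 < e ->
  exists K : set E, [/\ K `<=` U, compact K & (leb (U `\` K) <= e%:E)%E].
Proof.
move=> bUo e0; have [bU oU] := bUo; have mU := open_euclidean_measurable oU.
have [K [cK KU _ _ /cvgrPdist_lt/(_ _ e0)[m _ /(_ m (leqnn m))/= Ke]]] :=
  compact_exhaustion bUo.
exists (K m); split => //.
have mK : measurable (K m).
  by apply: closed_euclidean_measurable; apply: compact_closed => //; exact: norm_hausdorff.
rewrite -[leb _]fineK.
  by move: Ke; rewrite sub0r normrN lee_fin => /ltW; apply: le_trans; exact: ler_norm.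
rewrite ge0_fin_numE//; apply: bounded_lebesgue_lty; last exact: measurableD.
by apply: bounded_setS bU; exact: subDsetl.
Qed.

End hard_core_configurations.

Lemma ultra_fmap (S T : Type) (f : S -> T) (F : set_system S) :
  UltraFilter F -> UltraFilter (f @ F).
Proof.
move=> FU; split; first exact: fmap_proper_filter.
move=> G GF sG; rewrite predeqE => A; split; last exact: sG.
move=> GA; have [//|FnA] := in_ultra_setVsetC (f @^-1` A) FU.
have : G (~` A) by apply: sG; exact: FnA.
by move=> /(filterI GA); rewrite setICr => /filter_not_empty.
Qed.

(** * Ultrafilter limits of the finite-volume laws *)

Section weak_limit_existence.
Context {R : realType} {d : nat}.
Local Notation E := (euclidean R d).
Local Notation conf := (configuration R d).
Local Notation leb := (lebesgue_euclidean R d).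
Variables (P : nat -> probability conf R) (p : set E -> R) (lam : R).
Hypothesis lam0 : 0 <= lam.
Hypothesis P_hard_core : forall n, P n (~` @hard_core R d) = 0%E.
Hypothesis P_void : forall B : set E, bounded_set B -> measurable B ->
  fine (P n (void B)) @[n --> \oo] --> p B.
Hypothesis P_void_ge : forall n (B : set E), bounded_set B -> measurable B ->
  1 - lam * fine (leb B) <= fine (P n (void B)).

Let pr n A := fine (P n A).

Let prE n A : measurable A -> P n A = (pr n A)%:E.
Proof. by move=> mA; rewrite /pr fineK// fin_num_measure. Qed.

Let pr_ge0 n A : 0 <= pr n A.
Proof. by rewrite fine_ge0. Qed.

Let pr_le1 n A : measurable A -> pr n A <= 1.
Proof. by move=> mA; rewrite -lee_fin -prE// probability_le1. Qed.

Let prT n : pr n setT = 1.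
Proof. by rewrite /pr probability_setT. Qed.

Let prU n A B : measurable A -> measurable B -> A `&` B = set0 ->
  pr n (A `|` B) = pr n A + pr n B.
Proof.
move=> mA mB AB; apply: EFin_inj; rewrite EFinD -!prE//; last exact: measurableU.
by rewrite measureU.
Qed.

Let le_pr n A B : measurable A -> measurable B -> A `<=` B -> pr n A <= pr n B.
Proof. by move=> mA mB AB; rewrite -lee_fin -!prE// le_measure ?inE. Qed.

Section ultralimit.
Variable U : set_system nat.
Hypothesis UU : UltraFilter U.
Hypothesis U_oo : nbhs \oo `<=` U.

Definition ulim (A : set conf) : R := lim (pr n A @[n --> U]).

(** The probabilities lie in a compact interval, so one ultrafilter makes them converge for every
    event. *)
Lemma ulim_cvg A : measurable A -> pr n A @[n --> U] --> ulim A.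
Proof.
move=> mA; have := @segment_compact R 0 1.
rewrite compact_ultra => /(_ _ (ultra_fmap (fun n => pr n A) UU)) [].
  apply: (@filterS _ U _ setT); last exact: filterT.
  by move=> n _; rewrite /= in_itv/= pr_ge0 pr_le1.
by move=> l [_ /cvgP].
Qed.

Lemma ulim_cvg_oo A (l : R) : measurable A -> pr n A @[n --> \oo] --> l -> ulim A = l.
Proof.
move=> mA h; apply: cvg_lim => //; apply: cvg_trans h => X; exact: U_oo.
Qed.

Lemma ulim_ge0 A : measurable A -> 0 <= ulim A.
Proof.
move=> mA; apply: (limr_ge (cvgP _ (ulim_cvg mA))).
by apply: nearW => n; exact: pr_ge0.
Qed.

Lemma ulim_le (A : set conf) (c : R) : measurable A -> (forall n, pr n A <= c) ->
  ulim A <= c.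
Proof.
move=> mA h; apply: (limr_le (cvgP _ (ulim_cvg mA))); exact: nearW.
Qed.

Lemma ulimU A B : measurable A -> measurable B -> A `&` B = set0 ->
  ulim (A `|` B) = ulim A + ulim B.
Proof.
move=> mA mB AB.
apply: cvg_lim => //.
rewrite (_ : (fun n => _) = (fun n => pr n A) \+ (fun n => pr n B)).
  exact: (cvgD (ulim_cvg mA) (ulim_cvg mB)).
by apply/funext => n /=; rewrite prU.
Qed.

Lemma le_ulim A B : measurable A -> measurable B -> A `<=` B -> ulim A <= ulim B.
Proof.
move=> mA mB AB; rewrite -(setDUK AB) ulimU//; last by rewrite setDIK.
  by rewrite lerDl ulim_ge0//; exact: measurableD.
exact: measurableD.
Qed.

Lemma ulimT : ulim setT = 1.
Proof.
apply: ulim_cvg_oo => //; rewrite (_ : (fun n => _) = cst 1); first exact: cvg_cst.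
by apply/funext => n; rewrite prT.
Qed.

Lemma ulim_void (B : set E) : bounded_set B -> measurable B -> ulim (void B) = p B.
Proof.
by move=> bB mB; apply: ulim_cvg_oo; [exact: measurable_void|exact: P_void].
Qed.

Lemma ulim_gt0_hard_core A : measurable A -> 0 < ulim A -> exists X, A X /\ hard_core X.
Proof.
move=> mA A0; apply: contrapT => h.
suff : ulim A <= 0 by rewrite leNgt A0.
apply: ulim_le => // n; rewrite -lee_fin -prE// -[leRHS](P_hard_core n).
apply: le_measure; rewrite ?inE//; first exact: measurable_hard_coreC.
by move=> X AX hX; apply: h; exists X.
Qed.

(* The points around which an ultrafilter of configurations accumulates. When the
   ultrafilter contains [hard_core] these form its vague limit, so [closed_event]
   below is vague closedness within [hard_core]; testing it on ultrafilters
   dispenses with the compactness of the space of configurations. *)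
Definition limit_points (G : set_system conf) : set E :=
  [set x | forall V, bounded_open V -> V x -> G (~` void V)].

Definition closed_event (C : set conf) := forall G : set_system conf,
  UltraFilter G -> G (@hard_core R d) -> G C ->
  forall X : conf, (X : set E) = limit_points G -> C X.

Lemma closed_event0 : closed_event set0.
Proof. by move=> G UG _ /filter_not_empty. Qed.

Lemma closed_eventI A B : closed_event A -> closed_event B -> closed_event (A `&` B).
Proof.
move=> cA cB G UG hG GAB X XE; split.
- by apply: (cA G) => //; apply: filterS GAB => x [].
- by apply: (cB G) => //; apply: filterS GAB => x [].
Qed.

Lemma closed_eventU A B : closed_event A -> closed_event B -> closed_event (A `|` B).
Proof.
move=> cA cB G UG hG GAB X XE.
have [GA|GnA] := in_ultra_setVsetC A UG; first by left; exact: (cA G).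
right; apply: (cB G) => //; apply: filterS (filterI GAB GnA) => x [[]//].
Qed.

Lemma closed_event_void V : bounded_open V -> closed_event (void V).
Proof.
move=> bV G UG hG GV X XE; rewrite /void/= -subset0 => x [+ Vx].
rewrite XE => /(_ V bV Vx) /(filterI GV).
by rewrite setICr => /filter_not_empty.
Qed.

(** If no point of [K] is a limit point, every [x] in [K] has a neighbourhood whose void event
    belongs to [G]; finitely many of these cover [K], so [void K] belongs to [G]. *)
Lemma closed_event_hit K : compact K -> closed_event (~` void K).
Proof.
move=> cK G UG hG GK X XE XK.
have hx x : K x -> exists V, [/\ bounded_open V, V x & G (void V)].
  move=> Kx; apply: contrapT => h.
  have : ((X : set E) `&` K) x.
    split => //; rewrite XE => V bV Vx.
    have [GV|//] := in_ultra_setVsetC (void V) UG.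
    by exfalso; apply: h; exists V.
  by rewrite [X in X x]XK.
have /choice[V hV] : forall x, exists V, K x -> [/\ bounded_open V, V x & G (void V)].
  move=> x; have [Kx|nK] := pselect (K x); last by exists set0.
  by have [V hV] := hx _ Kx; exists V.
move: cK; rewrite compact_cover => /(_ E K V) [].
- by move=> x Kx; have [[]] := hV _ Kx.
- by move=> x Kx; exists x => //; have [] := hV _ Kx.
move=> D DK cov.
have GD : G (\bigcap_(x in [set` D]) void (V x)).
  apply: filter_bigI => x xD; have Kx : K x by exact/set_mem/DK.
  by have [] := hV _ Kx.
suff : \bigcap_(x in [set` D]) void (V x) `<=` void K.
  by move=> /filterS/(_ GD)/(filterI GK); rewrite setICl => /filter_not_empty.
move=> Y hY; rewrite /void/= -subset0 => y [Yy /cov[x xD Vy]].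
have : ((Y : set E) `&` V x) y by [].
by have -> : (Y : set E) `&` V x = set0 := hY x xD.
Qed.

(** Around two limit points closer than [2r] there are balls so small that a configuration hitting
    both violates the hard core; yet [G] contains both hits together with [hard_core]. *)
Lemma limit_points_separated G : UltraFilter G -> G (@hard_core R d) ->
  separated (limit_points G).
Proof.
move=> UG hG x y Gx Gy xy; rewrite leNgt; apply/negP => lt.
pose r := (@unit_volume_radius R d)%:num.
have xy0 : 0 < `|x - y| by rewrite normr_gt0 subr_eq0; exact/eqP.
pose e := Num.min (`|x - y| / 2) ((2 * r - `|x - y|) / 2).
have e0 : 0 < e by rewrite lt_min !divr_gt0// subr_gt0.
have bo (v : E) : bounded_open (ball v e).
  by split; [exact: bounded_ball|exact: ball_open].
have : G (@hard_core R d `&` (~` void (ball x e) `&` ~` void (ball y e))).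
  apply: filterI => //; apply: filterI.
  - exact: (Gx _ (bo x) (ballxx _ e0)).
  - exact: (Gy _ (bo y) (ballxx _ e0)).
move=> /filter_ex[X [sX [/eqP/set0P[x' [Xx' xx']] /eqP/set0P[y' [Xy' yy']]]]].
move: xx' yy'; rewrite !eballE/= => h1 h2.
have {}h1 : `|x - x'| < `|x - y| / 2 /\ `|x - x'| < (2 * r - `|x - y|) / 2.
  by apply/andP; rewrite -lt_min.
have {}h2 : `|y - y'| < `|x - y| / 2 /\ `|y - y'| < (2 * r - `|x - y|) / 2.
  by apply/andP; rewrite -lt_min.
have : 2 * r <= `|x' - y'|.
  apply: sX => // x'y'; have := ler_distD x' x y; rewrite [X in _ <= _ + X]distrC.
  by rewrite x'y' in h1 *; move: h1 h2 => [h1 _] [h2 _]; lra.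
have := ler_distD x x' y'; rewrite (distrC x' x).
have := ler_distD y x y'.
by move: h1 h2 => [_ h1] [_ h2]; lra.
Qed.

Definition inner_regular (A : set conf) := forall e : R, 0 < e -> exists C,
  [/\ measurable C, C `<=` A, closed_event C & ulim (A `\` C) <= e].

(** Regularity of the complement is included to make the class stable under complements; a union
    then needs the regularity of an intersection of complements. *)
Definition regular_events : set (set conf) :=
  [set A | [/\ measurable A, inner_regular A & inner_regular (~` A)]].

Let ulim_subU A B D : measurable A -> measurable B -> measurable D ->
  D `<=` A `|` B -> ulim D <= ulim A + ulim B.
Proof.
move=> mA mB mD DAB; apply: (@le_trans _ _ (ulim (A `|` (B `\` A)))).
  apply: le_ulim => //.
    by apply: measurableU => //; exact: measurableD.
  by move=> x /DAB h; have [Ax|nA] := pselect (A x); [left|right; case: h].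
rewrite ulimU//; [|exact: measurableD|by rewrite setDIK].
by rewrite lerD2l; apply: le_ulim => //; exact: measurableD.
Qed.

Let inner_regularU A B : measurable A -> measurable B ->
  inner_regular A -> inner_regular B -> inner_regular (A `|` B).
Proof.
move=> mA mB iA iB e e0; have e20 : 0 < e / 2 by rewrite divr_gt0.
have [C [mC CA cC hC]] := iA _ e20; have [D [mD DB cD hD]] := iB _ e20.
exists (C `|` D); split.
- exact: measurableU.
- exact: setUSS.
- exact: closed_eventU.
- rewrite [e]splitr; apply: le_trans (lerD hC hD); apply: ulim_subU.
  + exact: measurableD.
  + exact: measurableD.
  + by apply: measurableD; exact: measurableU.
  + by move=> x [[Ax|Bx] n]; [left|right]; split => // ?; apply: n; [left|right].
Qed.

Let inner_regularI A B : measurable A -> measurable B ->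
  inner_regular A -> inner_regular B -> inner_regular (A `&` B).
Proof.
move=> mA mB iA iB e e0; have e20 : 0 < e / 2 by rewrite divr_gt0.
have [C [mC CA cC hC]] := iA _ e20; have [D [mD DB cD hD]] := iB _ e20.
exists (C `&` D); split.
- exact: measurableI.
- exact: setISS.
- exact: closed_eventI.
- rewrite [e]splitr; apply: le_trans (lerD hC hD); apply: ulim_subU.
  + exact: measurableD.
  + exact: measurableD.
  + by apply: measurableD; exact: measurableI.
  + move=> x [[Ax Bx] n]; have [Cx|nC] := pselect (C x); last by left.
    by right; split => // Dx; apply: n.
Qed.

(* Every event generated by finitely many void events is regular, and [ulim] is
   continuous at [set0] on regular events by compactness: this makes it extend to
   a probability. *)
Lemma regular_events0 : regular_events set0.
Proof.
split => //.
- move=> e e0; exists set0; split => //; first exact: closed_event0.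
  rewrite setD0; apply: ulim_le => // n.
  by rewrite /pr measure0 ltW.
- move=> e e0; exists setT; split => //.
  + by rewrite setC0.
  + rewrite setDT; apply: ulim_le => // n.
    by rewrite /pr measure0 ltW.
Qed.

Lemma regular_eventsU : setU_closed regular_events.
Proof.
move=> A B [mA iA iA'] [mB iB iB']; split.
- exact: measurableU.
- exact: inner_regularU.
- by rewrite setCU; apply: inner_regularI => //; exact: measurableC.
Qed.

Lemma regular_eventsC : setC_closed regular_events.
Proof. by move=> A [mA iA iA']; split; rewrite ?setCK//; exact: measurableC. Qed.

(** [void V] is itself a closed event. Its complement is approximated by hitting a compact [K]
    inside [V]: what is lost hits [V] minus [K], with probability at most [lam] times the volume. *)
Lemma regular_events_void V : bounded_open V -> regular_events (void V).
Proof.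
move=> bV; have mV := measurable_void_open bV; split => //.
  move=> e e0; exists (void V); split => //; first exact: closed_event_void.
  rewrite setDv; apply: ulim_le => // n; by rewrite /pr measure0 ltW.
move=> e e0.
(* Dividing by [lam + 1] keeps [lam] times the volume below [e] also when [lam = 0]. *)
have e'0 : 0 < e / (lam + 1) by rewrite divr_gt0// ltr_wpDl.
have [K [KV cK VK]] := compact_inner_approx bV e'0.
have bK : bounded_set K by case: bV => bV _; exact: bounded_setS bV.
have clK : closed K by apply: compact_closed => //; exact: norm_hausdorff.
have mK := closed_euclidean_measurable clK.
have mvK := measurable_void bK mK.
have mVK : measurable (V `\` K).
  by apply: measurableD => //; case: bV => _; exact: open_euclidean_measurable.
have bVK : bounded_set (V `\` K) by case: bV => bV _; apply: bounded_setS bV => x [].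
have mD : measurable (~` void V `\` ~` void K).
  by apply: measurableD; apply: measurableC.
have mH : measurable (~` void (V `\` K)).
  by apply: measurableC; exact: measurable_void.
exists (~` void K); split.
- exact: measurableC.
- move=> X XK XV; apply: XK; rewrite /void/= -subset0 => x [Xx /KV Vx].
  have : ((X : set E) `&` V) x by [].
  by have -> : (X : set E) `&` V = set0 := XV.
- exact: closed_event_hit.
- apply: ulim_le => [//|n].
  apply: (@le_trans _ _ (pr n (~` void (V `\` K)))).
    apply: le_pr => //.
    move=> X [XV /contrapT XK] h; apply: XV; rewrite /void/= -subset0 => x [Xx Vx].
    have [Kx|nK] := pselect (K x).
      have : ((X : set E) `&` K) x by [].
      by have -> : (X : set E) `&` K = set0 := XK.
    have : ((X : set E) `&` (V `\` K)) x by [].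
    by have -> : (X : set E) `&` (V `\` K) = set0 := h.
  have -> : pr n (~` void (V `\` K)) = 1 - pr n (void (V `\` K)).
    apply: EFin_inj; rewrite EFinB -!prE; last 2 first.
    - exact: measurable_void.
    - exact: mH.
    by apply: probability_setC; exact: measurable_void.
  have := P_void_ge n bVK mVK; rewrite -/(pr _ _) => h.
  apply: (@le_trans _ _ (lam * fine (leb (V `\` K)))); first by lra.
  have : fine (leb (V `\` K)) <= e / (lam + 1).
    by rewrite -lee_fin fineK// ge0_fin_numE//; exact: bounded_lebesgue_lty.
  rewrite ler_pdivlMr ?ltr_wpDl// => h2; apply: le_trans h2.
  by rewrite mulrC ler_wpM2l ?fine_ge0// lerDl.
Qed.

(** If the limits stay above [e], closed events inside the [D n] have finite intersections of
    positive limit, which contain hard-core configurations. The limit points of an ultrafilter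
    containing all of these form a configuration lying in every [D n]. *)
Lemma ulim_continuous (D : (set conf)^nat) : (forall n, regular_events (D n)) ->
  (forall n, D n.+1 `<=` D n) -> \bigcap_n D n = set0 ->
  forall e : R, 0 < e -> exists n, ulim (D n) < e.
Proof.
move=> rD dD D0 e e0; apply: contrapT => h.
have ge n : e <= ulim (D n) by rewrite leNgt; apply/negP => lt; apply: h; exists n.
have mD n : measurable (D n) by case: (rD n).
(* The losses up to step [n] sum to [e / 2 - e / 2^(n+2)], so more than [e / 2] survives. *)
have en n : 0 < e / 2 ^+ n.+2 by rewrite divr_gt0// exprn_gt0.
have /choice[C hC] : forall n, exists C,
    [/\ measurable C, C `<=` D n, closed_event C & ulim (D n `\` C) <= e / 2 ^+ n.+2].
  by move=> n; case: (rD n) => _ + _; apply.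
have mC n : measurable (C n) by case: (hC n).
pose F n := \big[setI/setT]_(i < n.+1) C i.
have mF n : measurable (F n) by apply: bigsetI_measurable.
have FS n : F n.+1 = F n `&` C n.+1 by rewrite /F big_ord_recr.
have FE n : ulim (D n `\` F n) <= e / 2 - e / 2 ^+ n.+2.
  elim: n => [|n IH].
    rewrite /F big_ord_recr big_ord0/= setTI; case: (hC 0%N) => _ _ _ h0.
    by apply: (le_trans h0); rewrite expr2; lra.
  apply: (@le_trans _ _ (ulim (D n `\` F n) + ulim (D n.+1 `\` C n.+1))).
    apply: ulim_subU; try by apply: measurableD.
    move=> x [Dx nF]; have [Cx|nC] := pselect (C n.+1 x); last by right.
    left; split; first exact: dD.
    by move=> Fx; apply: nF; rewrite FS.
  case: (hC n.+1) => _ _ _ h1; apply: (le_trans (lerD IH h1)).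
  have q : 0 < (2 ^+ n.+2 : R) by rewrite exprn_gt0.
  have -> : e / 2 ^+ n.+3 = e / 2 ^+ n.+2 / 2 by rewrite [in LHS]exprSr invfM mulrA.
  lra.
have Fpos n : 0 < ulim (F n).
  have : ulim (D n) <= ulim (F n) + ulim (D n `\` F n).
    apply: ulim_subU => //; first exact: measurableD.
    by move=> x Dx; have [Fx|nF] := pselect (F n x); [left|right].
  have := ge n; have := FE n; have := en n; lra.
pose G0 n := F n `&` @hard_core R d.
have G0x n : G0 n !=set0.
  by have [X [FX hX]] := ulim_gt0_hard_core (mF n) (Fpos n); exists X.
have G0d m n : (m <= n)%N -> G0 n `<=` G0 m.
  move=> mn; apply: setSI; elim: n mn => [|n IH]; first by rewrite leqn0 => /eqP ->.
  rewrite leq_eqVlt => /predU1P[->//|]; rewrite ltnS => /IH h2.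
  by rewrite FS => x [/h2].
have PG : ProperFilter (filter_from setT G0).
  apply: filter_from_proper => //; apply: filter_from_filter; first by exists 0%N.
  move=> i j _ _; exists (maxn i j) => // X GX; split.
  - by apply: G0d GX; exact: leq_maxl.
  - by apply: G0d GX; exact: leq_maxr.
have [G [UG sG]] := ultraFilterLemma PG.
have hG : G (@hard_core R d) by apply: sG; exists 0%N => // X [].
have GC n : G (C n).
  by apply: sG; exists n => // X [+ _]; rewrite /F big_ord_recr => -[].
pose X : conf := Configuration (separated_locally_finite (limit_points_separated UG hG)).
suff : (\bigcap_n D n) X by rewrite D0.
move=> n _; case: (hC n) => _ CD cl _; apply: CD.
exact: (cl G).
Qed.

End ultralimit.

Lemma exists_void_limit_probability :
  exists Q : probability conf R, forall V, bounded_open V -> Q (void V) = (p V)%:E.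
Proof.
have [U [UU U_oo]] := ultraFilterLemma (@eventually_filter).
have ge0 A : regular_events U A -> 0 <= ulim U A.
  by move=> [mA _ _]; exact: ulim_ge0.
have add A B : regular_events U A -> regular_events U B -> A `&` B = set0 ->
    ulim U (A `|` B) = ulim U A + ulim U B.
  by move=> [mA _ _] [mB _ _]; exact: ulimU.
have [Q [Q0 Qge0 Qsig QE]] := algebra_extension (@regular_events0 U UU)
  (@regular_eventsU U UU) (@regular_eventsC U) ge0 add (@ulim_continuous U UU).
have mreg : @measurable _ conf `<=` <<s regular_events U >>.
  rewrite measurable_configuration_void; apply: sub_smallest2r.
    exact: smallest_sigma_algebra.
  by move=> _ [V bV ->]; exact: regular_events_void.
have Qsa : semi_sigma_additive Q.
  by move=> F mF tF _; apply: Qsig => // n; apply: mreg; exact: mF.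
have [QM QME] : exists QM : {measure set conf -> \bar R}, forall A, QM A = Q A.
  pose mQ := isMeasure.Build _ conf R Q Q0 Qge0 Qsa.
  by exists (HB.pack_for {measure set conf -> \bar R} Q mQ).
have QT : QM setT = 1%E.
  rewrite QME -setC0 QE ?setC0 ?ulimT//.
  by rewrite -setC0; apply: regular_eventsC; exact: regular_events0.
(* [QM] has total mass 1, so normalising leaves it unchanged and only supplies the structure of a
   probability. *)
exists (mnormalize QM \d_(empty_configuration)) => V bV.
rewrite /= /mnormalize/= QT gt_eqF//= invr1 mule1.
rewrite QME QE; last exact: regular_events_void.
case: (bV) => bdV oV; rewrite ulim_void//; exact: open_euclidean_measurable.
Qed.

End weak_limit_existence.

(** * Weak convergence from void probabilities *)

Section vague_topology.
Context {R : realType} {d : nat}.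
Local Notation E := (euclidean R d).
Local Notation conf := (configuration R d).
Local Notation test := (@test_function R d).

Lemma configuration_cvg (F : set_system conf) (X : conf) : Filter F ->
  (forall f : test, vague_coordinates Y f @[Y --> F] --> vague_coordinates X f) ->
  F --> X.
Proof.
move=> FF h U [B [[W oW <-]]] /= WX /filterS; apply.
have : vague_coordinates @ F --> vague_coordinates X.
  apply/cvg_sup => f V [C [[D oD <-]]] /= DX /filterS; apply.
  by apply: (h f); exact: open_nbhs_nbhs.
by apply; exact: open_nbhs_nbhs.
Qed.

Lemma vague_coordinate_continuous (f : test) :
  continuous (fun X : conf => vague_coordinates X f).
Proof.
move=> X; apply: (@continuous_comp _ _ _ (@vague_coordinates R d) (fun g => g f)).
  exact: initial_continuous.
move: (vague_coordinates X) => g.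
have /cvg_sup/(_ f) h : nbhs g --> g by exact: cvg_id.
apply: cvg_trans (@initial_continuous _ _ (fun g => g f) g).
exact: cvg_app h.
Qed.

Lemma vague_coordinateE (f : test) (X : conf) n (g : nat -> E) :
  (forall i, (i < n)%N -> (X : set E) (g i)) ->
  (forall i j, (i < n)%N -> (j < n)%N -> g i = g j -> i = j) ->
  (forall x, (X : set E) x -> sval f x != 0 -> exists2 i, (i < n)%N & g i = x) ->
  vague_coordinates X f = \sum_(i < n) sval f (g i).
Proof.
move=> gX ginj gsur; rewrite /vague_coordinates.
rewrite -(fsbig_widen (g @` `I_n) (X : set E)).
- rewrite (fsbig_ord _ _ (fun i => sval f (g i))).
  apply: reindex_fsbig; split; first by move=> i ?; exists i.
    by move=> i j /set_mem/= hi /set_mem/= hj; exact: ginj.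
  by move=> _ [i hi <-]; exists i.
- by move=> _ [i hi <-]; exact: gX.
- move=> x [Xx nx] /=; apply/eqP; apply: contrapT => /negP fx; apply: nx.
  by have [i hi <-] := gsur _ Xx fx; exists i.
Qed.

End vague_topology.

(** * Countably many patterns describing vaguely open sets *)

Section configuration_patterns.
Context {R : realType} {d : nat}.
Local Notation E := (euclidean R d).
Local Notation conf := (configuration R d).
Local Notation r := ((@unit_volume_radius R d)%:num : R).

(* [X] looks like [X0] in the ball of radius [k], up to displacements of size
   [1 / (k + 1)] given by [phi]. *)
Definition near_conf (X0 : conf) (k : nat) (X : conf) := exists phi : E -> E,
  [/\ forall y, (X0 : set E) y -> ball (0 : E) k%:R y ->
        (X : set E) (phi y) /\ `|phi y - y| < k.+1%:R^-1,
      forall y z, (X0 : set E) y -> ball (0 : E) k%:R y ->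
        (X0 : set E) z -> ball (0 : E) k%:R z -> phi y = phi z -> y = z &
      forall x, (X : set E) x -> ball (0 : E) k%:R x ->
        exists y, [/\ (X0 : set E) y, ball (0 : E) k%:R y & phi y = x]].

Lemma ball0_le (a b : R) : a <= b -> ball (0 : E) a `<=` ball (0 : E) b.
Proof. by move=> ab x; rewrite !eballE/= => /lt_le_trans; apply. Qed.

(** A test function sees finitely many points of [X0], each displaced by less than [1 / (k + 1)], so
    continuity at these points suffices. *)
Lemma near_conf_cvg (X0 : conf) (X_ : nat -> conf) :
  (forall k, near_conf X0 k (X_ k)) -> X_ k @[k --> \oo] --> X0.
Proof.
move=> nX; apply: configuration_cvg => -[f [fc [K cK fK]]].
have [M0 M00 KM] := bounded_sub_ball (compact_bounded cK).
(* The margin 1 catches points of [X0] outside the ball of radius [M0] whose displaced images fall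
   inside, as displacements are less than 1. *)
pose S := (X0 : set E) `&` ball (0 : E) (M0 + 1).
have finS : finite_set S by apply: points_finite; exact: bounded_ball.
pose s : seq E := enum_fset (fset_set S).
have sS x : x \in s <-> S x.
  by split=> [|Sx]; rewrite -[x \in s]/(x \in fset_set S) in_fset_set ?inE.
pose n := size s; pose y i := nth 0 s i.
have yS i : (i < n)%N -> S (y i) by move=> hi; apply/sS; exact: mem_nth.
have yinj i j : (i < n)%N -> (j < n)%N -> y i = y j -> i = j.
  by move=> hi hj /eqP; rewrite nth_uniq ?fset_uniq// => /eqP.
have fM0 x : f x != 0 -> ball (0 : E) M0 x.
  by move=> fx; apply: KM; apply: contrapT => /fK fx0; move: fx; rewrite fx0 eqxx.
have ysur x : S x -> exists2 i, (i < n)%N & y i = x.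
  move=> /sS xs; exists (index x s); first by rewrite index_mem.
  by rewrite /y nth_index.
set ff : test_function := exist _ f _.
have X0E : vague_coordinates X0 ff = \sum_(i < n) f (y i).
  apply: vague_coordinateE => [i /yS[]//|//|x Xx /fM0 xM].
  by apply: ysur; split => //; apply: ball0_le xM; rewrite lerDl.
apply/cvgrPdist_lt => e e0; rewrite X0E.
have e'0 : 0 < e / n.+1%:R by rewrite divr_gt0.
have unif : \forall k \near \oo, forall i : 'I_n, forall z : E,
    `|z - y i| < k.+1%:R^-1 -> `|f (y i) - f z| < e / n.+1%:R.
  apply: filter_forall => i.
  have /cvgrPdist_lt/(_ _ e'0)/nbhs_ballP[a /= a0 ha] := fc (y i).
  near=> k => z zy; apply: ha; rewrite eballE/= distrC; apply: (lt_trans zy).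
  by near: k; exact: near_infty_natSinv_lt (PosNum a0).
change (\forall k \near \oo,
  `|\sum_(i < n) f (y i) - vague_coordinates (X_ k) ff| < e).
near=> k.
have uk : forall i : 'I_n, forall z : E,
    `|z - y i| < k.+1%:R^-1 -> `|f (y i) - f z| < e / n.+1%:R by near: k.
have kM : M0 + 1 <= k%:R by near: k; exact: nbhs_infty_ger.
have [phi [ph1 ph2 ph3]] := nX k.
have yk i : (i < n)%N -> (X0 : set E) (y i) /\ ball (0 : E) k%:R (y i).
  by move=> /yS[? yM]; split => //; apply: ball0_le yM.
have -> : vague_coordinates (X_ k) ff = \sum_(i < n) f (phi (y i)).
  apply: (@vague_coordinateE _ _ ff _ n (phi \o y)) => /=.
  - by move=> i /yk[h1 h2]; case: (ph1 _ h1 h2).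
  - move=> i j hi hj /ph2; have [a1 a2] := yk _ hi; have [b1 b2] := yk _ hj.
    by move=> /(_ a1 a2 b1 b2); exact: yinj.
  - move=> x Xx /fM0 xM.
    have xk : ball (0 : E) k%:R x.
      by apply: ball0_le xM; apply: le_trans kM; rewrite lerDl.
    have [z [X0z zk zx]] := ph3 _ Xx xk.
    have [_ zd] := ph1 _ X0z zk.
    have [i hi yi] : exists2 i, (i < n)%N & y i = z.
      apply: ysur; split => //; move: xM; rewrite !eballE/= !sub0r !normrN => xM.
      rewrite -(subrK x z) (le_lt_trans (ler_normD _ _))// addrC ltrD//.
      rewrite -zx distrC (lt_le_trans zd)// invf_le1// ler1n//.
    by exists i => //; rewrite yi.
rewrite -sumrB; apply: (le_lt_trans (ler_norm_sum _ _ _)).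
apply: (@le_lt_trans _ _ (\sum_(i < n) e / n.+1%:R)).
  apply: ler_sum => i _; apply/ltW/uk.
  by have [h1 h2] := yk _ (ltn_ord i); case: (ph1 _ h1 h2).
exact: sum_fraction_lt.
Unshelve. all: end_near. Qed.

(** Counterexamples for all [k] would form a sequence converging to [X0] by [near_conf_cvg] while
    staying outside [O]. *)
Lemma open_near_conf (O : set conf) (X0 : conf) : open O -> O X0 ->
  exists k, forall X, near_conf X0 k X -> O X.
Proof.
move=> oO OX0; apply: contrapT => h.
have /choice[X_ hX] : forall k, exists X, near_conf X0 k X /\ ~ O X.
  move=> k; apply: contrapT => h2; apply: h; exists k => X nX.
  by apply: contrapT => nO; apply: h2; exists X.
have /near_conf_cvg : forall k, near_conf X0 k (X_ k) by move=> k; case: (hX k).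
move=> /(_ O (open_nbhs_nbhs (conj oO OX0)))[k _ /(_ k (leqnn k))].
by case: (hX k).
Qed.

(** Cell centres, the index [m] of the cell radius [1 / (m + 1)], and the radius of the window.
    Rational centres make the type countable. *)
Definition pattern : Type := (seq (d.-tuple rat) * nat * nat)%type.

Definition cell (m : nat) (q : d.-tuple rat) : set E :=
  ball (rational_point q) m.+1%:R^-1.

Definition half_cell (m : nat) (q : d.-tuple rat) : set E :=
  closed_ball (rational_point q : E) (m.+1%:R^-1 / 2).

Lemma half_cellE m q : half_cell m q = [set y : E |
  `|rational_point q - y| <= m.+1%:R^-1 / 2].
Proof. by rewrite /half_cell closed_ballE// divr_gt0. Qed.

(** Removing closed half cells makes this set open, while a point of the window avoiding it still
    lies inside an open cell. *)
Definition outside (t : pattern) : set E :=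
  ball (0 : E) t.2%:R `&` ~` \bigcup_(q in [set` t.1.1]) half_cell t.1.2 q.

Definition count_pattern (t : pattern) : set conf :=
  void (outside t) `&` \bigcap_(q in [set` t.1.1])
    [set X | count X (cell t.1.2 q) = 1%N].

(* On [hard_core], a cell of radius less than [r] that is hit contains exactly one
   point, so a pattern is a Boolean combination of void events. *)
Definition hit_pattern (t : pattern) : set conf :=
  void (outside t) `&` \bigcap_(q in [set` t.1.1]) ~` void (cell t.1.2 q).

Lemma cell_bounded_open m q : bounded_open (cell m q).
Proof. by split; [exact: bounded_ball|exact: ball_open]. Qed.

Lemma outside_bounded_open t : bounded_open (outside t).
Proof.
split; first by apply: bounded_setS (@bounded_ball _ _ (0 : E) t.2%:R); exact: subIsetl.
apply: openI; first exact: ball_open.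
apply: closed_openC; apply: closed_bigcup; first exact: finite_seq.
by move=> q _; exact: closed_ball_closed.
Qed.

Lemma count1P (X : conf) (B : set E) : bounded_set B ->
  count X B = 1%N <-> exists x, (X : set E) `&` B = [set x].
Proof.
move=> bB; have fin := points_finite X bB; rewrite /count; split.
  move=> /eqP/cardfs1P[x xE]; exists x.
  by rewrite -(fset_setK fin) xE predeqE => y /=; split=> [|->]; rewrite inE// => /eqP.
by move=> [x ->]; rewrite fset_set1 cardfs1.
Qed.

Lemma measurable_count_pattern t : measurable (count_pattern t).
Proof.
apply: measurableI; first by apply: measurable_void_open; exact: outside_bounded_open.
apply: fin_bigcap_measurable; first exact: finite_seq.
move=> q _; have [bc oc] := cell_bounded_open t.1.2 q.
apply: sub_sigma_algebra; exists (cell t.1.2 q), 1%N; split => //.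
  exact: open_euclidean_measurable.
rewrite predeqE => X; split; last exact: card_fset_set.
have /finite_setP[m Xm] := points_finite X bc.
by rewrite /= /count (card_fset_set Xm) => m1; move: Xm; rewrite m1.
Qed.

Lemma measurable_hit_pattern t : measurable (hit_pattern t).
Proof.
apply: measurableI; first by apply: measurable_void_open; exact: outside_bounded_open.
apply: fin_bigcap_measurable; first exact: finite_seq.
by move=> q _; apply: measurableC; apply: measurable_void_open; exact: cell_bounded_open.
Qed.

Lemma hit_count_pattern t : t.1.2.+1%:R^-1 < r ->
  hit_pattern t `&` @hard_core R d `<=` count_pattern t.
Proof.
move=> tr X [[Xo Xh] hX]; split => // q qs /=.
apply/count1P; first by case: (cell_bounded_open t.1.2 q).
have /eqP/set0P[x [Xx xq]] := Xh q qs; exists x.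
rewrite predeqE => y; split=> [[Xy yq]|->//].
apply: contrapT => /(hX _ _ Xy Xx); apply/negP; rewrite -ltNge.
move: xq yq; rewrite /cell !eballE/= => xq yq.
rewrite -(subrK (rational_point q) y) -addrA (le_lt_trans (ler_normD _ _))//.
rewrite mulrDl mul1r ltrD//; first by rewrite distrC (lt_trans yq).
exact: lt_trans xq tr.
Qed.

Lemma pattern_exists (X0 : conf) (k : nat) : exists t : pattern,
  [/\ count_pattern t X0, t.1.2.+1%:R^-1 < r &
      forall X, count_pattern t X -> near_conf X0 k X].
Proof.
(* The window is enlarged by 1 because a cell near its boundary reaches beyond it. *)
pose S := (X0 : set E) `&` ball (0 : E) (k%:R + 1).
have finS : finite_set S by apply: points_finite; exact: bounded_ball.
(* A point of a cell is within 3/2 cell radii of the point of [X0] the cell stands for, so two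
   points of [X0] matched with the same point are within 3 radii, less than the 4 required here. *)
have sep : \forall m \near \oo, forall y z, S y -> S z ->
    `|y - z| < 4 * m.+1%:R^-1 -> y = z.
  suff : \forall m \near \oo, (\bigcap_(y in [set` fset_set S])
      [set m | forall z, S z -> `|y - z| < 4 * m.+1%:R^-1 -> z = y]) m.
    apply: filterS => m h y z Sy Sz yz; apply/esym; apply: (h y) => //=.
    by rewrite in_fset_set// inE.
  apply: filter_bigI => y _.
  have [e e0 iso] := finite_isolated y finS.
  have e40 : 0 < e / 4 by rewrite divr_gt0.
  near=> m => z Sz yz; apply: iso => //; rewrite eballE/=; apply: (lt_trans yz).
  rewrite mulrC -ltr_pdivlMr//.
  by near: m; exact: near_infty_natSinv_lt (PosNum e40).
have k0 : (0 : R) < k.+1%:R^-1 / 2 by rewrite divr_gt0.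
have r0 : 0 < r by [].
have [m [[/= sm mr] mk]] := filter_ex (filterI (filterI sep
  (near_infty_natSinv_lt (PosNum r0))) (near_infty_natSinv_lt (PosNum k0))).
rewrite /= in mr mk.
set w : R := m.+1%:R^-1 in sm mr mk.
have w0 : 0 < w by rewrite invr_gt0.
have w20 : 0 < w / 2 by rewrite divr_gt0.
have k1 : k.+1%:R^-1 <= 1 :> R by rewrite invf_le1// ler1n.
have [v vE] : {v : R | v = k.+1%:R^-1} by exists k.+1%:R^-1.
rewrite -vE in k0 mk k1.
have /choice[qf hq] : forall y : E, exists q, `|y - rational_point q| < w / 2.
  by move=> y; exact: rational_point_dense.
pose T := (X0 : set E) `&` ball (0 : E) k%:R.
have finT : finite_set T by apply: points_finite; exact: bounded_ball.
have TS : T `<=` S by move=> y [Xy yk]; split => //; apply: ball0_le yk; rewrite lerDl.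
pose s : seq (d.-tuple rat) := [seq qf y | y <- enum_fset (fset_set T)].
have sP q : q \in s <-> exists2 y, T y & q = qf y.
  split=> [/mapP[y ys ->]|[y Ty ->]].
    by exists y => //; move: ys; rewrite -[y \in _]/(y \in fset_set T) in_fset_set ?inE.
  by apply/mapP; exists y => //; rewrite -[y \in _]/(y \in fset_set T) in_fset_set ?inE.
have cellP y x : cell m (qf y) x -> `|x - y| < 3 / 2 * w.
  rewrite /cell eballE/= -/w => qx; have h := hq y.
  have := ler_distD (rational_point (qf y)) x y.
  by rewrite distrC in qx; rewrite distrC in h; lra.
have cell_self y : cell m (qf y) y.
  by rewrite /cell eballE/= distrC (lt_trans (hq y))// -/w; lra.
have Sball y z : T y -> (X0 : set E) z -> `|z - y| < 3 / 2 * w -> S z.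
  move=> [_]; rewrite eballE/= sub0r normrN => yk Xz zy; split => //.
  rewrite eballE/= sub0r normrN -(subrK y z) (le_lt_trans (ler_normD _ _))//.
  lra.
exists (s, m, k); split => //.
  split=> [|q /= /sP[y Ty ->]].
    rewrite /void/= -subset0 => y [Xy [/= yk]]; apply.
    exists (qf y) => /=; first by apply/sP; exists y.
    by rewrite half_cellE/= distrC ltW.
  apply/count1P; first by case: (cell_bounded_open m (qf y)).
  exists y; rewrite predeqE => z; split=> [[Xz /cellP zy]|->]; last first.
    by split; [case: Ty|exact: cell_self].
  apply: sm; [exact: Sball zy|exact: TS|lra].
move=> X [Xo Xc].
have one y : T y -> exists x, (X : set E) `&` cell m (qf y) = [set x].
  move=> Ty; apply/count1P; first by case: (cell_bounded_open m (qf y)).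
  by apply: Xc => /=; apply/sP; exists y.
have /choice[phi hphi] : forall y, exists x, T y -> (X : set E) `&` cell m (qf y) = [set x].
  move=> y; have [Ty|nT] := pselect (T y); last by exists 0.
  by have [x hx] := one _ Ty; exists x.
have phiX y : T y -> (X : set E) (phi y) /\ cell m (qf y) (phi y).
  by move=> Ty; have : [set phi y] (phi y) by []; rewrite -hphi.
exists phi; split.
- move=> y Xy yk; have [h1 /cellP h2] := phiX y (conj Xy yk); split => //.
  by rewrite -vE; lra.
- move=> y z Xy yk Xz zk yz; have [_ /cellP h2] := phiX y (conj Xy yk).
  have [_ /cellP h3] := phiX z (conj Xz zk).
  apply: sm; [exact: TS|exact: TS|].
  rewrite -yz in h3; have := ler_distD (phi y) y z; rewrite (distrC y (phi y)); lra.
- move=> x Xx xk.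
  have : (\bigcup_(q in [set` s]) half_cell m q) x.
    apply: contrapT => nx; have : ((X : set E) `&` outside (s, m, k)) x by [].
    by have -> : (X : set E) `&` outside (s, m, k) = set0 := Xo.
  move=> [_ /= /sP[y Ty ->]]; rewrite half_cellE/= => xq.
  exists y; case: (Ty) => Xy yk; split => //.
  have : ((X : set E) `&` cell m (qf y)) x.
    split => //; rewrite /cell eballE/=; apply: (@le_lt_trans _ _ (w / 2)).
      exact: xq.
    by rewrite -/w; lra.
  by rewrite hphi// => ->.
Unshelve. all: end_near. Qed.

(** The union is countable, hence measurable; the bound on the cell radius lets hits replace counts
    on [hard_core]. *)
Lemma open_pattern (O : set conf) : open O ->
  O = \bigcup_(t in [set t | count_pattern t `<=` O /\ t.1.2.+1%:R^-1 < r])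
    count_pattern t.
Proof.
move=> oO; rewrite predeqE => X; split=> [OX|[t [tO _] /tO]//].
have [k hk] := open_near_conf oO OX.
have [t [tX tr tk]] := pattern_exists X k.
by exists t => //; split => // Y /tk /hk.
Qed.

Lemma pattern_countable : countable [set: pattern].
Proof. exact: countableP. Qed.

Lemma open_configuration_measurable (O : set conf) : open O -> measurable O.
Proof.
move=> /open_pattern ->; rewrite bigcup_mkcond.
apply: countable_bigcupT_measurable; first exact: pattern_countable.
by move=> t; case: ifPn => // _; exact: measurable_count_pattern.
Qed.

Lemma continuous_configuration_measurable (F : conf -> R) :
  continuous F -> measurable_fun setT F.
Proof.
move=> cF; apply: (measurability _ (RGenOpens.measurableE R)) => //.
move=> _ [_ [a [b ->] <-]]; rewrite setTI; apply: open_configuration_measurable.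
by apply: open_comp; [move=> ? _; exact: cF|exact: interval_open].
Qed.

End configuration_patterns.

(** * Real-valued probabilities, expectations and staircase functions *)

Section real_probability.
Context {d} {T : measurableType d} {R : realType}.
Variable P : probability T R.

Lemma fine_probabilityE A : measurable A -> P A = (fine (P A))%:E.
Proof. by move=> mA; rewrite fineK// fin_num_measure. Qed.

Lemma le_fine_probability A B : measurable A -> measurable B -> A `<=` B ->
  fine (P A) <= fine (P B).
Proof.
by move=> mA mB AB; rewrite -lee_fin -!fine_probabilityE// le_measure ?inE.
Qed.

Lemma fine_probabilityD A B : measurable A -> measurable B -> B `<=` A ->
  fine (P (A `\` B)) = fine (P A) - fine (P B).
Proof.
move=> mA mB BA; have mAB : measurable (A `\` B) by exact: measurableD.
apply: EFin_inj; rewrite EFinB -!fine_probabilityE//.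
rewrite measureD//; last by rewrite (le_lt_trans (probability_le1 P mA))// ltry.
by rewrite setIidr.
Qed.

Lemma fine_probabilityU A B : measurable A -> measurable B ->
  fine (P (A `|` B)) = fine (P A) + fine (P B) - fine (P (A `&` B)).
Proof.
move=> mA mB; rewrite -(setDUK (@subsetUl _ A B)).
have mAI : measurable (A `&` B) by exact: measurableI.
have -> : (A `|` B) `\` A = B `\` (A `&` B).
  by rewrite predeqE => x; split=> [[[?|Bx] nA]|[Bx h]] //; split => //;
    [move=> []|right|move=> ?; apply: h].
have mD : measurable (B `\` (A `&` B)) by exact: measurableD.
rewrite -addrA -(fine_probabilityD mB mAI (@subIsetr _ A B)).
apply: EFin_inj; rewrite EFinD -!fine_probabilityE//; last exact: measurableU.
by rewrite measureU// predeqE => x; split => // -[? [? h]]; apply: h.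
Qed.

Lemma bounded_integrable_probability (F : T -> R) (M : R) : measurable_fun setT F ->
  (forall x, `|F x| <= M) -> P.-integrable setT (EFin \o F).
Proof.
move=> mF FM; apply: measurable_bounded_integrable => //.
  by rewrite (le_lt_trans (probability_le1 P _))// ltry.
by exists M; split; [exact: num_real|move=> N /ltW MN x _; exact: le_trans MN].
Qed.

Lemma expectation_indic A : measurable A -> \int[P]_x \1_A x = fine (P A).
Proof. by move=> mA; rewrite /Rintegral integral_indic// setIT. Qed.

Lemma expectation_cst (c : R) : \int[P]_x c = c.
Proof.
have PT : fine (P setT) = 1 by rewrite probability_setT.
by rewrite Rintegral_cst// PT mulr1.
Qed.

End real_probability.

Section staircase.
Context {R : realType}.

(** [h] times the number of levels among [h], ..., [K * h] strictly below [x]. For continuous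
    functions the strict inequality makes the level sets open. *)
Definition staircase K (h x : R) : R := \sum_(i < K) h * (i.+1%:R * h < x)%R%:R.

Lemma staircaseS K (h x : R) :
  staircase K.+1 h x = staircase K h x + h * (K.+1%:R * h < x)%R%:R.
Proof. by rewrite /staircase big_ord_recr. Qed.

Lemma staircase_full K (h x : R) : 0 <= h -> K%:R * h < x -> staircase K h x = K%:R * h.
Proof.
move=> h0 Kx; rewrite /staircase (eq_bigr (fun=> h)).
  by rewrite sumr_const card_ord mulr_natl.
move=> i _; rewrite (_ : i.+1%:R * h < x) ?mulr1//.
by apply: le_lt_trans Kx; rewrite ler_wpM2r// ler_nat.
Qed.

Lemma staircase_le K (h x : R) : 0 <= h -> 0 <= x -> staircase K h x <= x.
Proof.
move=> h0 x0; elim: K => [|K IH]; first by rewrite /staircase big_ord0.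
have [lt|ge] := ltP (K.+1%:R * h) x.
  by rewrite staircase_full// ltW.
by rewrite staircaseS ltNge ge mulr0 addr0.
Qed.

Lemma le_staircase K (h x : R) : 0 <= h -> x <= K%:R * h -> x <= h + staircase K h x.
Proof.
move=> h0; elim: K => [|K IH] xK.
  by rewrite /staircase big_ord0 addr0; apply: (le_trans xK); rewrite mul0r.
have [le|lt] := leP x (K%:R * h).
  rewrite staircaseS addrA; apply: (le_trans (IH le)).
  by rewrite lerDl mulr_ge0.
rewrite staircaseS ltNge xK mulr0 addr0 staircase_full//.
by apply: (le_trans xK); rewrite -[in leLHS]natr1 mulrDl mul1r addrC.
Qed.

End staircase.

Section weak_convergence.
Context {R : realType} {d : nat}.
Local Notation E := (euclidean R d).
Local Notation conf := (configuration R d).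
Variables (P : nat -> probability conf R) (Q : probability conf R).
Hypothesis P_hard_core : forall n, P n (~` @hard_core R d) = 0%E.
Hypothesis P_void : forall V, bounded_open V ->
  fine (P n (void V)) @[n --> \oo] --> fine (Q (void V)).

Let conv (A : set conf) :=
  measurable A /\ fine (P n A) @[n --> \oo] --> fine (Q A).

Let convD A B : conv A -> conv B -> B `<=` A -> conv (A `\` B).
Proof.
move=> [mA cA] [mB cB] BA; split; first exact: measurableD.
rewrite fine_probabilityD//.
under eq_fun do rewrite fine_probabilityD//.
exact: cvgB.
Qed.

Let convU A B : conv A -> conv B -> conv (A `&` B) -> conv (A `|` B).
Proof.
move=> [mA cA] [mB cB] [mAB cAB]; split; first exact: measurableU.
rewrite fine_probabilityU//.
under eq_fun do rewrite fine_probabilityU//.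
by apply: cvgB => //; exact: cvgD.
Qed.

Let hits (l : seq (set E)) : set conf := foldr (fun U A => ~` void U `&` A) setT l.
Let opens (l : seq (set E)) : Prop := foldr (fun U p => bounded_open U /\ p) True l.
Let event (a : set E * seq (set E)) := void a.1 `&` hits a.2.
Let good (a : set E * seq (set E)) := bounded_open a.1 /\ opens a.2.

Let hits_cat l l' : hits (l ++ l') = hits l `&` hits l'.
Proof. by elim: l => [|U l IH]/=; rewrite ?setTI// IH setIA. Qed.

Let opens_cat l l' : opens l -> opens l' -> opens (l ++ l').
Proof. by elim: l => [|U l IH]//= [bU ol] ol'; split => //; exact: IH. Qed.

(** A hit is a difference of void events: hitting [U] while avoiding [V] means avoiding [V] but not
    the union of [V] and [U]. *)
Let conv_event a : good a -> conv (event a).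
Proof.
case: a => V l [/= bV ol]; elim: l V bV ol => [|U l IH] V bV ol.
  by rewrite /event/= setIT; split; [exact: measurable_void_open|exact: P_void].
have [bU ol'] := ol.
have -> : event (V, U :: l) = event (V, l) `\` event (V `|` U, l).
  rewrite /event/= -voidU predeqE => X; split.
    by move=> [vV [vU hl]]; split => // -[[_ /vU]].
  by move=> [[vV hl] h]; split => //; split => // vU; apply: h.
apply: convD; [exact: IH|apply: IH => //; exact: bounded_openU|].
by rewrite /event/= -voidU => X [[? _] ?].
Qed.

Let union (l : seq (set E * seq (set E))) := foldr (fun a A => event a `|` A) set0 l.
Let goods (l : seq (set E * seq (set E))) : Prop := foldr (fun a p => good a /\ p) True l.

Let meet (a b : set E * seq (set E)) := (a.1 `|` b.1, a.2 ++ b.2).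

Let event_meet a b : event (meet a b) = event a `&` event b.
Proof. by rewrite /event/= -voidU hits_cat setIACA. Qed.

Let union_meet a l : event a `&` union l = union (map (meet a) l).
Proof. by elim: l => [|b l IH]/=; rewrite ?setI0// setIUr IH event_meet. Qed.

Let goods_meet a l : good a -> goods l -> goods (map (meet a) l).
Proof.
move=> [ba oa]; elim: l => [|b l IH]//= [[bb ob] gl]; split; last exact: IH.
by split; [exact: bounded_openU|exact: opens_cat].
Qed.

(** Inclusion-exclusion: the first event meets the others in a union over a list as long as the
    tail, so the induction is on the length. *)
Let conv_union l : goods l -> conv (union l).
Proof.
have [n] := ubnP (size l); elim: n l => // n IH [|a l] /=.
  by move=> _ _; split => //; under eq_fun do rewrite measure0; rewrite measure0; exact: cvg_cst.
rewrite ltnS => ln [ga gl]; apply: convU; first exact: conv_event.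
  exact: IH.
by rewrite union_meet; apply: IH; [rewrite size_map|exact: goods_meet].
Qed.

Let hit_patternE (t : pattern) : hit_pattern t =
  event (outside t, map (cell t.1.2) t.1.1).
Proof.
rewrite /hit_pattern /event/=; congr (_ `&` _).
elim: t.1.1 => [|q s IH]/=; first by rewrite set_nil bigcap_set0.
rewrite -IH predeqE => X; split=> [h|[h1 h2] q' /=].
  split; first by apply: h; rewrite /= mem_head.
  by move=> q' /= q's; apply: h; rewrite /= inE q's orbT.
by rewrite inE => /predU1P[->//|]; exact: h2.
Qed.

Let good_pattern (t : pattern) : good (outside t, map (cell t.1.2) t.1.1).
Proof.
split; first exact: outside_bounded_open.
by rewrite /=; elim: t.1.1 => //= q s IH; split => //; exact: cell_bounded_open.
Qed.

(** Each event in the countable union of [hard_coreC] has probability 0 under all [P n], and its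
    probabilities converge to that under [Q]. *)
Let Q_hard_core : Q (~` @hard_core R d) = 0%E.
Proof.
apply/eqP; rewrite -measure_le0 hard_coreC bigcup_mkcond.
pose A p : set conf := if p \in @overlapping_pairs R d
  then ~` void (rball p.1) `&` ~` void (rball p.2) else set0.
have QA p : Q (A p) = 0%E.
  rewrite /A; case: ifPn => [/set_mem hp|_]; last exact: measure0.
  have [mB cB] : conv (event (set0, [:: rball p.1; rball p.2])).
    apply: conv_event; split; first split.
    - exact: bounded_setS (@sub0set _ (rball p.1)) (rball_bounded_open p.1).1.
    - exact: open0.
    by split; [exact: rball_bounded_open|split=> //; exact: rball_bounded_open].
  have eqB : event (set0, [:: rball p.1; rball p.2]) =
      ~` void (rball p.1) `&` ~` void (rball p.2).
    rewrite /event/= setIT (_ : void set0 = setT) ?setTI//.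
    by rewrite predeqE => X; rewrite /void/= setI0.
  rewrite eqB in mB cB.
  have P0 n : P n (~` void (rball p.1) `&` ~` void (rball p.2)) = 0%E.
    apply/eqP; rewrite -measure_le0 -(P_hard_core n); apply: le_measure; rewrite ?inE//.
      exact: measurable_hard_coreC.
    by rewrite hard_coreC => X pX; exists p.
  rewrite fine_probabilityE//; congr EFin.
  have : (fun n => fine (P n (~` void (rball p.1) `&` ~` void (rball p.2)))) = cst 0.
    by apply/funext => n; rewrite P0.
  by move=> e; move: cB; rewrite e => /(cvg_lim (@Rhausdorff R)) <-; exact: lim_cst.
have mA p : measurable (A p).
  rewrite /A; case: ifPn => // _; apply: measurableI; apply: measurableC;
    by apply: measurable_void_open; exact: rball_bounded_open.
pose B k : set conf :=
  if @choice.unpickle ((d.-tuple rat * nat) * (d.-tuple rat * nat))%type k is Some p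
  then A p else set0.
have mB k : measurable (B k) by rewrite /B; case: choice.unpickle.
apply: (@le_trans _ _ (Q (\bigcup_k B k))).
  apply: le_measure; rewrite ?inE.
  - by apply: countable_bigcupT_measurable; [exact: countableP|exact: mA].
  - exact: bigcupT_measurable.
  - by move=> X [p _ Ap]; exists (choice.pickle p) => //; rewrite /B choice.pickleK.
apply: (le_trans (@measure_sigma_subadditive _ _ _ Q _ _ mB (bigcupT_measurable _ mB) (@subset_refl _ _))).
rewrite eseries0// => k _ _; rewrite /B; case: choice.unpickle => [p|]; [exact: QA|exact: measure0].
Qed.

(** Up to null sets of configurations violating the hard core, [O] is a countable union of hit
    patterns; a finite part carries almost all of [Q O], and its probabilities converge. *)
Let liminf_open (O : set conf) (e : R) : open O -> 0 < e ->
  \forall n \near \oo, fine (Q O) - e < fine (P n O).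
Proof.
move=> oO e0; have mO := open_configuration_measurable oO.
pose TO := [set t : pattern | count_pattern t `<=` O /\
  t.1.2.+1%:R^-1 < ((@unit_volume_radius R d)%:num : R)].
pose B k : set conf := if @choice.unpickle pattern k is Some t then
  (if t \in TO then hit_pattern t else set0) else set0.
have mB k : measurable (B k).
  rewrite /B; case: choice.unpickle => // t; case: ifPn => // _; exact: measurable_hit_pattern.
pose W k := \big[setU/set0]_(i < k) B i.
have WS k : W k.+1 = W k `|` B k by rewrite /W big_ord_recr.
have WP k : exists2 l, goods l & W k = union l.
  elim: k => [|k [l gl Wl]]; first by exists [::] => //; rewrite /W big_ord0.
  rewrite WS /B; case: choice.unpickle => [t|]; last by exists l; rewrite ?setU0.
  case: ifPn => _; last by exists l; rewrite ?setU0.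
  exists ((outside t, map (cell t.1.2) t.1.1) :: l) => /=; first by split => //; exact: good_pattern.
  by rewrite Wl hit_patternE setUC.
have cW k : conv (W k) by have [l gl ->] := WP k; exact: conv_union.
have WO k : W k `&` @hard_core R d `<=` O.
  elim: k => [|k IH]; first by rewrite /W big_ord0 set0I.
  rewrite WS setIUl subUset; split => //.
  rewrite /B; case: choice.unpickle => [t|]; last by rewrite set0I.
  case: ifPn => [/set_mem[tO tr]|_]; last by rewrite set0I.
  by apply: subset_trans tO; exact: hit_count_pattern.
have mH := @measurable_hard_core R d.
have OW : O `&` @hard_core R d `<=` \bigcup_k B k.
  move=> X [OX hX]; move: OX; rewrite {1}(open_pattern oO) => -[t tO tX].
  exists (choice.pickle t) => //; rewrite /B choice.pickleK mem_set//.
  case: tX => vX cX; split => // q qs vq; have := cX q qs; rewrite /= /count.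
  have -> : (X : set E) `&` cell t.1.2 q = set0 := vq.
  by rewrite fset_set0 cardfs0.
have null (P' : probability conf R) A : P' (~` @hard_core R d) = 0%E -> measurable A ->
    fine (P' A) = fine (P' (A `&` @hard_core R d)).
  move=> hP mA; have mAH : measurable (A `&` @hard_core R d) by exact: measurableI.
  apply/eqP; rewrite -subr_eq0 -(fine_probabilityD P' mA mAH (@subIsetl _ _ _)).
  rewrite (_ : P' _ = 0%E)//; apply/eqP; rewrite -measure_le0 -hP.
  apply: le_measure; rewrite ?inE.
  - exact: measurableD.
  - exact: measurableC.
  - by move=> X [AX h] hX; apply: h.
have e20 : 0 < e / 2 by rewrite divr_gt0.
have [k hk] : exists k, fine (Q O) - e / 2 < fine (Q (W k)).
  have mW k : measurable (W k) by exact: (cW k).1.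
  have mUW : measurable (\bigcup_k W k) by exact: bigcupT_measurable.
  have : (Q \o W) k @[k --> \oo] --> Q (\bigcup_k W k).
    apply: nondecreasing_cvg_mu => // i j ij; apply/subsetPset.
    exact: subset_bigsetU.
  rewrite fine_probabilityE//.
  move=> /fine_cvgP[_ /cvgrPdist_lt/(_ _ e20)][k _ /(_ k (leqnn k))/= hk].
  exists k; have : fine (Q O) <= fine (Q (\bigcup_k W k)).
    rewrite (null Q O)//; apply: le_fine_probability.
    - exact: measurableI.
    - exact: mUW.
    - by move=> X /OW[j _ Bj]; exists j.+1 => //; rewrite WS; right.
  move: hk; rewrite ltr_norml => /andP[_]; rewrite -/(W k); lra.
have [mW /cvgrPdist_lt/(_ _ e20) cWk] := cW k.
near=> n.
have h1 : `|fine (Q (W k)) - fine (P n (W k))| < e / 2 by near: n.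
have : fine (P n (W k)) <= fine (P n O).
  have mWH : measurable (W k `&` @hard_core R d) by exact: measurableI.
  rewrite (null (P n) (W k) (P_hard_core n) mW).
  exact: (le_fine_probability (P n) mWH mO (@WO k)).
move: h1; rewrite ltr_norml => /andP[_]; lra.
Unshelve. all: end_near. Qed.

Let staircase_expectation (P' : probability conf R) (F : conf -> R) K (h : R) :
  measurable_fun setT F ->
  P'.-integrable setT (EFin \o (fun X => staircase K h (F X))) /\
  \int[P']_X staircase K h (F X) =
    \sum_(i < K) h * fine (P' [set X | i.+1%:R * h < F X]).
Proof.
move=> mF.
have mO (i : nat) : measurable [set X | i.+1%:R * h < F X].
  rewrite (_ : [set X | _] = F @^-1` `]i.+1%:R * h, +oo[).
    by rewrite -[X in measurable X]setTI; exact: mF.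
  by rewrite predeqE => X /=; rewrite in_itv/= andbT.
have ind (i : nat) : (fun X => (i.+1%:R * h < F X)%R%:R) =
    (\1_[set X | i.+1%:R * h < F X] : conf -> R).
  by apply/funext => X; rewrite indicE /=; congr (_%:R); congr nat_of_bool;
    apply/idP/idP => [?|/set_mem//]; apply/mem_set.
have ii (i : nat) : P'.-integrable setT (EFin \o (fun X => (i.+1%:R * h < F X)%R%:R)).
  apply: (@bounded_integrable_probability _ _ _ _ _ 1).
    by rewrite ind; exact: measurable_indic.
  by move=> X; rewrite normr_nat lern1; case: (_ < _).
have iZ (i : nat) : P'.-integrable setT (EFin \o (fun X => h * (i.+1%:R * h < F X)%R%:R)).
  exact: (integrableZl measurableT h (ii i)).
elim: K => [|K [iK IK]].
  rewrite big_ord0 (_ : (fun X => _) = cst 0); last first.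
    by apply/funext => X; rewrite /staircase big_ord0.
  split; last by rewrite Rintegral_cst// mul0r.
  by apply: (@bounded_integrable_probability _ _ _ _ _ 0) => // X; rewrite normr0.
have SE : (fun X => staircase K.+1 h (F X)) =
    (fun X => staircase K h (F X) + h * (K.+1%:R * h < F X)%R%:R).
  by apply/funext => X; rewrite staircaseS.
split; rewrite SE; first exact: (integrableD measurableT iK (iZ K)).
rewrite RintegralD// IK RintegralZl// big_ord_recr/=; congr (_ + h * _).
by rewrite ind expectation_indic.
Qed.

Let liminf_expectation (F : conf -> R) (M e : R) : continuous F ->
  (forall X, 0 <= F X) -> (forall X, F X <= M) -> 0 < e ->
  \forall n \near \oo, \int[Q]_X F X - e < \int[P n]_X F X.
Proof.
move=> cF F0 FM e0; have mF := continuous_configuration_measurable cF.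
have iF (P' : probability conf R) : P'.-integrable setT (EFin \o F).
  by apply: (@bounded_integrable_probability _ _ _ _ _ M) => // X; rewrite ger0_norm.
(* The error is split in two: the step height [h = e / 2] of the staircase, and [K * h * a = e / 2]
   for the [K] open level sets. *)
pose h := e / 2; have h0 : 0 < h by rewrite divr_gt0.
pose K := (Num.truncn (M / h)).+1.
have MK : M <= K%:R * h by rewrite -ler_pdivrMr// ltW// truncnS_gt.
pose O (i : nat) := [set X | i.+1%:R * h < F X].
have oO i : open (O i).
  rewrite (_ : O i = F @^-1` `]i.+1%:R * h, +oo[).
    by apply: open_comp; [move=> ? _; exact: cF|exact: interval_open].
  by rewrite predeqE => X /=; rewrite in_itv/= andbT.
pose a := e / 2 / (K%:R * h).
have Kh0 : 0 < K%:R * h by rewrite mulr_gt0.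
have a0 : 0 < a by rewrite !divr_gt0.
have near_all : \forall n \near \oo, forall i : 'I_K,
    fine (Q (O i)) - a < fine (P n (O i)).
  by apply: filter_forall => i; apply: liminf_open.
near=> n.
have hn : forall i : 'I_K, fine (Q (O i)) - a < fine (P n (O i)) by near: n.
have [iSP SP] := staircase_expectation (P n) K h mF.
have [iSQ SQ] := staircase_expectation Q K h mF.
have lowP : \sum_(i < K) h * fine (P n (O i)) <= \int[P n]_X F X.
  rewrite -SP; apply: le_Rintegral => //; first exact: iF.
  by move=> X _; apply: staircase_le => //; exact: ltW.
have upQ : \int[Q]_X F X <= h + \sum_(i < K) h * fine (Q (O i)).
  rewrite -SQ.
  have ih : Q.-integrable setT (EFin \o (cst h : conf -> R)).
    by apply: (@bounded_integrable_probability _ _ _ _ _ `|h|).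
  rewrite -[X in X + _](expectation_cst Q) -RintegralD//; apply: le_Rintegral => //.
  - exact: iF.
  - exact: (integrableD measurableT ih iSQ).
  move=> X _; apply: le_staircase; first exact: ltW.
  exact: le_trans (FM X) MK.
have K0 : (0 < K)%N by [].
have mid : \sum_(i < K) h * fine (Q (O i)) - e / 2 < \sum_(i < K) h * fine (P n (O i)).
  rewrite -(_ : \sum_(i < K) h * a = e / 2); last first.
    by rewrite sumr_const card_ord -(mulr_natl (h * a)) [LHS]mulrA [LHS]mulrC divfK// gt_eqF.
  rewrite -sumrB; apply: ltr_sum => [|i _].
    by apply/hasP; exists (Ordinal K0); rewrite ?mem_index_enum.
  by rewrite -mulrBr ltr_pM2l.
rewrite /h in upQ; lra.
Unshelve. all: end_near. Qed.

Lemma weak_limit_void : weak_limit P Q.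
Proof.
move=> F cF [M FM]; have mF := continuous_configuration_measurable cF.
have iF (P' : probability conf R) : P'.-integrable setT (EFin \o F).
  exact: (@bounded_integrable_probability _ _ _ _ _ M).
have IE (P' : probability conf R) : (\int[P']_X (F X)%:E = (\int[P']_X F X)%:E)%E.
  by rewrite /Rintegral fineK//; exact: (integrable_fin_num measurableT (iF P')).
rewrite IE; under eq_fun do rewrite IE.
apply: cvg_EFin; first by apply: nearW.
rewrite (_ : fine \o _ = fun n => \int[P n]_X F X) //.
apply/cvgrPdist_lt => e e0.
have ic (P' : probability conf R) : P'.-integrable setT (EFin \o (cst M : conf -> R)).
  by apply: (@bounded_integrable_probability _ _ _ _ _ `|M|).
have cM : continuous (cst M : conf -> R) by exact: cst_continuous.
have c1 : continuous (fun X => F X + cst M X) by move=> X; exact: (cvgD (cF X) (cM X)).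
have c2 : continuous (fun X => cst M X - F X) by move=> X; exact: (cvgB (cM X) (cF X)).
have E1 (P' : probability conf R) : \int[P']_X (F X + cst M X) = \int[P']_X F X + M.
  by rewrite (RintegralD measurableT) ?expectation_cst//; [exact: iF|exact: ic].
have E2 (P' : probability conf R) : \int[P']_X (cst M X - F X) = M - \int[P']_X F X.
  by rewrite (RintegralB measurableT) ?expectation_cst//; [exact: ic|exact: iF].
have b X : - M <= F X /\ F X <= M by apply/andP; rewrite -ler_norml.
(* [F + M] and [M - F] take values between 0 and [M + M]; their lower bounds control [F] from both
   sides. *)
have h1 := @liminf_expectation _ (M + M) e c1 _ _ e0.
have h2 := @liminf_expectation _ (M + M) e c2 _ _ e0.
near=> n.
have : \int[Q]_X (F X + cst M X) - e < \int[P n]_X (F X + cst M X).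
  by near: n; apply: h1 => X /=; have [? ?] := b X; lra.
have : \int[Q]_X (cst M X - F X) - e < \int[P n]_X (cst M X - F X).
  by near: n; apply: h2 => X /=; have [? ?] := b X; lra.
rewrite !E1 !E2 ltr_norml => l1 l2; apply/andP; split; lra.
Unshelve. all: end_near. Qed.

End weak_convergence.

(** * Uniqueness of the limit law *)

Section uniqueness.
Context {R : realType} {d : nat}.
Local Notation E := (euclidean R d).
Local Notation conf := (configuration R d).
Local Notation leb := (lebesgue_euclidean R d).

Lemma vague_coordinates_ge (f : test_function) (X : conf) (x : E) :
  (forall y, 0 <= sval f y) -> (X : set E) x -> sval f x <= vague_coordinates X f.
Proof.
move=> f0 Xx; rewrite /vague_coordinates.
have [K cK fK] : exists2 K, compact K & forall x, ~ K x -> sval f x = 0.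
  by have [_ ?] := svalP f.
have finXK : finite_set ((X : set E) `&` (K `|` [set x])).
  rewrite setIUr finite_setU; split; first exact/points_finite/compact_bounded.
  by apply: (@sub_finite_set _ _ [set x]); [exact: subIsetr|exact: finite_set1].
rewrite -(fsbig_widen ((X : set E) `&` (K `|` [set x])) (X : set E)).
- rewrite (fsbigD1 x)//=; last by split => //; right.
  by rewrite lerDl fsumr_ge0// => i [].
- by move=> y [].
- by move=> y [Xy nh] /=; apply: fK => Ky; apply: nh; split => //; left.
Qed.

(** A vaguely continuous substitute for the indicator of a void event: for [f >= 0] it is 1 when [X]
    avoids the points where [f] is nonzero, and 0 when [X] contains a point where [f] is 1. *)
Definition void_bump (f : @test_function R d) (X : conf) : R :=
  Num.max 0 (1 - vague_coordinates X f).

Lemma void_bump_continuous f : continuous (void_bump f).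
Proof.
move=> X; apply: (@continuous_comp _ _ _ (fun X : conf => vague_coordinates X f)
  (fun y : R => Num.max 0 (1 - y))); first exact: vague_coordinate_continuous.
apply: continuous_max; first exact: cst_continuous.
by apply: cvgB; [exact: cvg_cst|exact: cvg_id].
Qed.

Lemma test_function_between (K U : set E) : compact K -> bounded_open U -> K `<=` U ->
  exists f : @test_function R d, [/\ forall x, 0 <= sval f x,
    forall x, ~ U x -> sval f x = 0 & forall x, K x -> sval f x = 1].
Proof.
move=> cK [bU oU] KU.
have clK : closed K by apply: compact_closed; [exact: norm_hausdorff|].
have clU : closed (~` U) by exact: open_closedC.
have KU0 : ~` U `&` K = set0 by rewrite -subset0 => x [nU /KU].
have /(@uniform_separatorP _ R)[f [fc fr f0 f1]] :=
  (@normal_separatorP R E).1 (@pseudometric_normal R E) _ _ clU clK KU0.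
have fU x : ~ U x -> f x = 0 by move=> nU; apply: f0; exists x.
have fP : continuous f /\ exists2 K, compact K & forall x, ~ K x -> f x = 0.
  have [M M0 UM] := bounded_sub_ball bU.
  split => //; exists (closed_ball (0 : E) M).
    apply: euclidean_bounded_closed_compact; last exact: closed_ball_closed.
    apply: bounded_setS (bounded_ball 0 (M + 1)) => x; rewrite closed_ballE// eballE/=.
    by move=> /le_lt_trans; apply; rewrite ltrDl.
  by move=> x nM; apply: fU => /UM xM; apply: nM; exact: subset_closed_ball.
exists (exist _ f fP); split => //= x; last by move=> Kx; apply: f1; exists x.
by have /fr/= : range f (f x) by []; rewrite in_itv/= => /andP[].
Qed.

Lemma void_bump_between (P : probability conf R) (K U : set E) (f : @test_function R d) :
  measurable K -> measurable U -> bounded_set K -> bounded_set U ->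
  (forall x, 0 <= sval f x) ->
  (forall x, ~ U x -> sval f x = 0) -> (forall x, K x -> sval f x = 1) ->
  [/\ P.-integrable setT (EFin \o void_bump f),
    fine (P (void U)) <= \int[P]_X void_bump f X &
    \int[P]_X void_bump f X <= fine (P (void K))].
Proof.
move=> mK mU bK bU f0 fU fK.
have G0 X : 0 <= void_bump f X by rewrite le_max lexx.
have G1 X : void_bump f X <= 1.
  by rewrite ge_max ler01 lerBlDr lerDl; apply: fsumr_ge0 => x _; exact: f0.
have iG : P.-integrable setT (EFin \o void_bump f).
  apply: (@bounded_integrable_probability _ _ _ _ _ 1) => [|X].
    exact: (continuous_configuration_measurable (@void_bump_continuous f)).
  by rewrite ger0_norm.
have mV (B : set E) : measurable B -> bounded_set B -> measurable (void B : set conf).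
  by move=> mB bB; exact: measurable_void.
have i1 (B : set E) : measurable B -> bounded_set B ->
    P.-integrable setT (EFin \o (\1_(void B) : conf -> R)).
  move=> mB bB; apply: (@bounded_integrable_probability _ _ _ _ _ 1) => [|X].
    by apply: measurable_indic; exact: mV.
  by rewrite indicE normr_nat lern1; case: (_ \in _).
split => //.
- rewrite -expectation_indic; last exact: mV.
  apply: le_Rintegral => //; [exact: i1|move=> X _].
  rewrite indicE; case: (boolP (X \in void U)) => [/set_mem XU|_]; last exact: G0.
  rewrite /void_bump le_max; apply/orP; right.
  rewrite [vague_coordinates _ _]fsbig1 ?subr0// => x Xx; apply: fU => Ux.
  by have : ((X : set E) `&` U) x by []; rewrite XU.
- rewrite -expectation_indic; last exact: mV.
  apply: le_Rintegral => //; [exact: i1|move=> X _].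
  rewrite indicE; case: (boolP (X \in void K)) => [_|nXK]; first exact: G1.
  rewrite /void_bump ge_max lexx/= subr_le0.
  have /set0P[x [Xx Kx]] : (X : set E) `&` K != set0.
    by apply/eqP => XK; move: nXK; rewrite notin_setE; apply.
  by rewrite -(fK x Kx); exact: vague_coordinates_ge.
Qed.

Variables (P : nat -> probability conf R) (Q : probability conf R).
Variables (p : set E -> R) (lam : R).
Hypothesis PQ : weak_limit P Q.
Hypothesis P_void : forall B : set E, bounded_set B -> measurable B ->
  fine (P n (void B)) @[n --> \oo] --> p B.
Hypothesis P_void_ge : forall n (B : set E), bounded_set B -> measurable B ->
  1 - lam * fine (leb B) <= fine (P n (void B)).

(** Avoiding [U] means avoiding both [K] and [U] minus [K]; the union of these two events has
    probability at most 1, and the second has probability at least [1 - lam] times the volume. *)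
Let void_limit_le (K U : set E) : measurable K -> measurable U -> bounded_set U ->
  K `<=` U -> p K <= p U + lam * fine (leb (U `\` K)).
Proof.
move=> mK mU bU KU; have bK := bounded_setS KU bU.
have mUK : measurable (U `\` K) by exact: measurableD.
have bUK : bounded_set (U `\` K) by apply: bounded_setS bU; exact: subDsetl.
apply: (ler_cvg_to (P_void bK mK)
  (cvgD (P_void bU mU) (cvg_cst (lam * fine (leb (U `\` K)))))).
apply: nearW => n.
rewrite -[leRHS]/(fine (P n (void U)) + lam * fine (leb (U `\` K))).
have mV (B : set E) : measurable B -> bounded_set B -> measurable (void B : set conf).
  by move=> mB bB; exact: measurable_void.
have := @fine_probabilityU _ _ _ (P n) _ _ (mV _ mK bK) (mV _ mUK bUK).
rewrite voidU setDUK//.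
have : fine (P n (void K `|` void (U `\` K))) <= 1.
  have mKUK : measurable (void K `|` void (U `\` K) : set conf).
    by apply: measurableU; exact: mV.
  by rewrite -lee_fin -fine_probabilityE// probability_le1.
have := P_void_ge n bUK mUK.
lra.
Qed.

(** The continuous [void_bump] lies between the indicators of [void U] and [void (K m)], which
    transfers the limit to [Q] up to an error vanishing with the volume of [U] minus [K m]; moreover
    [void U] is the intersection of the [void (K m)]. *)
Lemma weak_limit_void_limit U : bounded_open U -> Q (void U) = (p U)%:E.
Proof.
move=> bUo; have [bU oU] := bUo; have mU := open_euclidean_measurable oU.
have [K [cK KU KK UK lebK]] := compact_exhaustion bUo.
have mK m : measurable (K m).
  apply: closed_euclidean_measurable; apply: compact_closed; last exact: cK.
  exact: norm_hausdorff.
have bK m : bounded_set (K m) by exact: bounded_setS (KU m) bU.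
have mV (B : set E) : measurable B -> bounded_set B -> measurable (void B : set conf).
  by move=> mB bB; exact: measurable_void.
rewrite fine_probabilityE; last exact: mV.
have between m : p U <= fine (Q (void (K m))) /\
    fine (Q (void U)) <= p U + lam * fine (leb (U `\` K m)).
  have [f [f0 fU fK]] := test_function_between (cK m) bUo (KU m).
  have B P' := @void_bump_between P' _ _ f (mK m) mU (bK m) bU f0 fU fK.
  have [iQ Q1 Q2] := B Q.
  have IE (P' : probability conf R) :
      (\int[P']_X (void_bump f X)%:E = (\int[P']_X void_bump f X)%:E)%E.
    have [iP _ _] := B P'.
    by rewrite /Rintegral fineK//; exact: (integrable_fin_num measurableT iP).
  have PG : \int[P n]_X void_bump f X @[n --> \oo] --> \int[Q]_X void_bump f X.
    have := PQ (@void_bump_continuous f); rewrite IE => h; apply: fine_cvg; apply: h.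
    exists 1 => X; rewrite ger0_norm ?le_max ?lexx//.
    by rewrite ge_max ler01 lerBlDr lerDl; apply: fsumr_ge0 => x _; exact: f0.
  split.
    apply: le_trans Q2; apply: (ler_cvg_to (P_void bU mU) PG).
    by apply: nearW => n; have [] := B (P n).
  apply: (le_trans Q1); apply: le_trans (void_limit_le (mK m) mU bU (KU m)).
  apply: (ler_cvg_to PG (P_void (bK m) (mK m))).
  by apply: nearW => n; have [] := B (P n).
congr EFin; apply/eqP; rewrite eq_le; apply/andP; split.
  have h : (p U + lam * fine (leb (U `\` K m))) @[m --> \oo] --> p U + lam * 0.
    by apply: cvgD; [exact: cvg_cst|apply: cvgM => //; exact: cvg_cst].
  rewrite -[leRHS]addr0 -[X in _ + X](mulr0 lam).
  apply: (ler_cvg_to (cvg_cst (fine (Q (void U)))) h).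
  by apply: nearW => m; have [] := between m.
have : (Q \o (fun m => void (K m))) m @[m --> \oo] --> Q (\bigcap_m void (K m)).
  apply: nonincreasing_cvg_mu.
  - by rewrite (le_lt_trans (probability_le1 Q _)) ?ltry//; exact: mV.
  - by move=> m; exact: mV.
  - by apply: bigcapT_measurable => m; exact: mV.
  - move=> m n mn; apply/subsetPset => X; rewrite /void/= -!subset0 => h x [Xx Kx].
    by apply: (h x); split => //; exact: KK Kx.
rewrite (_ : \bigcap_m _ = void U); last first.
  rewrite predeqE => X; rewrite /void/=; split=> h.
    rewrite -subset0 => x [Xx /UK[m _ Kx]].
    by rewrite -(h m Logic.I).
  by move=> m _; rewrite -subset0 -h => x [Xx /KU].
rewrite fine_probabilityE; last exact: mV.
move=> /fine_cvg h; apply: (ler_cvg_to (cvg_cst (p U)) h).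
by apply: nearW => m; have [] := between m.
Qed.

End uniqueness.

(** * Van Hove sequences *)

Section van_hove_sequences.
Context {R : realType} {d : nat}.
Local Notation E := (euclidean R d).
Local Notation r := ((@unit_volume_radius R d)%:num : R).
Local Notation leb := (lebesgue_euclidean R d).

Lemma edist_inf_lt_witness (A : set E) (x : E) (s : R) : (edist_inf A x < s%:E)%E ->
  exists2 y, A y & `|x - y| < s.
Proof.
move=> /ereal_inf_lt[_ [y Ay <-]] /edist_lt_ball; rewrite eballE/=; by exists y.
Qed.

Lemma ball_sub_inner_region (L : set E) (M : R) :
  ball (0 : E) (M + r) `<=` L -> ball (0 : E) M `<=` inner_region L.
Proof.
move=> ML x; rewrite eballE/= => xM; split.
  by apply: ML; rewrite eballE/=; apply: (lt_trans xM); rewrite ltrDl.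
rewrite leNgt; apply/negP => /edist_inf_lt_witness[y nLy xy]; apply: nLy; apply: ML.
rewrite eballE/= -(subrK x 0) -addrA (le_lt_trans (ler_normD _ _))//.
by rewrite ltrD.
Qed.

Lemma boundary_ball (s : R) (y : E) : boundary (ball (0 : E) s) y -> `|y| = s.
Proof.
move=> [cy iy]; apply/eqP; rewrite eq_le; apply/andP; split.
  apply/ler_addgt0Pr => e e0.
  have [z []] := cy _ (nbhsx_ballx y e e0); rewrite !eballE/= sub0r normrN => zs yz.
  rewrite -(subrK z y) (le_trans (ler_normD _ _))// addrC lerD// ltW//.
rewrite leNgt; apply/negP => ys; apply: iy.
apply: open_nbhs_nbhs; split; first exact: ball_open.
by rewrite eballE/= sub0r normrN.
Qed.

(** The factor 2 is slack: from an infimum distance at most [l], a boundary point at distance less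
    than [2 * l] is extracted without discussing attainment. *)
Lemma boundary_neighbourhood_ball (s l : R) : 0 < l -> 2 * l < s ->
  (leb [set x | (edist_inf (boundary (ball (0%R : E) s)) x <= l%:E)%E] <=
    leb (ball (0%R : E) (s + 2 * l)%R `\` ball (0%R : E) (s - 2 * l)%R))%E.
Proof.
move=> l0 ls; apply: le_measure; rewrite ?inE.
- apply: closed_euclidean_measurable.
  rewrite (_ : [set _ | _] = edist_inf (boundary (ball (0 : E) s)) @^-1`
    [set y | (y <= l%:E)%E])//.
  apply: closed_comp => [x _|]; first exact: edist_inf_continuous.
  exact: closed_ereal_ge_ereal.
- by apply: measurableD; exact: eball_measurable.
move=> x /= xl; have [y /boundary_ball ys xy] : exists2 y,
    boundary (ball (0 : E) s) y & `|x - y| < 2 * l.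
  apply: edist_inf_lt_witness; apply: le_lt_trans xl _.
  by rewrite lte_fin mulrDl mul1r ltrDl.
have h1 : `|x| <= `|x - y| + `|y| by rewrite -{1}(subrK y x) ler_normD.
have h2 : `|y| <= `|x - y| + `|x|.
  by rewrite -{1}(subrK x y) distrC ler_normD.
rewrite !eballE/= sub0r normrN; split; first by lra.
by apply/negP; rewrite -leNgt; lra.
Qed.

Lemma van_hove_balls : van_hove (fun n => ball (0 : E) n.+1%:R).
Proof.
split.
- by move=> n; split; [exact: bounded_ball|exact: eball_measurable].
- move=> B /bounded_sub_ball[M M0 BM]; exists (Num.truncn M) => // n /= Mn x /BM.
  rewrite !eballE/= => /lt_le_trans; apply; apply/ltW/(lt_le_trans (truncnS_gt M)).
  by rewrite ler_nat ltnS.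
move=> l l0; apply/eqoP => _/posnumP[e] /=.
set V := fine (leb (ball (0 : E) 1)).
have ballV s : 0 < s -> leb (ball (0 : E) s) = (s ^+ d * V)%:E.
  move=> s0; rewrite lebesgue_euclidean_ball// EFinM /V fineK//.
  by rewrite ge0_fin_numE// lebesgue_ball_lty.
have V0 : 0 <= V by exact: fine_ge0.
(* The annulus has [g (2 * l / s)] times the volume of the ball of radius [s], and [g] is continuous
   with value 0 at 0. *)
pose g (q : R) : R := (1 + q) ^+ d - (1 - q) ^+ d.
have g_small : \forall n \near \oo, g (2 * l * n.+1%:R^-1) < e%:num.
  have cg : continuous g.
    have cX (f : R -> R) : continuous f -> continuous (fun q => f q ^+ d).
      move=> cf q; apply: (@continuous_comp _ _ _ f (fun z => z ^+ d)); first exact: cf.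
      exact: exprn_continuous.
    have c1 : continuous (fun q : R => 1 + q).
      by move=> q; apply: cvgD; [exact: cvg_cst|exact: cvg_id].
    have c2 : continuous (fun q : R => 1 - q).
      by move=> q; apply: cvgB; [exact: cvg_cst|exact: cvg_id].
    by move=> q; exact: (cvgB (cX _ c1 q) (cX _ c2 q)).
  have : g (2 * l * n.+1%:R^-1) @[n --> \oo] --> g (2 * l * 0).
    apply: continuous_cvg; first exact: cg.
    by apply: cvgM; [exact: cvg_cst|exact: cvg_harmonic].
  have -> : g (2 * l * 0) = 0 by rewrite /g mulr0 addr0 subr0 subrr.
  move=> /cvgrPdist_lt/(_ e%:num (gt0 e)); apply: filterS => n.
  by rewrite sub0r normrN; apply: le_lt_trans; exact: ler_norm.
near=> n.
have gn : g (2 * l * n.+1%:R^-1) < e%:num by near: n.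
pose s : R := n.+1%:R; have s0 : 0 < s by rewrite ltr0n.
have ls : 2 * l < s.
  apply: (@le_lt_trans _ _ n%:R); last by rewrite ltr_nat.
  by near: n; exact: nbhs_infty_ger.
rewrite -/s ger0_norm ?fine_ge0// [X in _ * X]ger0_norm ?fine_ge0// ballV//=.
have sl0 : 0 < s - 2 * l by rewrite subr_gt0.
have sl1 : 0 < s + 2 * l by rewrite addr_gt0// mulr_gt0.
have volD : leb (ball (0 : E) (s + 2 * l) `\` ball (0 : E) (s - 2 * l)) =
    ((s ^+ d * g (2 * l * s^-1)) * V)%:E.
  rewrite measureD ?ballV//; last 3 first.
  - exact: eball_measurable.
  - exact: eball_measurable.
  - exact: lebesgue_ball_lty.
  rewrite setIidr; last first.
    by move=> x; rewrite !eballE/= => /lt_trans; apply; lra.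
  rewrite [LHS](_ : _ = leb (ball (0%R : E) (s + 2 * l)%R) -
    leb (ball (0%R : E) (s - 2 * l)%R))%E// !ballV// -EFinB -mulrBl.
  congr (_ * _)%:E.
  rewrite /g mulrBr -!exprMn; congr (_ ^+ _ - _ ^+ _);
    by rewrite mulrDr mulr1 ?mulrN mulrCA divff ?gt_eqF// mulr1.
have := boundary_neighbourhood_ball l0 ls; rewrite volD => h.
apply: (@le_trans _ _ (s ^+ d * g (2 * l * s^-1) * V)).
  rewrite -lee_fin fineK// ge0_fin_numE//; apply: le_lt_trans h _; exact: ltry.
rewrite mulrA ler_wpM2r// [leRHS]mulrC ler_wpM2l ?exprn_ge0 ?(ltW s0)//.
exact: ltW.
Unshelve. all: end_near. Qed.

End van_hove_sequences.

(** * Uniqueness below the threshold and the critical fugacity *)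

Section uniqueness_regime.
Context {R : realType} {d : nat}.
Hypothesis d0 : (0 < d)%N.
Local Notation E := (euclidean R d).
Local Notation leb := (lebesgue_euclidean R d).
Variable lam : {nonneg R}.
Hypothesis lam_small : lam%:num * 2 ^+ d / 2 < 1.

Let P_void (L : nat -> set E) (B : set E) : van_hove L -> bounded_set B ->
  measurable B ->
  fine (hard_sphere lam (L n) (void B)) @[n --> \oo] --> void_limit lam%:num B.
Proof.
move=> [bL xL _] bB mB.
rewrite (_ : (fun n => _) = fun n => avoid leb overlap lam%:num (inner_region (L n)) B).
  apply: avoid_cvg => // [n|M]; first exact: finite_region_inner (bL n).1.
  have /xL := @bounded_ball R d 0 (M + (@unit_volume_radius R d)%:num).
  by apply: filterS => n; exact: ball_sub_inner_region.
by apply/funext => n; rewrite hard_sphere_void//; exact: (bL n).1.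
Qed.

Let P_void_ge (L : nat -> set E) n (B : set E) : van_hove L -> bounded_set B ->
  measurable B ->
  1 - lam%:num * fine (leb B) <= fine (hard_sphere lam (L n) (void B)).
Proof.
move=> [bL _ _] bB mB; rewrite hard_sphere_void//; last exact: (bL n).1.
by apply: avoid_ge_volume => //; exact: finite_region_inner (bL n).1.
Qed.

Lemma unique_infinite_volume_limit_small : @unique_infinite_volume_limit R d lam.
Proof.
have vB := @van_hove_balls R d.
pose P n := hard_sphere lam (ball (0 : E) n.+1%:R).
have PH n : P n (~` @hard_core R d) = 0%E.
  by apply: hard_sphere_hard_core; exact: bounded_ball.
have [Q QE] := @exists_void_limit_probability R d P (void_limit lam%:num) lam%:num
  (ge0 lam) PH (fun B => P_void vB) (fun n B => P_void_ge n vB).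
exists Q.
  exists (fun n => ball (0 : E) n.+1%:R) => //.
  apply: (weak_limit_void PH) => V bV.
  have mV : measurable V by apply: open_euclidean_measurable; exact: bV.2.
  by rewrite QE//; exact: (P_void vB bV.1 mV).
move=> Q' [L vL wL] A mA.
(* The pi-system of void events contains the whole space as [void set0], which serves as the
   constant cover. *)
apply: (@measure_unique _ _ _ (@void_opens R d) (fun=> setT)) => //.
- exact: measurable_configuration_void.
- exact: void_opens_setI_closed.
- move=> _; exists set0.
    by split; [exact: bounded_setS (@sub0set _ _) (bounded_ball 0 0)|exact: open0].
  by rewrite predeqE => X; rewrite /void/= setI0.
- by rewrite predeqE => X; split => // _; exists 0%N.
- move=> _ [U bU ->]; apply: etrans (esym (QE U bU)).
  exact: (weak_limit_void_limit wL (fun B => P_void vL) (fun n B => P_void_ge n vL) bU).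
- by move=> _; rewrite (le_lt_trans (probability_le1 Q' measurableT))// ltry.
Qed.

End uniqueness_regime.

Theorem theorem1p1 (R : realType) (d : nat) (hd : (2 <= d)%N) :
  (((2 : R) ^ (1 - d%:Z))%:E <= critical_fugacity R d)%E.
Proof.
have d0 : (0 < d)%N by exact: leq_trans hd.
set c : R := 2 ^ (1 - d%:Z).
(* [c] is the fugacity at which the contraction factor equals 1. *)
have cE : c * 2 ^+ d / 2 = 1.
  by rewrite /c exprnP -expfzDr ?pnatr_eq0// subrK expr1z divff ?pnatr_eq0.
have c0 : 0 <= c by rewrite exprz_ge0.
apply/lee_addgt0Pr => e e0; rewrite -leeBlDr// -EFinB.
(* The witness is [c - e], cut off at 0 because a fugacity is nonnegative. *)
have m0 : 0 <= Num.max 0 (c - e) by rewrite le_max lexx.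
have mc : Num.max 0 (c - e) < c.
  rewrite gt_max ltrBlDr ltrDl e0 andbT lt_neqAle c0 andbT eq_sym.
  by apply/eqP => c00; move: cE; rewrite c00 !mul0r => /eqP; rewrite eq_sym oner_eq0.
apply: (@le_trans _ _ (Num.max 0 (c - e))%:E); first by rewrite lee_fin le_max lexx orbT.
apply: ereal_sup_ubound; exists (NngNum m0) => //=.
apply: unique_infinite_volume_limit_small => //=.
by rewrite -[ltRHS]cE !ltr_pM2r ?invr_gt0 ?exprn_gt0.
Qed.
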